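(* Let $r\ge 1$ be an integer, let $\lambda=(\lambda_1\ge\dots\ge\lambda_r)\in\mathbb Z_{\ge0}^{r}$ and let $g\in SO_{2r+1}(\mathbb C)$. Put $\ell=\lambda+\rho$, i.e. $\ell_i=\lambda_i+r+\tfrac12-i$. Then $$\sum_{\sigma\in\mathfrak W}(-1)^\sigma g^{\sigma\ell}=\chi_\lambda(g)\cdot\sum_{\sigma\in\mathfrak W}(-1)^\sigma g^{\sigma\rho};$$ equivalently, $$\bigwedge_{i=1}^{r}\left(g^{\ell_i}-g^{-\ell_i}\right)=\chi_\lambda(g)\cdot\bigwedge_{i=1}^{r}\left(g^{r+1/2-i}-g^{-(r+1/2-i)}\right),$$ where the powers are defined using any, but always the same, value of $\sqrt g\in SO_{2r+1}(\mathbb C)$.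
   Context: $SO_{2r+1}(\mathbb C)$ is the connected group (determinant $1$) of linear transformations of $\mathbb C^{2r+1}$, with coordinates ordered $(x_1,y_1,\dots,x_r,y_r,z)$, preserving the quadratic form $x_1y_1+\dots+x_ry_r+z^2$. Its maximal torus $H$ consists of the matrices $\mathrm{diag}(z_1,z_1^{-1},\dots,z_r,z_r^{-1},1)$; the weight lattice of $H$ is $\mathbb Z^r$, with $\lambda=(\lambda_1,\dots,\lambda_r)$ corresponding to the character $\prod_j z_j^{\lambda_j}$. The half-sum of the positive roots is $\rho=(r-\tfrac12,r-\tfrac32,\dots,\tfrac32,\tfrac12)$ (positive roots: $e_i\pm e_j$ for $i<j$, and $e_i$, where $e_1,\dots,e_r$ is the standard basis of $\mathbb Z^r$). $\chi_\lambda$ is the character of the irreducible representation of $SO_{2r+1}(\mathbb C)$ with highest weight $\lambda$. The Weyl group $\mathfrak W$ is the semidirect product of $\mathfrak S_r$ and $(\mathbb Z/2)^r$, acting on $r$-tuples by permutations of the coordinates and arbitrary sign changes; $(-1)^\sigma$ is the determinant of $\sigma$ acting on $\mathbb R^r$. A value of $\sqrt g$ is an element $h\in SO_{2r+1}(\mathbb C)$ with $h^2=g$; given this choice, $g^{s}=h^{2s}$ for $s\in\mathbb Z+\tfrac12$. For $\ell\in(\mathbb Z+\tfrac12)^r$, $g^\ell=g^{\ell_1}\otimes\dots\otimes g^{\ell_r}\in M_{2r+1}(\mathbb C)^{\otimes r}$, where $M_{2r+1}(\mathbb C)$ is the space of $(2r+1)\times(2r+1)$ complex matrices. The wedge product is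 the antisymmetrized tensor $\bigwedge_{i=1}^rA_i=\sum_{\tau\in\mathfrak S_r}(-1)^\tau A_{\tau(1)}\otimes\dots\otimes A_{\tau(r)}$, where $(-1)^\tau$ is the sign of $\tau$ and the factors are elements of the vector space $M_{2r+1}(\mathbb C)$; thus $\sum_{\sigma\in\mathfrak W}(-1)^\sigma g^{\sigma\ell}=\bigwedge_{i=1}^r(g^{\ell_i}-g^{-\ell_i})$. *)

(* Defs.v *)
From mathcomp Require Import all_boot all_order all_fingroup all_algebra.
From mathcomp Require Import complex reals.
From mathcomp Require Import mpoly.

Set Implicit Arguments.
Unset Strict Implicit.
Unset Printing Implicit Defensive.

Import GRing.Theory.
Local Open Scope ring_scope.

(* The coordinates (x_1, y_1, ..., x_r, y_r, z) are numbered from 0, so that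
   x_k, y_k (with k : 'I_r) and z sit at 2k, 2k + 1 and 2r. *)
Definition x_idx (r : nat) (k : 'I_r) : 'I_(r.*2.+1) := inord k.*2.
Definition y_idx (r : nat) (k : 'I_r) : 'I_(r.*2.+1) := inord k.*2.+1.
Definition z_idx (r : nat) : 'I_(r.*2.+1) := ord_max.

Section OddOrthogonal.
Variables (K : fieldType) (r : nat).
Local Notation n := (r.*2.+1).

Definition quad_form (v : 'cV[K]_n) : K :=
  \sum_(k < r) v (x_idx k) 0 * v (y_idx k) 0 + v (z_idx r) 0 ^+ 2.

Definition in_SO (g : 'M[K]_n) : Prop :=
  (forall v : 'cV[K]_n, quad_form (g *m v) = quad_form v) /\ \det g = 1.

Definition torus (t : 'I_r -> K) : 'M[K]_n :=
  \sum_(k < r) (t k *: delta_mx (x_idx k) (x_idx k)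
                + (t k)^-1 *: delta_mx (y_idx k) (y_idx k))
  + delta_mx (z_idx r) (z_idx r).

(* Regular functions on the closed subvariety SO of the space of matrices. *)
Definition regular_on_SO (f : 'M[K]_n -> K) : Prop :=
  exists p : {mpoly K[n * n]},
    forall g, in_SO g -> f g = p.@[fun k => mxvec g 0 k].

(* Finite-dimensional algebraic representations, acting on column vectors;
   the values of so_map outside SO are irrelevant. *)
Record so_rep := SORep {
  so_dim : nat;
  so_map :> 'M[K]_n -> 'M[K]_so_dim;
  so_map1 : so_map 1%:M = 1%:M;
  so_mapM : forall g h, in_SO g -> in_SO h ->
              so_map (g *m h) = so_map g *m so_map h;
  so_map_regular : forall i j, regular_on_SO (fun g => so_map g i j)
}.

Definition character (V : so_rep) (g : 'M[K]_n) : K := \tr (V g).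

(* A subspace of column vectors is encoded by the row space of a matrix U,
   hence the transpose. *)
Definition irreducible_rep (V : so_rep) : Prop :=
  (0 < so_dim V)%N /\
  forall U : 'M[K]_(so_dim V),
    (forall g, in_SO g -> stablemx U (V g)^T) -> U = 0 \/ row_full U.

Definition is_weight (V : so_rep) (mu : 'rV[int]_r) : Prop :=
  exists2 v : 'cV[K]_(so_dim V), v != 0 &
    forall t : 'I_r -> K, (forall j, t j != 0) ->
      V (torus t) *m v = (\prod_(j < r) t j ^ mu 0 j) *: v.

Definition basis_wt (i : 'I_r) : 'rV[int]_r := delta_mx 0 i.

Definition pos_root (a : 'rV[int]_r) : Prop :=
  (exists i j : 'I_r, (i < j)%N /\
     (a = basis_wt i + basis_wt j \/ a = basis_wt i - basis_wt j))
  \/ (exists i : 'I_r, a = basis_wt i).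

Definition weight_le (mu lam : 'rV[int]_r) : Prop :=
  exists2 s : seq 'rV[int]_r,
    (forall a, a \in s -> pos_root a) & lam - mu = \sum_(a <- s) a.

Definition highest_weight (V : so_rep) (lam : 'rV[int]_r) : Prop :=
  is_weight V lam /\ forall mu, is_weight V mu -> weight_le mu lam.

(* [h] plays the role of the chosen square root of g and s is a half-integer,
   so that g^s = h^(2s) and numq (2s) is the integer 2s. *)
Definition half_pow (h : 'M[K]_n) (s : rat) : 'M[K]_n := h ^ numq (2 * s).

(* The r-th tensor power of the matrix space, in coordinates with respect to
   the basis of tensor products of elementary matrices: an index
   p : {ffun 'I_r -> 'I_n * 'I_n} stands for
   E_(p 0) (x) ... (x) E_(p (r - 1)). *)
Definition tensor := {ffun {ffun 'I_r -> 'I_n * 'I_n} -> K^o}.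

Definition pure_tensor (A : 'I_r -> 'M[K]_n) : tensor :=
  [ffun p : {ffun 'I_r -> 'I_n * 'I_n} => \prod_(k < r) A k (p k).1 (p k).2].

Definition wedge (A : 'I_r -> 'M[K]_n) : tensor :=
  \sum_(t : 'S_r) (-1) ^+ t *: pure_tensor (fun k => A (t k)).

Definition tensor_pow (h : 'M[K]_n) (l : 'rV[rat]_r) : tensor :=
  pure_tensor (fun i => half_pow h (l 0 i)).

End OddOrthogonal.

Definition rho (r : nat) : 'rV[rat]_r :=
  \row_(i < r) (r%:R + 2^-1 - i.+1%:R).

(* The pair (p, e) stands for the signed permutation that permutes the
   coordinates by p and then changes the signs of those i with e i = true. *)
Definition weyl (r : nat) : finType := ('S_r * {ffun 'I_r -> bool})%type.

Definition weyl_act (A : pzRingType) (r : nat) (s : weyl r) (l : 'rV[A]_r) :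
    'rV[A]_r :=
  \row_(i < r) ((-1) ^+ s.2 i * l 0 (s.1 i)).

Definition weyl_sign (r : nat) (s : weyl r) : int :=
  \det (lin1_mx (@weyl_act int r s)).

Definition weyl_sum (K : fieldType) (r : nat) (h : 'M[K]_(r.*2.+1))
    (l : 'rV[rat]_r) : tensor K r :=
  \sum_(s : weyl r) tensor_pow h (weyl_act s l) *~ weyl_sign s.

(* Main.v *)
Require Import Defs.
From mathcomp Require Import all_boot all_order all_fingroup all_algebra.
From mathcomp Require Import complex reals.
From mathcomp Require Import mpoly ring zify separable.

(* On the torus this is the Weyl character formula of type B_r, which follows
   from the radial part of the Casimir operator. By Schur's lemma the Casimir
   operator acts on V by a scalar. For a root vector e of weight alpha and its
   opposite f, equivariance gives tr(t f e) = t^(-alpha) tr(t e f), which makes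
   the Casimir equation say that the product of the Weyl denominator and the
   character is an eigenvector of a Laplacian. This product is a combination of
   the alternants of mu + rho for the weights mu of V, with eigenvalues
   |mu + rho|^2; since |mu + rho| = |lam + rho| only for mu = lam, and lam has
   multiplicity one, it is the alternant of lam + rho.

   Every component of the wedge product at h is an r x r determinant. For
   h = Q t Q^-1 with t in the torus the determinant factors into one depending
   on Q only and the alternant of t, so that the identity holds at h. It holds
   everywhere by polynomiality and the Zariski density of these h. *)

Set Implicit Arguments.
Unset Strict Implicit.
Unset Printing Implicit Defensive.

Import Order.TTheory GRing.Theory Num.Theory.
Local Open Scope ring_scope.

(** * Polynomial and differentiable functions of one variable *)

(** The obstacle is that the argument concerns Lie algebras and connected groups, while [V] is only
    known through polynomials in the entries of elements of SO. Two devices replace analysis.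
    Derivatives are first-order expansions along curves; the Lie algebra is spanned by the
    velocities of unipotent groups of Eichler transformations and of lines in the torus. The
    generation of SO by Eichler transformations stands in for connectedness: it gives polynomial
    paths from 1 to every element, which serve for density, and it carries the stability of a
    subspace from the Lie algebra to the group, on which multiplicity one depends. Half-integral
    exponents are avoided by working with polynomials in X_i = e^(-e_i) multiplied by a monomial,
    the shift being recorded in the Euler operators, and in the end by evaluating at squares. *)

Section PolynomialFunctions.
Variable K : numFieldType.
Implicit Types (f g : K -> K).

Lemma poly_eq0_of_vanishing (p : {poly K}) : (forall s, p.[s] = 0) -> p = 0.
Proof.
move=> p0; apply/eqP; case: eqP => // /eqP pn0.
have := max_poly_roots pn0 (rs := [seq i%:R | i <- iota 0 (size p)]).
rewrite size_map size_iota ltnn; apply.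
  by apply/allP => s _; rewrite rootE p0.
rewrite map_inj_uniq ?iota_uniq // => i j /eqP.
by rewrite eqr_nat => /eqP.
Qed.

Lemma poly_eq0_of_generic_vanishing (p d : {poly K}) :
  d != 0 -> (forall s, d.[s] != 0 -> p.[s] = 0) -> p = 0.
Proof.
move=> d0 pv; have : p * d = 0.
  apply: poly_eq0_of_vanishing => s; rewrite hornerM.
  by have [->|/pv->] := eqVneq d.[s] 0; rewrite ?mulr0 ?mul0r.
by move/eqP; rewrite mulf_eq0 (negPf d0) orbF => /eqP.
Qed.

Definition polyfun f := exists p : {poly K}, forall s, f s = p.[s].

Lemma polyfun_eq f g : f =1 g -> polyfun f -> polyfun g.
Proof. by move=> fg [p pE]; exists p => s; rewrite -fg. Qed.

Lemma polyfun_cst c : polyfun (fun=> c).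
Proof. by exists c%:P => s; rewrite hornerC. Qed.

Lemma polyfun_add f g : polyfun f -> polyfun g -> polyfun (fun s => f s + g s).
Proof. by move=> [p fE] [q gE]; exists (p + q) => s; rewrite hornerD fE gE. Qed.

Lemma polyfun_opp f : polyfun f -> polyfun (fun s => - f s).
Proof. by move=> [p fE]; exists (- p) => s; rewrite hornerN fE. Qed.

Lemma polyfun_mul f g : polyfun f -> polyfun g -> polyfun (fun s => f s * g s).
Proof. by move=> [p fE] [q gE]; exists (p * q) => s; rewrite hornerM fE gE. Qed.

Lemma polyfun_sum (I : Type) (r : seq I) (P : pred I) (F : I -> K -> K) :
  (forall i, P i -> polyfun (F i)) -> polyfun (fun s => \sum_(i <- r | P i) F i s).
Proof.
move=> FP; elim: r => [|i r IH].
  by apply: (polyfun_eq _ (polyfun_cst 0)) => s; rewrite big_nil.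
case Pi: (P i); last by apply: polyfun_eq IH => s; rewrite big_cons Pi.
by apply: polyfun_eq (polyfun_add (FP i Pi) IH) => s; rewrite big_cons Pi.
Qed.

Lemma polyfun_prod (I : Type) (r : seq I) (P : pred I) (F : I -> K -> K) :
  (forall i, P i -> polyfun (F i)) -> polyfun (fun s => \prod_(i <- r | P i) F i s).
Proof.
move=> FP; elim: r => [|i r IH].
  by apply: (polyfun_eq _ (polyfun_cst 1)) => s; rewrite big_nil.
case Pi: (P i); last by apply: polyfun_eq IH => s; rewrite big_cons Pi.
by apply: polyfun_eq (polyfun_mul (FP i Pi) IH) => s; rewrite big_cons Pi.
Qed.

Lemma polyfun_det n (F : K -> 'M[K]_n) :
  (forall i j, polyfun (fun s => F s i j)) -> polyfun (fun s => \det (F s)).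
Proof.
move=> FP; apply: polyfun_sum => t _; apply: polyfun_mul; first exact: polyfun_cst.
by apply: polyfun_prod.
Qed.

Lemma polyfun_mulmx m n k (F : K -> 'M[K]_(m, n)) (G : K -> 'M[K]_(n, k)) :
  (forall i j, polyfun (fun s => F s i j)) ->
  (forall i j, polyfun (fun s => G s i j)) ->
  forall i j, polyfun (fun s => (F s *m G s) i j).
Proof.
move=> FP GP i j.
apply: (@polyfun_eq (fun s => \sum_l F s i l * G s l j)) => [s|]; first by rewrite mxE.
by apply: polyfun_sum => l _; apply: polyfun_mul.
Qed.

Lemma mpoly_ring_ind n (P : {mpoly K[n]} -> Prop) :
  (forall c, P c%:MP) -> (forall i, P 'X_i) ->
  (forall p q, P p -> P q -> P (p + q)) ->
  (forall p q, P p -> P q -> P (p * q)) ->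
  forall p, P p.
Proof.
move=> PC PX PD PM p; rewrite (mpolyE p).
apply: big_ind => [||m _]; [exact: (PC) 0 | exact: (PD) |].
rewrite -mul_mpolyC; apply: (PM); first exact: (PC).
rewrite mpolyXE_id; apply: big_ind => [||i _]; [exact: (PC) 1 | exact: (PM) |].
by elim: (m i) => [|k IH]; [exact: (PC) 1 | rewrite exprS; apply: (PM)].
Qed.

Lemma polyfun_meval n (p : {mpoly K[n]}) (x : K -> 'I_n -> K) :
  (forall k, polyfun (fun s => x s k)) -> polyfun (fun s => p.@[x s]).
Proof.
move=> xP; elim/mpoly_ring_ind: p => [c|i|p q Pp Pq|p q Pp Pq].
- by apply: (polyfun_eq _ (polyfun_cst c)) => s; rewrite mevalC.
- by apply: polyfun_eq (xP i) => s; rewrite mevalXU.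
- by apply: polyfun_eq (polyfun_add Pp Pq) => s; rewrite mevalD.
- by apply: polyfun_eq (polyfun_mul Pp Pq) => s; rewrite mevalM.
Qed.

(* [der f a b]: f(s) = a + b s + O(s^2) at 0, the remainder being s^2 times a
   rational function of s without pole at 0. *)
Definition der f (a b : K) := exists p q : {poly K},
  q.[0] != 0 /\ forall s, q.[s] != 0 -> f s = a + b * s + s ^+ 2 * (p.[s] / q.[s]).

(** Only parameters near 0 matter, in the Zariski sense. This admits curves such as 1 + s in the
    torus, which leave the group at s = -1. *)
Lemma der_near f g a b (d : {poly K}) : d.[0] != 0 -> (forall s, d.[s] != 0 -> f s = g s) ->
  der f a b -> der g a b.
Proof.
move=> d0 fg [p [q [q0 fE]]]; exists (p * d), (q * d).
split=> [|s]; first by rewrite hornerM mulf_neq0.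
rewrite hornerM mulf_eq0 negb_or => /andP[qs ds].
by rewrite -fg // fE // hornerM -mulf_div divff // mulr1.
Qed.

Lemma der_eq f g a b : f =1 g -> der f a b -> der g a b.
Proof.
by move=> fg; apply: (@der_near _ _ _ _ 1); rewrite ?hornerC ?oner_neq0.
Qed.

Lemma der_uniq f a b a' b' : der f a b -> der f a' b' -> a = a' /\ b = b'.
Proof.
move=> [p [q [q0 fE]]] [p' [q' [q'0 fE']]].
(* The difference of the two expansions, cleared of denominators. It vanishes identically; its
   constant term gives a = a', and after division by ['X] the next one gives b = b'. *)
pose D := (a - a')%:P * (q * q') + (b - b')%:P * (q * q') * 'X
          + 'X ^+ 2 * (p * q' - p' * q).
have qq' : q * q' != 0.
  by apply/eqP => e; have := mulf_neq0 q0 q'0; rewrite -hornerM e hornerC eqxx.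
have D0 : D = 0.
  apply: (poly_eq0_of_generic_vanishing qq') => s.
  rewrite hornerM mulf_eq0 negb_or => /andP[qs q's].
  have /eqP := fE s qs; rewrite fE' // -subr_eq0 => /eqP e.
  rewrite /D !(hornerD, hornerN, hornerM, hornerZ, hornerXn, hornerX, hornerC) /=.
  have -> : 0 = - (q.[s] * q'.[s]) * (a' + b' * s + s ^+ 2 * (p'.[s] / q'.[s]) -
    (a + b * s + s ^+ 2 * (p.[s] / q.[s]))) by rewrite e mulr0.
  by field; rewrite qs.
have aE : a = a'.
  have := congr1 (horner^~ 0) D0; rewrite /D !(hornerD, hornerN, hornerM, hornerZ, hornerXn, hornerX, hornerC) /=.
  rewrite ?(mulr0, expr0n, mul0r, addr0) => /eqP.
  by rewrite !mulf_eq0 (negPf q0) (negPf q'0) !orbF subr_eq0 => /eqP.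
split=> //.
have := D0; rewrite /D aE subrr mul0r add0r.
have -> : (b - b')%:P * (q * q') * 'X + 'X ^+ 2 * (p * q' - p' * q)
  = 'X * ((b - b')%:P * (q * q') + 'X * (p * q' - p' * q)) by ring.
move/eqP; rewrite mulf_eq0 polyX_eq0 /= => /eqP {}D0.
have := congr1 (horner^~ 0) D0; rewrite !(hornerD, hornerN, hornerM, hornerZ, hornerXn, hornerX, hornerC) /=.
rewrite ?(mul0r, addr0) => /eqP.
by rewrite !mulf_eq0 (negPf q0) (negPf q'0) !orbF subr_eq0 => /eqP.
Qed.

Lemma der_cst c : der (fun=> c) c 0.
Proof.
exists 0, 1; split=> [|s _]; first by rewrite hornerC oner_neq0.
by rewrite hornerC !mul0r mulr0 !addr0.
Qed.

Lemma der_linear a b : der (fun s => a + b * s) a b.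
Proof.
exists 0, 1; split=> [|s _]; first by rewrite hornerC oner_neq0.
by rewrite hornerC !mul0r mulr0 !addr0.
Qed.

Lemma der_inv1D : der (fun s => (1 + s)^-1) 1 (-1).
Proof.
exists 1, (1 + 'X); split=> [|s].
  by rewrite hornerD hornerX hornerC addr0 oner_neq0.
by rewrite hornerD hornerX !hornerC => s0; field.
Qed.

Lemma der_add f g a b a' b' :
  der f a b -> der g a' b' -> der (fun s => f s + g s) (a + a') (b + b').
Proof.
move=> [p [q [q0 fE]]] [p' [q' [q'0 gE]]].
exists (p * q' + p' * q), (q * q').
split=> [|s]; first by rewrite hornerM mulf_neq0.
rewrite hornerM mulf_eq0 negb_or => /andP[qs q's].
by rewrite fE // gE // !(hornerD, hornerN, hornerM, hornerZ, hornerXn, hornerX, hornerC); field; apply/andP; split.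
Qed.

Lemma der_mul f g a b a' b' :
  der f a b -> der g a' b' -> der (fun s => f s * g s) (a * a') (b * a' + a * b').
Proof.
move=> [p [q [q0 fE]]] [p' [q' [q'0 gE]]].
exists ((b * b') *: (q * q') + a *: (p' * q) + a' *: (p * q') +
        'X * (b *: (p' * q) + b' *: (p * q')) + 'X ^+ 2 * (p * p')), (q * q').
split=> [|s]; first by rewrite hornerM mulf_neq0.
rewrite hornerM mulf_eq0 negb_or => /andP[qs q's].
by rewrite fE // gE // !(hornerD, hornerN, hornerM, hornerZ, hornerXn, hornerX, hornerC) /=; field; apply/andP; split.
Qed.

Lemma der_sum (I : Type) (r : seq I) (F : I -> K -> K) (a b : I -> K) :
  (forall i, der (F i) (a i) (b i)) ->
  der (fun s => \sum_(i <- r) F i s) (\sum_(i <- r) a i) (\sum_(i <- r) b i).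
Proof.
move=> FD; elim: r => [|i r IH].
  by rewrite !big_nil; apply: der_eq (der_cst 0) => s; rewrite big_nil.
by rewrite !big_cons; apply: der_eq (der_add (FD i) IH) => s; rewrite big_cons.
Qed.

Lemma der_meval n (p : {mpoly K[n]}) (x : K -> 'I_n -> K) (a b : 'I_n -> K) :
  (forall k, der (fun s => x s k) (a k) (b k)) ->
  der (fun s => p.@[x s]) p.@[a] (\sum_k (p^`M(k)).@[a] * b k).
Proof.
move=> xD; elim/mpoly_ring_ind: p => [c|i|p q Pp Pq|p q Pp Pq].
- rewrite mevalC big1 => [|k _]; last by rewrite mderivC meval0 mul0r.
  by apply: der_eq (der_cst c) => s; rewrite mevalC.
- rewrite mevalXU (bigD1 i) //= big1 => [|k ki].
    have U0 : (U_(i) - U_(i))%MM = 0%MM :> 'X_{1..n}.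
      by apply/mnmP => j; rewrite mnmBE subnn mnm0E.
    rewrite mderivX mnm1E eqxx scale1r U0 mpolyX0 meval1 mul1r addr0.
    by apply: der_eq (xD i) => s; rewrite mevalXU.
  by rewrite mderivX mnm1E eq_sym (negPf ki) scale0r meval0 mul0r.
- rewrite mevalD (eq_bigr (fun k => (p^`M(k)).@[a] * b k + (q^`M(k)).@[a] * b k)).
    by rewrite big_split; apply: der_eq (der_add Pp Pq) => s; rewrite mevalD.
  by move=> k _; rewrite mderivD mevalD mulrDl.
- rewrite mevalM (eq_bigr (fun k => (p^`M(k)).@[a] * b k * q.@[a] +
    p.@[a] * ((q^`M(k)).@[a] * b k))).
    rewrite big_split -mulr_suml -mulr_sumr.
    by apply: der_eq (der_mul Pp Pq) => s; rewrite mevalM.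
  by move=> k _; rewrite mderivM mevalD !mevalM; ring.
Qed.

Lemma der_horner (p : {poly K}) c : der (fun s => p.[c + s]) p.[c] p^`().[c].
Proof.
elim/poly_ind: p => [|p a IH].
  by rewrite linear0 !hornerC; apply: der_eq (der_cst 0) => s; rewrite hornerC.
rewrite derivD derivM derivX derivC addr0 mulr1 hornerMXaddC hornerD hornerMX.
have := der_add (der_mul IH (der_linear c 1)) (der_cst a).
by rewrite addr0 mulr1; apply: der_eq => s; rewrite hornerMXaddC mul1r.
Qed.

Definition mder m n (F : K -> 'M[K]_(m, n)) (A B : 'M[K]_(m, n)) :=
  forall i j, der (fun s => F s i j) (A i j) (B i j).

Lemma mder_near m n (F G : K -> 'M[K]_(m, n)) A B (d : {poly K}) :
  d.[0] != 0 -> (forall s, d.[s] != 0 -> F s = G s) -> mder F A B -> mder G A B.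
Proof. by move=> d0 FG FD i j; apply: (der_near d0 _ (FD i j)) => s /FG->. Qed.

Lemma mder_uniq m n (F : K -> 'M[K]_(m, n)) A B A' B' :
  mder F A B -> mder F A' B' -> A = A' /\ B = B'.
Proof.
by move=> FD FD'; split; apply/matrixP => i j; case: (der_uniq (FD i j) (FD' i j)).
Qed.

Lemma mder_cst m n (A : 'M[K]_(m, n)) : mder (fun=> A) A 0.
Proof. by move=> i j; rewrite mxE; apply: der_cst. Qed.

Lemma mder_mul m n k (F : K -> 'M[K]_(m, n)) (G : K -> 'M[K]_(n, k)) A B A' B' :
  mder F A B -> mder G A' B' ->
  mder (fun s => F s *m G s) (A *m A') (B *m A' + A *m B').
Proof.
move=> FD GD i j; rewrite !mxE -big_split.
apply: (@der_eq (fun s => \sum_l F s i l * G s l j)) => [s|]; first by rewrite mxE.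
by apply: der_sum => l; apply: der_mul.
Qed.

Lemma mder_tr m n (F : K -> 'M[K]_(m, n)) A B :
  mder F A B -> mder (fun s => (F s)^T) A^T B^T.
Proof. by move=> FD i j; rewrite !mxE; apply: der_eq (FD j i) => s; rewrite mxE. Qed.

End PolynomialFunctions.

(** * The orthogonal group and its torus *)

Section Indices.
Variable r : nat.
Local Notation n := (r.*2.+1).
Local Notation x_ := (@x_idx r).
Local Notation y_ := (@y_idx r).
Local Notation z_ := (z_idx r).

Lemma x_idxE k : x_ k = k.*2 :> nat.
Proof. by rewrite inordK // ltnS leq_double ltnW. Qed.

Lemma y_idxE k : y_ k = k.*2.+1 :> nat.
Proof. by rewrite inordK // ltnS ltn_double. Qed.

Lemma eq_xx k l : (x_ k == x_ l) = (k == l).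
Proof. by rewrite -!val_eqE /= !x_idxE -!muln2 eqn_pmul2r. Qed.

Lemma eq_yy k l : (y_ k == y_ l) = (k == l).
Proof. by rewrite -!val_eqE /= !y_idxE eqSS -!muln2 eqn_pmul2r. Qed.

Lemma eq_xy k l : (x_ k == y_ l) = false.
Proof.
by apply/negP => /eqP/(congr1 (odd \o val)) /=; rewrite x_idxE y_idxE /= !odd_double.
Qed.

Lemma eq_yx k l : (y_ k == x_ l) = false.
Proof. by rewrite eq_sym eq_xy. Qed.

Lemma eq_xz k : (x_ k == z_) = false.
Proof. by rewrite -val_eqE /= x_idxE -!muln2 eqn_pmul2r // ltn_eqF. Qed.

Lemma eq_yz k : (y_ k == z_) = false.
Proof.
by apply/negP => /eqP/(congr1 (odd \o val)) /=; rewrite y_idxE /= !odd_double.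
Qed.

Lemma eq_zx k : (z_ == x_ k) = false.
Proof. by rewrite eq_sym eq_xz. Qed.

Lemma eq_zy k : (z_ == y_ k) = false.
Proof. by rewrite eq_sym eq_yz. Qed.

Definition eq_idxE :=
  (eq_xx, eq_yy, eq_xy, eq_yx, eq_xz, eq_yz, eq_zx, eq_zy, eqxx).

Variant idx_spec : 'I_n -> Type :=
  | IdxX k : idx_spec (x_ k)
  | IdxY k : idx_spec (y_ k)
  | IdxZ : idx_spec z_.

Lemma idxP a : idx_spec a.
Proof.
have [ar|] := ltnP a r.*2; last first.
  move=> ra; suff -> : a = z_ by constructor.
  by apply/val_inj/eqP; rewrite /= eqn_leq ra -ltnS ltn_ord.
have hr : (a./2 < r)%N by rewrite -ltn_double (leq_ltn_trans _ ar) // -[leqRHS]odd_double_half leq_addl.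
case: (boolP (odd a)) => oa.
  suff -> : a = y_ (Ordinal hr) by constructor.
  by apply/val_inj; rewrite /= y_idxE /= -[LHS]odd_double_half oa.
suff -> : a = x_ (Ordinal hr) by constructor.
by apply/val_inj; rewrite /= x_idxE /= -[LHS]odd_double_half (negPf oa).
Qed.

(** The index of the basis vector that pairs with that of [a]. Each x_k sits at an even and each y_k
    at an odd position; z, also at an even one, is its own partner and is tested for separately. *)
Definition dual (a : 'I_n) : 'I_n :=
  if a == z_ then a else if odd a then inord a.-1 else inord a.+1.

Lemma dual_x k : dual (x_ k) = y_ k.
Proof. by rewrite /dual eq_xz x_idxE odd_double. Qed.

Lemma dual_y k : dual (y_ k) = x_ k.
Proof. by rewrite /dual eq_yz y_idxE /= odd_double. Qed.

Lemma dual_z : dual z_ = z_.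
Proof. by rewrite /dual eqxx. Qed.

Definition dualE := (dual_x, dual_y, dual_z).

Lemma dualK : involutive dual.
Proof. by move=> a; case: (idxP a) => [k|k|]; rewrite !dualE. Qed.

Lemma big_idx (T : Type) (idx : T) (op : Monoid.com_law idx) (F : 'I_n -> T) :
  \big[op/idx]_a F a =
  op (op (\big[op/idx]_(k < r) F (x_ k)) (\big[op/idx]_(k < r) F (y_ k))) (F z_).
Proof.
rewrite big_ord_recr /=; congr (op _ (F _)).
pose G i := F (inord i); transitivity (\big[op/idx]_(0 <= i < r.*2) G i).
  rewrite big_mkord; apply: eq_bigr => i _; congr (F _); apply/val_inj.
  by rewrite /= inordK // ltnS ltnW.
rewrite -!(big_mkord xpredT (fun k => G k.*2)) -(big_mkord xpredT (fun k => G k.*2.+1)).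
elim: {F}r G => [|m IH] G; first by rewrite !big_nil Monoid.mulm1.
rewrite doubleS !big_nat_recr //= IH !Monoid.mulmA; congr (op _ _).
exact: Monoid.mulmAC.
Qed.

End Indices.

(** * Quadratic form, adjoint, isometries and torus *)

Section Form.
Variables (K : numFieldType) (r : nat).
Local Notation n := (r.*2.+1).
Local Notation x_ := (@x_idx r).
Local Notation y_ := (@y_idx r).
Local Notation z_ := (z_idx r).
Implicit Types (u v w : 'cV[K]_n) (A g h : 'M[K]_n).

(** Weights of the polar form Q(u + v) - Q(u) - Q(v): x_k pairs with y_k to 1, and z with itself to
    2 because z^2 polarizes to 2 z z'. *)
Definition form_wt (a : 'I_n) : K := if a == z_ then 2 else 1.

Definition form_mx : 'M[K]_n := \matrix_(a, b) (form_wt a *+ (b == dual a)).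
Definition form_inv : 'M[K]_n := \matrix_(a, b) ((form_wt a)^-1 *+ (b == dual a)).

Lemma form_wt_dual a : form_wt (dual a) = form_wt a.
Proof. by case: (idxP a) => [k|k|]; rewrite !dualE /form_wt !eq_idxE. Qed.

Lemma form_wt_neq0 a : form_wt a != 0.
Proof. by rewrite /form_wt; case: ifP; rewrite ?oner_neq0 ?pnatr_eq0. Qed.

Lemma form_mxK : form_mx *m form_inv = 1%:M.
Proof.
apply/matrixP => a b; rewrite !mxE (bigD1 (dual a)) //= big1 ?addr0 => [|c ca].
  rewrite !mxE eqxx dualK form_wt_dual mulr1n mulrnAr divff ?form_wt_neq0 //.
  by rewrite eq_sym.
by rewrite !mxE (negPf ca) mulr0n mul0r.
Qed.

Lemma form_invK : form_inv *m form_mx = 1%:M.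
Proof. exact: mulmx1C form_mxK. Qed.

Lemma form_tr : form_mx^T = form_mx.
Proof.
apply/matrixP => a b; rewrite !mxE; have [->|ab] := eqVneq a (dual b).
  by rewrite dualK eqxx form_wt_dual.
by case: eqP => // ba; rewrite ba dualK eqxx in ab.
Qed.

Lemma form_inv_tr : form_inv^T = form_inv.
Proof.
rewrite -[LHS]mulmx1 -form_mxK mulmxA -{1}form_tr -trmx_mul form_mxK.
by rewrite trmx1 mul1mx.
Qed.

Definition bil u v : K := (u^T *m form_mx *m v) 0 0.

Lemma bilC u v : bil u v = bil v u.
Proof. by rewrite /bil -[in LHS]form_tr -[v in LHS]trmxK -!trmx_mul mulmxA mxE. Qed.

Lemma bilDr u v w : bil u (v + w) = bil u v + bil u w.
Proof. by rewrite /bil mulmxDr mxE. Qed.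
Lemma bilDl u v w : bil (v + w) u = bil v u + bil w u.
Proof. by rewrite bilC bilDr !(bilC u). Qed.
Lemma bilZr c u v : bil u (c *: v) = c * bil u v.
Proof. by rewrite /bil -scalemxAr mxE. Qed.
Lemma bilZl c u v : bil (c *: v) u = c * bil v u.
Proof. by rewrite bilC bilZr bilC. Qed.
Lemma bilNr u v : bil u (- v) = - bil u v.
Proof. by rewrite -scaleN1r bilZr mulN1r. Qed.
Lemma bilNl u v : bil (- v) u = - bil v u.
Proof. by rewrite bilC bilNr bilC. Qed.

Definition bilE := (bilDl, bilDr, bilZl, bilZr, bilNl, bilNr).

Definition evec (a : 'I_n) : 'cV[K]_n := delta_mx a 0.

Lemma evec_entry A a b : ((evec a)^T *m A *m evec b) 0 0 = A a b.
Proof. by rewrite /evec trmx_delta -rowE -colE !mxE. Qed.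

Lemma bil_evec a b : bil (evec a) (evec b) = form_wt a *+ (b == dual a).
Proof. by rewrite /bil evec_entry mxE. Qed.

Lemma bil_sum u v : bil u v = \sum_a form_wt a * u a 0 * v (dual a) 0.
Proof.
rewrite /bil !mxE; under eq_bigr => b _.
  rewrite mxE (bigD1 (dual b)) //= big1 => [|c cb]; last first.
    rewrite !mxE; case: eqP => [bc|]; last by rewrite mulr0.
    by rewrite bc dualK eqxx in cb.
  rewrite !mxE dualK eqxx addr0 mulr1n form_wt_dual; over.
rewrite (reindex_inj (can_inj (@dualK r))) /=; apply: eq_bigr => b _.
by rewrite dualK form_wt_dual [_ * form_wt b]mulrC.
Qed.

Lemma bil_evecr u a : bil u (evec a) = form_wt a * u (dual a) 0.
Proof.
rewrite bil_sum (bigD1 (dual a)) //= big1 ?addr0 => [|b ba].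
  by rewrite !mxE dualK !eqxx mulr1 form_wt_dual.
by rewrite !mxE -(inj_eq (can_inj (@dualK r))) dualK (negPf ba) mulr0.
Qed.

Lemma quad_formE v : quad_form v = 2^-1 * bil v v.
Proof.
rewrite bil_sum big_idx /= /form_wt.
under eq_bigr do rewrite eq_idxE dual_x mul1r.
under [X in _ * (_ + X + _)]eq_bigr do rewrite eq_idxE dual_y mul1r mulrC.
rewrite eqxx dual_z /quad_form; set S := \sum_(k < r) _; set c := v _ _.
by field.
Qed.

(** The rank-one operator sending w to [bil v w *: u]. Together with [adj], the adjoint for [bil],
    it allows computations without coordinates. *)
Definition dyad u v : 'M[K]_n := u *m v^T *m form_mx.

Lemma dyadDr u v w : dyad u (v + w) = dyad u v + dyad u w.
Proof. by rewrite /dyad linearD mulmxDr mulmxDl. Qed.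
Lemma dyadDl u v w : dyad (v + w) u = dyad v u + dyad w u.
Proof. by rewrite /dyad mulmxDl mulmxDl. Qed.
Lemma dyadZr c u v : dyad u (c *: v) = c *: dyad u v.
Proof. by rewrite /dyad linearZ /= -scalemxAr -scalemxAl. Qed.
Lemma dyadZl c u v : dyad (c *: v) u = c *: dyad v u.
Proof. by rewrite /dyad -!scalemxAl. Qed.
Lemma dyadNr u v : dyad u (- v) = - dyad u v.
Proof. by rewrite -scaleN1r dyadZr scaleN1r. Qed.
Lemma dyadNl u v : dyad (- v) u = - dyad v u.
Proof. by rewrite -scaleN1r dyadZl scaleN1r. Qed.

Definition dyadLE := (dyadDl, dyadDr, dyadZl, dyadZr, dyadNl, dyadNr).

Lemma dyad_mulv u v w : dyad u v *m w = bil v w *: u.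
Proof.
rewrite /dyad -!mulmxA [v^T *m _]mx11_scalar mul_mx_scalar /bil.
by rewrite mulmxA.
Qed.

Lemma dyad_mul u v u' v' : dyad u v *m dyad u' v' = bil v u' *: dyad u v'.
Proof. by rewrite {2}/dyad !mulmxA dyad_mulv -!scalemxAl. Qed.

Lemma mul_dyad A u v : A *m dyad u v = dyad (A *m u) v.
Proof. by rewrite /dyad !mulmxA. Qed.

Definition adj A : 'M[K]_n := form_inv *m A^T *m form_mx.

Lemma adjD A g : adj (A + g) = adj A + adj g.
Proof. by rewrite /adj linearD mulmxDr mulmxDl. Qed.
Lemma adjZ c A : adj (c *: A) = c *: adj A.
Proof. by rewrite /adj linearZ /= -scalemxAr -scalemxAl. Qed.
Lemma adjN A : adj (- A) = - adj A.
Proof. by rewrite -scaleN1r adjZ scaleN1r. Qed.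
Lemma adj1 : adj 1%:M = 1%:M.
Proof. by rewrite /adj trmx1 mulmx1 form_invK. Qed.
Lemma adjM A g : adj (A *m g) = adj g *m adj A.
Proof. by rewrite /adj trmx_mul !mulmxA -[_ *m form_mx *m form_inv]mulmxA form_mxK mulmx1. Qed.
Lemma adj_dyad u v : adj (dyad u v) = dyad v u.
Proof.
by rewrite /adj /dyad !trmx_mul trmxK form_tr !mulmxA form_invK mul1mx.
Qed.
Lemma adjK : involutive adj.
Proof.
move=> A; rewrite /adj !trmx_mul trmxK form_tr form_inv_tr !mulmxA form_invK mul1mx.
by rewrite -mulmxA form_invK mulmx1.
Qed.

Lemma dyad_adj A u v : dyad u v *m adj A = dyad u (A *m v).
Proof.
by rewrite /dyad /adj trmx_mul !mulmxA -[_ *m form_mx *m form_inv]mulmxA form_mxK mulmx1.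
Qed.

Lemma bil_adj A u v : bil (A *m u) v = bil u (adj A *m v).
Proof. by rewrite /bil /adj trmx_mul !mulmxA -[_ *m form_mx *m form_inv]mulmxA form_mxK mulmx1. Qed.

Lemma bil_eqmx A : (forall u v, bil u (A *m v) = bil u v) -> A = 1%:M.
Proof.
move=> AP; suff e : form_mx *m A = form_mx by rewrite -[A]mul1mx -form_invK -mulmxA e.
apply/matrixP => a b; have := AP (evec a) (evec b).
by rewrite /bil evec_entry mulmxA -[_ *m A]mulmxA evec_entry.
Qed.

Lemma polarize u v : bil u v = quad_form (u + v) - quad_form u - quad_form v.
Proof. by rewrite !quad_formE !bilE (bilC v u); field. Qed.

Definition isom g := adj g *m g = 1%:M.

Lemma isom_quad g : (forall v, quad_form (g *m v) = quad_form v) <-> isom g.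
Proof.
split=> [gq|gi v].
  by apply: bil_eqmx => u v; rewrite -mulmxA -bil_adj !polarize -mulmxDr !gq.
by rewrite !quad_formE bil_adj mulmxA gi mul1mx.
Qed.

Lemma in_SOE g : in_SO g <-> isom g /\ \det g = 1.
Proof. by rewrite /in_SO isom_quad. Qed.

Lemma isomC g : isom g -> g *m adj g = 1%:M.
Proof. exact: mulmx1C. Qed.

Lemma bil_isom g u v : isom g -> bil (g *m u) (g *m v) = bil u v.
Proof. by move=> gi; rewrite bil_adj mulmxA gi mul1mx. Qed.

Lemma isom1 : isom 1%:M.
Proof. by rewrite /isom adj1 mul1mx. Qed.

Lemma isomM g h : isom g -> isom h -> isom (g *m h).
Proof. by move=> gi hi; rewrite /isom adjM mulmxA -(mulmxA (adj h)) gi mulmx1. Qed.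

Lemma isom_adj g : isom g -> isom (adj g).
Proof. by move=> gi; rewrite /isom adjK isomC. Qed.

Lemma det_adj g : \det (adj g) = \det g.
Proof.
rewrite /adj !det_mulmx det_tr mulrAC -det_mulmx form_invK det1 mul1r //.
Qed.

Lemma isom_det g : isom g -> \det g = 1 \/ \det g = -1.
Proof.
move=> /(congr1 determinant); rewrite det_mulmx det_adj det1 -expr2 => /eqP.
by rewrite sqrf_eq1 => /orP[]/eqP; [left|right].
Qed.

(** An isometry has determinant 1 or -1, and squaring removes the sign. Exhibiting a square root
    thereby replaces the computation of a determinant, for Eichler transformations and for the
    torus. *)
Lemma isom_sqr_SO g h : isom h -> g = h *m h -> in_SO g.
Proof.
move=> hi ->; apply/in_SOE; split; first exact: isomM.
by rewrite det_mulmx; case: (isom_det hi) => ->; rewrite ?mulrNN mulr1.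
Qed.

Lemma SO1 : in_SO (1%:M : 'M[K]_n).
Proof. by apply: (isom_sqr_SO isom1); rewrite mul1mx. Qed.

Lemma SOM g h : in_SO g -> in_SO h -> in_SO (g *m h).
Proof.
move=> /in_SOE[gi gd] /in_SOE[hi hd]; apply/in_SOE.
by rewrite det_mulmx gd hd mulr1; split=> //; apply: isomM.
Qed.

Lemma SO_adj g : in_SO g -> in_SO (adj g).
Proof. by move=> /in_SOE[gi gd]; apply/in_SOE; rewrite det_adj; split=> //; apply: isom_adj. Qed.

Lemma SO_adjK g : in_SO g -> adj g *m g = 1%:M.
Proof. by case/in_SOE. Qed.

Lemma SO_mul_adj g : in_SO g -> g *m adj g = 1%:M.
Proof. by case/in_SOE => /isomC. Qed.

(* In odd dimension one of g, -g has determinant 1. *)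
Lemma isom_SO g : isom g -> in_SO (\det g *: g).
Proof.
move=> gi; apply/in_SOE; rewrite /isom adjZ -scalemxAl -scalemxAr scalerA gi detZ.
rewrite -exprSr; have d2 : \det g ^+ 2 = 1.
  by case: (isom_det gi) => ->; rewrite ?sqrrN expr1n.
rewrite -expr2 d2 scale1r; split=> //.
by move: (\det g) d2 => d d2; rewrite -doubleS -mul2n exprM d2 expr1n.
Qed.

(* Eichler transformation: exp (s X) with X = e v^* - v e^*, for e isotropic
   and v orthogonal to e. *)
Definition eich u v : 'M[K]_n :=
  1%:M + (dyad u v - dyad v u) - quad_form v *: dyad u u.

Lemma eichD u v w : bil u u = 0 -> bil u v = 0 -> bil u w = 0 ->
  eich u v *m eich u w = eich u (v + w).
Proof.
move=> uu uv uw; rewrite /eich.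
rewrite !(mulmxDl, mulmxDr, mulNmx, mulmxN, mul1mx, mulmx1, opprD, opprK).
rewrite -!scalemxAl -!scalemxAr !dyad_mul uu uw (bilC v u) uv.
rewrite !dyadLE !quad_formE !bilE (bilC w v).
by apply/matrixP => i j; rewrite !mxE; field.
Qed.

Lemma eich0 u : eich u 0 = 1%:M.
Proof.
by rewrite /eich -(scale0r u) !dyadLE quad_formE !bilE !(scale0r, mul0r, mulr0) !subr0 addr0.
Qed.

Lemma adj_eich u v : adj (eich u v) = eich u (- v).
Proof.
rewrite /eich !(adjD, adjN, adjZ, adj1, adj_dyad) !dyadLE !quad_formE !bilE opprK.
by rewrite opprK [- _ + _]addrC.
Qed.

Lemma eich_SO u v : bil u u = 0 -> bil u v = 0 -> in_SO (eich u v).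
Proof.
move=> uu uv; have uv2 : bil u (2^-1 *: v) = 0 by rewrite bilZr uv mulr0.
apply: (@isom_sqr_SO _ (eich u (2^-1 *: v))).
  by rewrite /isom adj_eich eichD ?bilNr ?uv2 ?oppr0 // addNr eich0.
rewrite eichD // -scalerDl; congr (eich _ _).
have -> : 2^-1 + 2^-1 = 1 :> K by field.
by rewrite scale1r.
Qed.

Definition torus_ev (t : 'I_r -> K) (a : 'I_n) : K := torus t a a.

Lemma torusE t a b : torus t a b = torus_ev t a *+ (a == b).
Proof.
rewrite /torus_ev; have [->//|ab] := eqVneq a b.
have h c : (a == c) && (b == c) = false.
  by apply/negP => /andP[/eqP ac /eqP bc]; rewrite ac bc eqxx in ab.
rewrite /torus !mxE (h (z_idx r)) summxE big1 ?add0r // => k _.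
by rewrite !mxE !h !mulr0 addr0.
Qed.

Lemma torus_ev_x t k : torus_ev t (x_ k) = t k.
Proof.
rewrite /torus_ev /torus !mxE summxE !eq_idxE addr0 (bigD1 k) //= big1 => [|l lk].
  by rewrite !mxE !eq_idxE mulr1 mulr0 !addr0.
by rewrite !mxE !eq_idxE eq_sym (negPf lk) !mulr0 addr0.
Qed.

Lemma torus_ev_y t k : torus_ev t (y_ k) = (t k)^-1.
Proof.
rewrite /torus_ev /torus !mxE summxE !eq_idxE addr0 (bigD1 k) //= big1 => [|l lk].
  by rewrite !mxE !eq_idxE mulr1 mulr0 addr0 add0r.
by rewrite !mxE !eq_idxE eq_sym (negPf lk) !mulr0 addr0.
Qed.

Lemma torus_ev_z t : torus_ev t z_ = 1.
Proof.
rewrite /torus_ev /torus !mxE summxE !eq_idxE big1 ?add0r // => k _.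
by rewrite !mxE !eq_idxE !mulr0 addr0.
Qed.

Definition torus_evE := (torus_ev_x, torus_ev_y, torus_ev_z).

Lemma torus_ev_dual t a : torus_ev t (dual a) = (torus_ev t a)^-1.
Proof. by case: (idxP a) => [k|k|]; rewrite !dualE !torus_evE ?invrK ?invr1. Qed.

Lemma torus_ev_neq0 t a : (forall k, t k != 0) -> torus_ev t a != 0.
Proof. by move=> t0; case: (idxP a) => [k|k|]; rewrite torus_evE ?invr_eq0 ?oner_neq0. Qed.

Lemma torus_evM (s t : 'I_r -> K) a : torus_ev (fun k => s k * t k) a = torus_ev s a * torus_ev t a.
Proof. by case: (idxP a) => [k|k|]; rewrite !torus_evE ?invfM ?mulr1. Qed.

Lemma torus_ev1 a : torus_ev (fun _ : 'I_r => 1) a = 1.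
Proof. by case: (idxP a) => [k|k|]; rewrite !torus_evE ?invr1. Qed.

Lemma torus_diag t : torus t = diag_mx (\row_a torus_ev t a).
Proof. by apply/matrixP => a b; rewrite torusE !mxE. Qed.

Lemma torusM (s t : 'I_r -> K) : torus s *m torus t = torus (fun k => s k * t k).
Proof.
apply/matrixP => a b; rewrite torusE torus_evM torus_diag mul_diag_mx mxE.
by rewrite torusE mxE mulrnAr.
Qed.

Lemma torus1 : @torus K r (fun=> 1) = 1%:M :> 'M[K]_n.
Proof. by apply/matrixP => a b; rewrite torusE torus_ev1 mxE. Qed.

Lemma adj_torus t : adj (torus t) = torus (fun k => (t k)^-1).
Proof.
apply/matrixP => a b; rewrite [RHS]torusE /adj torus_diag tr_diag_mx mul_mx_diag mxE.
rewrite (bigD1 (dual a)) //= big1 => [|c ca]; last first.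
  by rewrite !mxE (negPf ca) mulr0n !mul0r.
rewrite !mxE eqxx dualK form_wt_dual mulr1n torus_ev_dual addr0 eq_sym.
have -> : torus_ev (fun k => (t k)^-1) a = (torus_ev t a)^-1.
  by case: (idxP a) => [k|k|]; rewrite !torus_evE ?invr1.
by rewrite mulrnAr mulrAC mulVf ?form_wt_neq0 // mul1r.
Qed.

End Form.

Section TorusSO.
Variables (K : numClosedFieldType) (r : nat).

Lemma torus_SO (t : 'I_r -> K) : (forall k, t k != 0) -> in_SO (torus t).
Proof.
move=> t0; apply: (@isom_sqr_SO _ _ _ (torus (fun k => sqrtC (t k)))).
  rewrite /isom adj_torus torusM -torus1; apply/matrixP => a b; rewrite !torusE.
  by case: (idxP a) => [k|k|]; rewrite !torus_evE // mulVf ?sqrtC_eq0.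
by rewrite torusM; apply/matrixP => a b; rewrite !torusE;
  case: (idxP a) => [k|k|]; rewrite !torus_evE // -expr2 sqrtCK.
Qed.

End TorusSO.

(** * Generation by Eichler transformations *)

Section Reflections.
Variables (K : numFieldType) (r : nat).
Local Notation n := (r.*2.+1).
Implicit Types (u v w : 'cV[K]_n) (g h : 'M[K]_n).

(** Both sides are the determinant of the block matrix with rows (1, u) and (w, 1), factored in two
    ways into block triangular matrices. *)
Lemma det_1_sub_mul m (u : 'cV[K]_m) (w : 'rV[K]_m) :
  \det (1%:M - u *m w) = 1 - (w *m u) 0 0.
Proof.
have := congr1 determinant
  (mulmx_block 1%:M 0 w 1%:M 1%:M u 0 (1%:M - w *m u)).
rewrite det_mulmx det_lblock det_ublock !det1 !mul1r det_mx11.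
have -> : (1%:M - w *m u) 0 0 = 1 - (w *m u) 0 0 by rewrite !mxE eqxx.
move=> ->; have := congr1 determinant
  (mulmx_block (1%:M - u *m w) u 0 1%:M 1%:M 0 w 1%:M).
rewrite det_mulmx det_lblock det_ublock !det1 !mulr1 => ->.
rewrite !(mulmx1, mul1mx, mulmx0, mul0mx, addr0, add0r) subrK.
by rewrite [_ + (_ - _)]addrC subrK.
Qed.

Definition refl u : 'M[K]_n := 1%:M - (2 / bil u u) *: dyad u u.

Lemma refl_mulv u w : refl u *m w = w - (2 / bil u u * bil u w) *: u.
Proof. by rewrite mulmxBl mul1mx -scalemxAl dyad_mulv scalerA. Qed.

Lemma adj_refl u : adj (refl u) = refl u.
Proof. by rewrite /refl adjD adjN adj1 adjZ adj_dyad. Qed.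

Lemma reflK u : bil u u != 0 -> refl u *m refl u = 1%:M.
Proof.
move=> u0; rewrite {2}/refl mulmxBr mulmx1 -scalemxAr mul_dyad refl_mulv.
rewrite divfK // -[X in dyad (X - _)]scale1r -scalerBl dyadZl /refl.
by apply/matrixP => i j; rewrite !mxE; ring.
Qed.

Lemma refl_isom u : bil u u != 0 -> isom (refl u).
Proof. by move=> u0; rewrite /isom adj_refl reflK. Qed.

Lemma det_refl u : bil u u != 0 -> \det (refl u) = -1.
Proof.
move=> u0; rewrite /refl /dyad -mulmxA scalemxAl det_1_sub_mul -scalemxAr mxE.
by rewrite -[(_ *m _) 0 0]/(bil u u) divfK //; ring.
Qed.

Lemma refl_fix u w : bil u w = 0 -> refl u *m w = w.
Proof. by move=> uw; rewrite refl_mulv uw mulr0 scale0r subr0. Qed.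

Lemma refl_self u : bil u u != 0 -> refl u *m u = - u.
Proof.
move=> u0; rewrite refl_mulv divfK // -[X in X - _]scale1r -scalerBl -scaleN1r.
by congr (_ *: _); ring.
Qed.

Lemma refl_sub u v : bil u u = bil v v -> bil (u - v) (u - v) != 0 ->
  refl (u - v) *m u = v.
Proof.
move=> uv d0; rewrite refl_mulv.
have e : bil (u - v) (u - v) = 2 * bil (u - v) u by rewrite !bilE uv (bilC v u); ring.
have -> : 2 / bil (u - v) (u - v) * bil (u - v) u = 1.
  by rewrite mulrAC -e divff.
by rewrite scale1r subKr.
Qed.

Lemma reflZ c u : c != 0 -> refl (c *: u) = refl u.
Proof.
move=> c0; rewrite /refl !bilE !dyadLE !scalerA; congr (_ - _ *: _).
have [->|u0] := eqVneq (bil u u) 0; first by rewrite !mulr0 invr0 mulr0 !mul0r.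
by field; rewrite u0.
Qed.

Definition refl_prod (us : seq 'cV[K]_n) := foldr (fun u M => refl u *m M) 1%:M us.
Definition anisotropic u := bil u u != 0.

Lemma det_refl_prod us : all anisotropic us -> \det (refl_prod us) = (-1) ^+ size us.
Proof.
elim: us => [|u us IH] /=; first by rewrite det1.
by move=> /andP[u0 us0]; rewrite det_mulmx det_refl // IH // exprS.
Qed.

(** The coordinate vectors x_k and y_k are isotropic, so reflections need another basis: x_k + y_k,
    x_k - y_k and z are orthogonal and anisotropic. *)
Definition orth_basis (a : 'I_n) : 'cV[K]_n :=
  if a == z_idx r then evec K a else
  if odd a then evec K (dual a) - evec K a else evec K a + evec K (dual a).

Lemma orth_basis_x k : orth_basis (x_idx k) = evec K (x_idx k) + evec K (y_idx k).
Proof. by rewrite /orth_basis eq_idxE x_idxE odd_double dualE. Qed.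
Lemma orth_basis_y k : orth_basis (y_idx k) = evec K (x_idx k) - evec K (y_idx k).
Proof. by rewrite /orth_basis eq_idxE y_idxE /= odd_double dualE. Qed.
Lemma orth_basis_z : orth_basis (z_idx r) = evec K (z_idx r).
Proof. by rewrite /orth_basis eqxx. Qed.
Definition orth_basisE := (orth_basis_x, orth_basis_y, orth_basis_z).

Lemma orth_basis_orth a b : a != b -> bil (orth_basis a) (orth_basis b) = 0.
Proof.
case: (idxP a) => [k|k|]; case: (idxP b) => [l|l|]; rewrite !eq_idxE => kl //;
  rewrite !orth_basisE ?bilE !bil_evec !dualE !eq_idxE /form_wt !eq_idxE;
  rewrite ?(eq_sym l k) ?(negPf kl) ?mulr0n; ring.
Qed.

Lemma orth_basis_aniso a : anisotropic (orth_basis a).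
Proof.
rewrite /anisotropic; case: (idxP a) => [k|k|]; rewrite !orth_basisE ?bilE;
  rewrite !bil_evec !dualE !eq_idxE /form_wt !eq_idxE ?mulr0n ?mulr1n;
  rewrite ?addr0 ?add0r ?oppr0 ?addr0 ?add0r -?opprD ?oppr_eq0 ?pnatr_eq0 //;
  by rewrite -mulr2n pnatr_eq0.
Qed.

Lemma orth_basis_fix g : (forall a, g *m orth_basis a = orth_basis a) -> g = 1%:M.
Proof.
move=> gf; have ge a : g *m evec K a = evec K a.
  case: (idxP a) => [k|k|]; last by rewrite -orth_basis_z gf.
    have -> : evec K (x_idx k) = 2^-1 *: (orth_basis (x_idx k) + orth_basis (y_idx k)).
      by rewrite !orth_basisE; apply/matrixP => i j; rewrite !mxE; field.
    by rewrite -scalemxAr mulmxDr !gf.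
  have -> : evec K (y_idx k) = 2^-1 *: (orth_basis (x_idx k) - orth_basis (y_idx k)).
    by rewrite !orth_basisE; apply/matrixP => i j; rewrite !mxE; field.
  by rewrite -scalemxAr mulmxBr !gf.
apply/matrixP => i j; have := congr1 (fun M : 'cV_n => M i 0) (ge j).
by rewrite /evec -colE !mxE eqxx andbT.
Qed.

(* Cartan-Dieudonne: for anisotropic v one of g v - v, g v + v is anisotropic,
   so one or two reflections carry g v to v without moving its orthogonal. *)
Lemma isom_refl_prod g : isom g -> exists2 us, all anisotropic us & g = refl_prod us.
Proof.
(* Induction on the number [k] of vectors of the orthogonal basis that [h] may still move. *)
suff CD k h : isom h -> (forall a : 'I_n, (k <= a)%N -> h *m orth_basis a = orth_basis a) ->
    exists2 us, all anisotropic us & h = refl_prod us.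
  by move=> gi; apply: (CD n g gi) => a; rewrite leqNgt ltn_ord.
elim: k h => [|k IH] h hi hf.
  by exists [::] => //=; apply: orth_basis_fix => a; apply: hf.
have [kn|kn] := ltnP k n; last first.
  by apply: IH => // a ka; have := leq_ltn_trans (leq_trans kn ka) (ltn_ord a); rewrite ltnn.
pose v := orth_basis (Ordinal kn); have v0 : bil v v != 0 := orth_basis_aniso _.
have hv : bil (h *m v) (h *m v) = bil v v by apply: bil_isom.
have ov (a : 'I_n) : (k < a)%N -> bil v (orth_basis a) = 0.
  by move=> ka; apply: orth_basis_orth; rewrite -val_eqE /= neq_ltn ka.
have ohv (a : 'I_n) : (k < a)%N -> bil (h *m v) (orth_basis a) = 0.
  by move=> ka; rewrite -(hf a ka) bil_isom // ov.
have step u : bil u u != 0 -> (forall a : 'I_n, (k < a)%N -> bil u (orth_basis a) = 0) ->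
    forall h' : 'M_n, isom h' ->
    (forall a : 'I_n, (k < a)%N -> h' *m orth_basis a = orth_basis a) ->
    isom (refl u *m h') /\
    (forall a : 'I_n, (k < a)%N -> (refl u *m h') *m orth_basis a = orth_basis a).
  move=> u0 uo h' h'i h'f; split; first by apply: isomM => //; apply: refl_isom.
  by move=> a ka; rewrite -mulmxA h'f // refl_fix // uo.
have fin h' : isom h' -> (forall a : 'I_n, (k < a)%N -> h' *m orth_basis a = orth_basis a) ->
    h' *m v = v -> exists2 us, all anisotropic us & h' = refl_prod us.
  move=> h'i h'f h'v; apply: IH => // a; rewrite leq_eqVlt => /predU1P[ka|]; last exact: h'f.
  by have -> : a = Ordinal kn by apply/val_inj.
have [d0|d0] := eqVneq (bil (h *m v - v) (h *m v - v)) 0; last first.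
  have o (a : 'I_n) : (k < a)%N -> bil (h *m v - v) (orth_basis a) = 0.
    by move=> ka; rewrite !bilE ohv // ov // subr0.
  have [i1 f1] := step _ d0 o h hi hf.
  have [] := fin _ i1 f1; first by rewrite -mulmxA refl_sub.
  move=> us us0 e; exists ((h *m v - v) :: us); rewrite /= ?us0 ?andbT //.
  by rewrite -e mulmxA reflK // mul1mx.
have s0 : bil (h *m v + v) (h *m v + v) != 0.
  have : bil (h *m v + v) (h *m v + v) + bil (h *m v - v) (h *m v - v) = 4 * bil v v.
    by rewrite !bilE hv; ring.
  by rewrite d0 addr0 => ->; rewrite mulf_neq0 // pnatr_eq0.
have o (a : 'I_n) : (k < a)%N -> bil (h *m v + v) (orth_basis a) = 0.
  by move=> ka; rewrite !bilE ohv // ov // addr0.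
have [i1 f1] := step _ s0 o h hi hf; have [i2 f2] := step _ v0 ov _ i1 f1.
have [] := fin _ i2 f2.
  rewrite -!mulmxA; have := @refl_sub (h *m v) (- v); rewrite opprK => -> //.
    by rewrite mulmxN refl_self // opprK.
  by rewrite hv !bilE opprK.
move=> us us0 e; exists ((h *m v + v) :: v :: us); first by rewrite /= us0 andbT; apply/andP.
by rewrite /= -e !mulmxA -[_ *m refl v *m refl v]mulmxA reflK // mulmx1 reflK // mul1mx.
Qed.

Inductive eich_gen : 'M[K]_n -> Prop :=
  | eich_gen1 : eich_gen 1%:M
  | eich_genM u v g : bil u u = 0 -> bil u v = 0 -> eich_gen g ->
      eich_gen (eich u v *m g).

Lemma eich_gen_mul g h : eich_gen g -> eich_gen h -> eich_gen (g *m h).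
Proof.
move=> + hg; elim=> [|u v g' uu uv _ IH]; first by rewrite mul1mx.
by rewrite -mulmxA; apply: eich_genM.
Qed.

Lemma eich_genE u v : bil u u = 0 -> bil u v = 0 -> eich_gen (eich u v).
Proof. by move=> uu uv; rewrite -[eich u v]mulmx1; apply: eich_genM => //; constructor. Qed.

(** For vectors of norm 2, the value [bil u w = 2] makes u - w isotropic and orthogonal to u, so the
    product of the reflections is unipotent instead of a rotation. *)
Lemma refl_mul_eich u w : bil u u = 2 -> bil w w = 2 -> bil u w = 2 ->
  refl u *m refl w = eich (u - w) u.
Proof.
move=> uu ww uw; rewrite /refl uu ww divff ?pnatr_eq0 // !scale1r.
rewrite /eich quad_formE uu mulVf ?pnatr_eq0 // scale1r !mulmxBr !mulmxBl !mul1mx mulmx1.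
rewrite dyad_mul uw !dyadLE.
by apply/matrixP => i j; rewrite !mxE; ring.
Qed.

Lemma refl_mul_gen u w : bil u u = 2 -> bil w w = 2 -> bil u w = 2 ->
  eich_gen (refl u *m refl w).
Proof.
move=> uu ww uw; rewrite refl_mul_eich //; apply: eich_genE; rewrite !bilE ?uu ?ww ?uw.
  by rewrite (bilC w u) uw; ring.
by rewrite (bilC w u) uw; ring.
Qed.

(** The Gram determinant 4 - b^2 of u and v is nonzero, so [p] projects onto their orthogonal
    complement. If all the vectors tested there were isotropic, polarization would give p = 0, and
    the identity in dimension 2r + 1 >= 3 would have rank at most 2. *)
Lemma exists_aniso_orth u v : (0 < r)%N -> bil u u = 2 -> bil v v = 2 ->
  bil u v ^+ 2 != 4 -> exists w, [/\ bil w u = 0, bil w v = 0 & bil w w != 0].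
Proof.
move=> r0 uu vv uv; set b := bil u v in uv.
have d0 : 4 - b ^+ 2 != 0 by rewrite subr_eq0 eq_sym.
pose ca e := (2 * bil e u - b * bil e v) / (4 - b ^+ 2).
pose cb e := (2 * bil e v - b * bil e u) / (4 - b ^+ 2).
pose p e := e - ca e *: u - cb e *: v.
have pu e : bil (p e) u = 0.
  by rewrite /p /ca /cb !bilE uu (bilC v u) -/b; field.
have pv e : bil (p e) v = 0.
  by rewrite /p /ca /cb !bilE vv -/b; field.
have pD e e' : p (e + e') = p e + p e'.
  rewrite /p /ca /cb !bilE; apply/matrixP => i j; rewrite !mxE; field.
  exact: d0.
have pE e : p e = e - ca e *: u - cb e *: v by [].
clearbody p ca cb.
have [[a c] /= h|h] := pickP (fun ac : 'I_n * 'I_n =>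
  bil (p (evec K ac.1 + evec K ac.2)) (p (evec K ac.1 + evec K ac.2)) != 0).
  by exists (p (evec K a + evec K c)).
have {}h a c : bil (p (evec K a + evec K c)) (p (evec K a + evec K c)) = 0.
  by have /negbFE/eqP := h (a, c).
have haa a : bil (p (evec K a)) (p (evec K a)) = 0.
  have := h a a; rewrite pD !bilE.
  set B := bil _ _ => e; have /eqP : 4 * B = 0 by rewrite -e; ring.
  by rewrite mulf_eq0 pnatr_eq0 => /eqP.
have hac a c : bil (p (evec K a)) (p (evec K c)) = 0.
  have := h a c; rewrite pD !bilE !haa (bilC (p (evec K c))) add0r addr0.
  by move=> /eqP; rewrite -mulr2n mulrn_eq0 => /eqP.
have p0 a : p (evec K a) = 0.
  apply/matrixP => i j; rewrite ord1 mxE.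
  have e : bil (p (evec K a)) (evec K (dual i)) = 0.
    by rewrite -(hac a (dual i)) (pE (evec K (dual i))) !bilE pu pv !mulr0 !subr0.
  move/eqP: e; rewrite bil_evecr dualK mulf_eq0 (negPf (form_wt_neq0 _ _)) /=.
  by move/eqP.
have e1 : 1%:M = u *m (\row_a ca (evec K a)) + v *m (\row_a cb (evec K a)).
  apply/matrixP => i a; have := congr1 (fun M : 'cV_n => M i 0) (p0 a).
  rewrite pE /evec !mxE !big_ord1 !mxE eqxx andbT => /eqP.
  rewrite -addrA -opprD subr_eq0 => /eqP->.
  by rewrite (mulrC (u _ _)) (mulrC (v _ _)).
have := mxrank1 K n; rewrite e1 => rk.
have := leq_trans (mxrank_add _ _) (leq_add
  (leq_trans (mxrankM_maxl u (\row_a ca (evec K a))) (rank_leq_col u))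
  (leq_trans (mxrankM_maxl v (\row_a cb (evec K a))) (rank_leq_col v))).
by rewrite rk -[(_ <= _)%N]/(r.*2 < 1.*2)%N ltn_double ltnNge r0.
Qed.

End Reflections.

Section Generation.
Variables (K : numClosedFieldType) (r : nat).
Hypothesis r0 : (0 < r)%N.
Local Notation n := (r.*2.+1).
Implicit Types (u v w : 'cV[K]_n) (g h : 'M[K]_n).

(* Two unit vectors are joined by a third one whose products with both are as
   in [refl_mul_eich]. *)
Lemma refl2_gen u v : bil u u = 2 -> bil v v = 2 -> eich_gen (refl u *m refl v).
Proof.
move=> uu vv; have [uv|uv] := eqVneq (bil u v) 2; first exact: refl_mul_gen.
have [uv'|uv'] := eqVneq (bil u v) (-2).
  rewrite -(@reflZ _ _ (-1) v) ?oppr_eq0 ?oner_neq0 // scaleN1r.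
  by apply: refl_mul_gen; rewrite ?bilE ?uv' ?opprK.
have uv2 : bil u v ^+ 2 != 4.
  have -> : 4 = 2 ^+ 2 :> K by rewrite -natrX.
  by rewrite eqf_sqr negb_or uv uv'.
have [m [mu mv mm]] := exists_aniso_orth r0 uu vv uv2.
set b := bil u v in uv uv' uv2.
have b2 : 2 + b != 0 by rewrite addrC addr_eq0.
(* The coefficient 2 / (2 + b) of u + v makes both products equal to 2; the multiple of [m],
   orthogonal to u and v, corrects the norm from 8 / (2 + b) to 2. *)
pose c := sqrtC ((2 - 8 / (2 + b)) / bil m m).
pose w := (2 / (2 + b)) *: (u + v) + c *: m.
have uw : bil u w = 2.
  by rewrite /w !bilE uu -/b (bilC u m) mu; field.
have vw : bil w v = 2.
  by rewrite /w !bilE vv -/b mv; field.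
have ww : bil w w = 2.
  have c2 : c * (c * bil m m) = 2 - 8 / (2 + b) by rewrite mulrA -expr2 sqrtCK divfK.
  rewrite /w !bilE (bilC u m) (bilC v m) mu mv uu vv (bilC v u) -/b c2; field.
  exact: b2.
have -> : refl u *m refl v = (refl u *m refl w) *m (refl w *m refl v).
  by rewrite mulmxA -(mulmxA (refl u)) reflK ?mulmx1 // ww pnatr_eq0.
by apply: eich_gen_mul; apply: refl_mul_gen.
Qed.

Lemma refl_mul2_gen u v : bil u u != 0 -> bil v v != 0 -> eich_gen (refl u *m refl v).
Proof.
have norm w : bil w w != 0 -> exists2 w', bil w' w' = 2 & refl w = refl w'.
  move=> w0; have c0 : 2 / bil w w != 0 by rewrite mulf_neq0 ?invr_eq0 ?pnatr_eq0.
  exists (sqrtC (2 / bil w w) *: w); last by rewrite reflZ // sqrtC_eq0.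
  by rewrite !bilE mulrA -expr2 sqrtCK divfK.
by move=> /norm[u' uu ->] /norm[v' vv ->]; apply: refl2_gen.
Qed.

(** Determinant 1 makes the number of reflections even, so they can be taken in pairs; the induction
    is on a bound for their number. *)
Lemma SO_eich_gen g : in_SO g -> eich_gen g.
Proof.
move=> /in_SOE[gi gd]; have [us us0 gE] := isom_refl_prod gi.
have : ~~ odd (size us).
  apply/negP => o; move: gd; rewrite gE det_refl_prod // -signr_odd o expr1.
  by move/eqP; rewrite eq_sym -addr_eq0 -mulr2n pnatr_eq0.
rewrite gE; move: {2}(size us) (leqnn (size us)) us0 => m.
elim: m us {gE} => [|m IH] us.
  by case: us => [_ _ _|//]; exact: eich_gen1.
case: us => [|u [|v us]]; first by move=> _ _ _; exact: eich_gen1.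
  by move=> _ _ /negP[].
rewrite /= negbK !ltnS => szm /and3P[u0 v0 us0] ev.
rewrite mulmxA; apply: eich_gen_mul; first exact: refl_mul2_gen.
by apply: IH => //; apply: ltnW.
Qed.

Lemma SO_eich_ind (P : 'M[K]_n -> Prop) :
  P 1%:M ->
  (forall u v g, bil u u = 0 -> bil u v = 0 -> P g -> P (eich u v *m g)) ->
  forall g, in_SO g -> P g.
Proof.
move=> P1 PM g /SO_eich_gen; elim=> [|u v g' uu uv _ IH]; first exact: P1.
exact: PM.
Qed.

End Generation.

(** * Density of the conjugates of the torus *)

Section InversePairs.
Variable K : fieldType.

(** Inversion has no fixed point in L, as 1 and -1 are excluded; M collects one element of each
    pair. *)
Lemma inverse_pairing (L : seq K) :
  uniq L -> 0 \notin L -> 1 \notin L -> -1 \notin L ->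
  (forall a, a \in L -> a^-1 \in L) ->
  exists M, perm_eq L (M ++ [seq a^-1 | a <- M]).
Proof.
have [m] := ubnP (size L); elim: m L => // m IH [|a L] /=; first by exists [::].
rewrite ltnS => szL /andP[aL uL]; rewrite !inE !negb_or.
move=> /andP[a0 L0] /andP[a1 L1] /andP[aN1 LN1] inv.
have aia : a^-1 != a.
  apply/negP => /eqP aa; have : a ^+ 2 = 1 ^+ 2.
    by rewrite expr2 -{1}aa mulVf ?expr1n // eq_sym.
  move/eqP; rewrite eqf_sqr => /orP[/eqP e|/eqP e].
    by rewrite e eqxx in a1.
  by rewrite e eqxx in aN1.
have aiL : a^-1 \in L by have := inv a (mem_head _ _); rewrite inE (negPf aia).
have sub b : b \in rem a^-1 L -> b \in L by apply: mem_rem.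
have [||||||M MP] := IH (rem a^-1 L).
- by rewrite size_rem //; apply: leq_ltn_trans (leq_pred _) szL.
- exact: rem_uniq.
- by apply: contra L0 => /sub.
- by apply: contra L1 => /sub.
- by apply: contra LN1 => /sub.
- move=> b; rewrite !mem_rem_uniq // !inE => /andP[ba bL].
  have := inv b; rewrite !inE bL orbT => /(_ isT)/orP[/eqP e|->].
    by rewrite -e invrK eqxx in ba.
  by rewrite andbT (inj_eq invr_inj); apply: contraNneq aL => <-.
exists (a :: M); rewrite /= perm_cons (permPl (perm_to_rem aiL)).
by rewrite -cat_rcons -cats1 -catA perm_sym perm_catCA /= perm_cons perm_sym.
Qed.

End InversePairs.

Section Eigenvectors.
Variable K : fieldType.

Lemma char_poly_tr n (A : 'M[K]_n) : char_poly A^T = char_poly A.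
Proof.
rewrite /char_poly -[RHS]det_tr; congr (\det _).
by apply/matrixP => i j; rewrite !mxE eq_sym.
Qed.

Lemma root_char_poly_col n (A : 'M[K]_n) a :
  root (char_poly A) a <-> exists2 w : 'cV_n, w != 0 & A *m w = a *: w.
Proof.
rewrite -char_poly_tr -eigenvalue_root_char; split.
  move=> /eigenvalueP[v vA v0]; exists v^T; rewrite ?trmx_eq0 //.
  by rewrite -[A]trmxK -trmx_mul vA linearZ.
move=> [w w0 Aw]; apply/eigenvalueP; exists w^T; rewrite ?trmx_eq0 //.
by rewrite -trmx_mul Aw linearZ.
Qed.

(** The kernel of Q is stable under the diagonal matrix of eigenvalues. Multiplying a kernel vector
    by the factors ev - ev b for all b != a leaves only its entry at a, up to a nonzero factor. *)
Lemma eigenvectors_unitmx n (A : 'M[K]_n) (ev : 'I_n -> K) (v : 'I_n -> 'cV[K]_n) :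
  injective ev -> (forall a, v a != 0) -> (forall a, A *m v a = ev a *: v a) ->
  (\matrix_(i, a) v a i 0) \in unitmx.
Proof.
move=> evI v0 Av; set Q := \matrix_(i, a) _.
have AQ : A *m Q = Q *m diag_mx (\row_a ev a).
  apply/matrixP => i a; rewrite mul_mx_diag !mxE mulrC.
  have := congr1 (fun M : 'cV_n => M i 0) (Av a); rewrite !mxE => <-.
  by apply: eq_bigr => k _; rewrite mxE.
have ker (s : seq K) (u : 'cV_n) : Q *m u = 0 ->
    Q *m (\col_b (u b 0 * \prod_(c <- s) (ev b - c))) = 0.
  move=> Qu; elim: s => [|c s IH].
    by rewrite -[RHS]Qu; congr (_ *m _); apply/matrixP => b j; rewrite ord1 mxE big_nil mulr1.
  have -> : \col_b (u b 0 * \prod_(d <- c :: s) (ev b - d)) =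
    (diag_mx (\row_a ev a) - c%:M) *m \col_b (u b 0 * \prod_(d <- s) (ev b - d)).
    apply/matrixP => b j; rewrite mulmxBl mul_diag_mx mul_scalar_mx !mxE big_cons.
    by ring.
  by rewrite mulmxA mulmxBr -AQ mul_mx_scalar mulmxBl -scalemxAl -!mulmxA IH mulmx0 scaler0 subr0.
rewrite -unitmx_tr -row_free_unit; apply: inj_row_free => u uQ.
have Qu : Q *m u^T = 0 by rewrite -[Q]trmxK -trmx_mul uQ trmx0.
apply/matrixP => i a; rewrite ord1 mxE.
have := ker [seq ev b | b <- enum 'I_n & b != a] _ Qu.
set w := \col_b _ => Qw.
have wE b : b != a -> w b 0 = 0.
  move=> ba; rewrite mxE; apply/eqP; rewrite mulf_eq0 prodf_seq_eq0; apply/orP; right.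
  apply/hasP; exists (ev b); last by rewrite /= subrr.
  by apply: map_f; rewrite mem_filter ba mem_enum.
have wa0 : w a 0 = 0.
  have /rV0Pn[k vk] : (v a)^T != 0 by rewrite trmx_eq0.
  have := congr1 (fun M : 'cV_n => M k 0) Qw.
  rewrite !mxE (bigD1 a) //= big1 ?addr0 => [|b ba]; last by rewrite wE // mulr0.
  by move: vk; rewrite !mxE => /negPf vk /eqP; rewrite mulf_eq0 vk => /eqP.
move/eqP: wa0; rewrite !mxE mulf_eq0 => /orP[/eqP//|].
rewrite prodf_seq_eq0 => /hasP[c /mapP[b]].
by rewrite mem_filter => /andP[ba _] -> /= /eqP/subr0_eq/evI e; rewrite e eqxx in ba.
Qed.

End Eigenvectors.

(** * Diagonalization of elements with distinct eigenvalues *)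

Section Diagonalization.
Variables (K : numClosedFieldType) (r : nat).
Local Notation n := (r.*2.+1).
Implicit Types (g h P : 'M[K]_n) (t : 'I_r -> K).

Definition regular_torus t := (forall k, t k != 0) /\ injective (torus_ev t).

Lemma isom_gramP P :
  (forall a b, bil (P *m evec K a) (P *m evec K b) = form_wt K a *+ (b == dual a)) ->
  isom P.
Proof.
move=> PP; suff e : P^T *m form_mx K r *m P = form_mx K r.
  by rewrite /isom /adj -!mulmxA [P^T *m _]mulmxA e form_invK.
apply/matrixP => a b; rewrite [RHS]mxE -PP /bil trmx_mul.
by rewrite mulmxA -(mulmxA (evec K a)^T) -(mulmxA (evec K a)^T) evec_entry.
Qed.

(** The form turns a left eigenvector of g into an eigenvector, for the same eigenvalue, of [adj g],
    which is the inverse of g. *)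
Lemma root_char_polyV g a : isom g -> root (char_poly g) a -> a != 0 /\ root (char_poly g) a^-1.
Proof.
move=> gi; rewrite -{1}eigenvalue_root_char => /eigenvalueP[v vg v0].
have w0 : form_inv K r *m v^T != 0.
  apply: contraNneq v0 => /(congr1 (mulmx (form_mx K r))).
  by rewrite mulmxA form_mxK mul1mx mulmx0 => /eqP; rewrite trmx_eq0.
have gw : adj g *m (form_inv K r *m v^T) = a *: (form_inv K r *m v^T).
  rewrite /adj -!mulmxA (mulmxA (form_mx K r)) form_mxK mul1mx -trmx_mul vg.
  by rewrite linearZ /= -scalemxAr.
have wE : form_inv K r *m v^T = a *: (g *m (form_inv K r *m v^T)).
  by rewrite scalemxAr -gw (mulmxA g) isomC // mul1mx.
have a0 : a != 0 by apply: contraNneq w0 => a0; rewrite wE a0 scale0r.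
split=> //; apply/root_char_poly_col; exists (form_inv K r *m v^T) => //.
by rewrite {2}wE scalerA mulVf // scale1r.
Qed.

(** The spectrum is stable under inversion, so apart from 1 and -1 it consists of pairs. As its size
    2r + 1 is odd, exactly one of 1 and -1 occurs, and determinant 1 shows that it is 1. *)
Lemma regular_torus_of_roots g (L : seq K) : in_SO g -> uniq L ->
  char_poly g = \prod_(a <- L) ('X - a%:P) ->
  exists2 t, regular_torus t & forall a, torus_ev t a \in L.
Proof.
move=> /in_SOE[gi gd] uL pE.
have rootE a : root (char_poly g) a = (a \in L) by rewrite pE root_prod_XsubC.
have szL : size L = n.
  by have := size_char_poly g; rewrite pE size_prod_XsubC => -[].
have L0 : 0 \notin L.
  by apply/negP; rewrite -rootE => /(root_char_polyV gi)[]; rewrite eqxx.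
have inv a : a \in L -> a^-1 \in L.
  by rewrite -!rootE => /(root_char_polyV gi)[].
have prodL : \prod_(a <- L) a = 1.
  have := char_poly_det g; rewrite gd mulr1 -horner_coef0 pE horner_prod.
  under eq_bigr do rewrite hornerXsubC sub0r.
  have -> : \prod_(a <- L) - a = (-1) ^+ size L * \prod_(a <- L) a.
    elim: (L) => [|a s IH]; first by rewrite !big_nil mulr1.
    by rewrite !big_cons IH exprS; ring.
  by rewrite szL -[RHS]mulr1 => /(@lreg_sign _ _ _ _)->.
pose L2 := [seq a <- [seq a <- L | a != 1] | a != -1].
have [||||| M ML] := @inverse_pairing _ L2.
- by rewrite !filter_uniq.
- by rewrite !mem_filter (negPf L0) !andbF.
- by rewrite !mem_filter eqxx andbF.
- by rewrite !mem_filter eqxx.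
- move=> a; rewrite !mem_filter => /and3P[aN1 a1 /inv->].
  by rewrite andbT -{1}[-1]invrK invrN invr1 !(inj_eq invr_inj) -{2}[1]invr1 (inj_eq invr_inj) aN1.
have LP : perm_eq L (nseq (1 \in L) 1 ++ nseq (-1 \in L) (-1) ++ M ++ [seq a^-1 | a <- M]).
  have split1 a (s : seq K) : uniq s -> perm_eq s (nseq (a \in s) a ++ [seq b <- s | b != a]).
    move=> us; rewrite -(permPl (permEl (perm_filterC (pred1 a) s))) perm_cat2r.
    have [/(filter_pred1_uniq us)->//|/count_memPn/eqP] := boolP (a \in s).
    by rewrite -size_filter size_eq0 => /eqP->.
  rewrite (permPl (split1 1 _ uL)) perm_cat2l.
  rewrite (permPl (split1 (-1) _ (filter_uniq _ uL))) mem_filter.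
  by rewrite eq_sym -addr_eq0 -mulr2n pnatr_eq0 perm_cat2l.
have prod2 : \prod_(a <- M ++ [seq a^-1 | a <- M]) a = 1.
  rewrite big_cat big_map /= -big_split /= big_seq big1 // => a aM.
  rewrite divff //; apply: contraNneq L0 => <-.
  by rewrite (perm_mem LP) !mem_cat aM !orbT.
have [L1 LN1] : (1 \in L) /\ (-1 \notin L).
  have := perm_size LP; rewrite szL !size_cat !size_nseq size_map.
  move/(congr1 odd); rewrite /= odd_double !oddD addbb addbF.
  have := prodL; rewrite (perm_big _ LP) /= !big_cat /= -big_cat /= prod2 mulr1.
  case: (1 \in L); case: (-1 \in L) => //=; rewrite !big_seq1 big_nil mul1r => /eqP.
  by rewrite eq_sym -addr_eq0 -mulr2n pnatr_eq0.
rewrite L1 (negPf LN1) /= in LP.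
have := uL; rewrite (perm_uniq LP) /= mem_cat negb_or cat_uniq => /andP[/andP[M1 M1'] /and3P[uM dM _]].
have szM : size M = r.
  have := perm_size LP; rewrite szL /= size_cat size_map => -[].
  by rewrite addnn => /double_inj.
have nM (k : 'I_r) : M`_k \in M by rewrite mem_nth // szM.
have nM' (k : 'I_r) : (M`_k)^-1 \in [seq a^-1 | a <- M] by apply: map_f.
have nI (k l : 'I_r) : M`_k = M`_l -> k = l.
  by move/eqP; rewrite nth_uniq ?szM // => /eqP/val_inj.
have ne a b : a \in M -> b \in [seq a^-1 | a <- M] -> a <> b.
  by move=> aM bM e; case/negP: dM; apply/hasP; exists b; rewrite // -e.
exists (fun k : 'I_r => M`_k); first split.
- by move=> k; apply: contraNneq L0 => <-; rewrite (perm_mem LP) inE mem_cat nM orbT.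
- move=> a b; case: (idxP a) => [k|k|]; case: (idxP b) => [l|l|]; rewrite !torus_evE //.
  + by move=> /nI->.
  + by move=> e; case: (ne _ _ (nM k) (nM' l)).
  + by move=> e; move: M1; rewrite -e nM.
  + by move=> e; case: (ne _ _ (nM l) (nM' k)).
  + by move=> /invr_inj/nI->.
  + by move=> e; move: M1'; rewrite -e nM'.
  + by move=> e; move: M1; rewrite e nM.
  + by move=> e; move: M1'; rewrite e nM'.
move=> a; rewrite (perm_mem LP) inE mem_cat.
by case: (idxP a) => [k|k|]; rewrite torus_evE ?eqxx ?nM ?nM' ?orbT.
Qed.

(** Eigenvectors are orthogonal unless their eigenvalues have product 1, that is, unless their
    indices are dual. So their Gram matrix has the shape of [form_mx], and rescaling makes it
    equal. *)
Lemma SO_diagonalize g t : in_SO g -> regular_torus t ->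
  (forall a, root (char_poly g) (torus_ev t a)) ->
  exists2 P, in_SO P & g *m P = P *m torus t.
Proof.
move=> /in_SOE[gi gd] [t0 tI] tr.
have /fin_all_exists2[v v0 gv] := fun a => (root_char_poly_col g (torus_ev t a)).1 (tr a).
pose Q : 'M_n := \matrix_(i, a) v a i 0.
have Qu : Q \in unitmx := eigenvectors_unitmx tI v0 gv.
have orth a b : b != dual a -> bil (v a) (v b) = 0.
  move=> ba; have /eqP := bil_isom (v a) (v b) gi.
  rewrite !gv !bilE mulrA -subr_eq0 -{2}[bil _ _]mul1r -mulrBl mulf_eq0.
  case/orP => [|/eqP//]; rewrite subr_eq0 => /eqP e; case/eqP: ba; apply: tI.
  rewrite torus_ev_dual -[RHS]mulr1 -e mulKf //.
  exact: torus_ev_neq0.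
have nondeg a : bil (v a) (v (dual a)) != 0.
  apply: contraTneq (v0 a) => e; rewrite negbK.
  have vQ : (v a)^T *m form_mx K r *m Q = 0.
    apply/matrixP => i b; rewrite ord1 [RHS]mxE.
    have -> : ((v a)^T *m form_mx K r *m Q) 0 b = bil (v a) (v b).
      by rewrite /bil !mxE; apply: eq_bigr => k _; congr (_ * _); rewrite mxE.
    by have [->|/orth->] := eqVneq b (dual a).
  have := congr1 (mulmx^~ (invmx Q *m form_inv K r)) vQ.
  rewrite /= !mulmxA mulmxK // -(mulmxA (v a)^T) form_mxK mulmx1 !mul0mx => e'.
  by rewrite -trmx_eq0 e'.
(* In each pair x_k, y_k it is enough to rescale the second vector; the z vector needs a square root
   to get norm 2. *)
pose c (a : 'I_n) := if a == z_idx r then sqrtC (2 / bil (v a) (v a)) else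
  if odd a then (bil (v a) (v (dual a)))^-1 else 1.
pose P0 : 'M_n := \matrix_(i, a) (c a * v a i 0).
have P0e a : P0 *m evec K a = c a *: v a.
  by apply/matrixP => i j; rewrite /evec -colE !mxE ord1.
have P0i : isom P0.
  apply: isom_gramP => a b; rewrite !P0e !bilE.
  have [->|/orth->] := eqVneq b (dual a); last by rewrite !mulr0.
  rewrite mulr1n /c /form_wt; case: (idxP a) => [k|k|]; rewrite !dualE !eq_idxE.
  - rewrite x_idxE y_idxE /= odd_double /= mul1r (bilC (v (x_idx k))) mulVf //.
    by have := nondeg (y_idx k); rewrite dual_y.
  - rewrite x_idxE y_idxE /= odd_double /= mul1r mulVf //.
    by have := nondeg (y_idx k); rewrite dual_y.
  by have := nondeg (z_idx r); rewrite dual_z => nz; rewrite mulrA -expr2 sqrtCK divfK.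
exists (\det P0 *: P0); first exact: isom_SO.
rewrite -scalemxAr -scalemxAl; congr (_ *: _).
apply/matrixP => i a; rewrite torus_diag mul_mx_diag [RHS]mxE [LHS]mxE.
rewrite [P0 i a]mxE [(\row__ _) 0 a]mxE.
have : (g *m v a) i 0 = (torus_ev t a *: v a) i 0 by rewrite gv.
rewrite [LHS]mxE [RHS]mxE mulrAC -mulrA => <-; rewrite mulr_sumr.
by apply: eq_bigr => k _; rewrite mxE; ring.
Qed.

End Diagonalization.

(** * Polynomial curves in the group *)

Section GenericRegularity.
Variables (K : numClosedFieldType) (r : nat).
Hypothesis r0 : (0 < r)%N.
Local Notation n := (r.*2.+1).
Implicit Types (g h P : 'M[K]_n) (t : 'I_r -> K) (c : K -> 'M[K]_n).

Definition curve c := forall i j, polyfun (fun s => c s i j).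

Lemma curve_mul (c c' : K -> 'M[K]_n) : curve c -> curve c' -> curve (fun s => c s *m c' s).
Proof. exact: polyfun_mulmx. Qed.

Lemma curve_adj c : curve c -> curve (fun s => adj (c s)).
Proof.
move=> cP; apply: polyfun_mulmx; last by move=> i j; apply: polyfun_cst.
apply: polyfun_mulmx => i j; first exact: polyfun_cst.
by apply: polyfun_eq (cP j i) => s; rewrite mxE.
Qed.

Lemma curve_eich u v : curve (fun s => eich u (s *: v)).
Proof.
move=> i j; exists (((1%:M : 'M[K]_n) i j)%:P + ((dyad u v - dyad v u) i j) *: 'X
  - (quad_form v * dyad u u i j) *: 'X^2) => s.
rewrite /eich !dyadLE !quad_formE !bilE !mxE.
by rewrite !(hornerD, hornerN, hornerZ, hornerXn, hornerX, hornerC); ring.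
Qed.

(** The path is the product of the groups s -> [eich u (s *: v)] over a factorization of g. Along
    such curves, polynomial identities on SO become identities in one variable. *)
Lemma SO_curve g : in_SO g ->
  exists c, [/\ curve c, forall s, in_SO (c s), c 0 = 1%:M & c 1 = g].
Proof.
apply: (SO_eich_ind r0 (P := fun g => exists c, [/\ curve c, forall s, in_SO (c s), c 0 = 1%:M & c 1 = g])).
  by exists (fun=> 1%:M); split=> // [i j|s]; [apply: polyfun_cst | apply: SO1].
move=> u v h uu uv [c [cP cS c0 c1]].
exists (fun s => eich u (s *: v) *m c s); split=> [|s||].
- by apply: curve_mul => //; apply: curve_eich.
- by apply: SOM => //; apply: eich_SO; rewrite // bilZr uv mulr0.
- by rewrite scale0r eich0 c0 mul1mx.
- by rewrite scale1r c1.
Qed.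

(** Evaluation commutes with the resultant if the leading coefficients survive it; for the
    derivative of the characteristic polynomial this is the constant 2r + 1. *)
Lemma size_deriv_monic (R : idomainType) (p : {poly R}) m :
  m.+1%:R != 0 :> R -> p \is monic -> size p = m.+2 -> lead_coef p^`() = m.+1%:R.
Proof.
move=> m0 pm sp; have cm : p^`()`_m = m.+1%:R.
  by rewrite coef_deriv; move/monicP: pm; rewrite lead_coefE sp /= => ->.
suff sd : size p^`() = m.+1 by rewrite lead_coefE sd.
apply/eqP; rewrite eqn_leq -ltnS -sp lt_size_deriv; last by rewrite -size_poly_eq0 sp.
by rewrite ltnNge; apply: contra m0 => /leq_sizeP/(_ m (leqnn _)); rewrite cm => ->.
Qed.

Definition regular_at c (s : K) := exists t P,
  [/\ forall k, t k != 0, in_SO P & c s *m P = P *m torus t].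

(** Up to sign, [d] is the discriminant of the characteristic polynomial, as a polynomial in s. It
    is nonzero because c 0 has distinct eigenvalues, and where it does not vanish c s has distinct
    eigenvalues too. *)
Lemma curve_generic_regular c t : curve c -> (forall s, in_SO (c s)) ->
  regular_torus t -> c 0 = torus t ->
  exists2 d : {poly K}, d != 0 & forall s, d.[s] != 0 -> regular_at c s.
Proof.
move=> cP cS [t0 tI] c0.
have /fin_all_exists[C0 C0E] := fun i => fin_all_exists (cP i).
pose C : 'M[{poly K}]_n := \matrix_(i, j) C0 i j.
have CE s : map_mx (horner_eval s) C = c s.
  by apply/matrixP => i j; rewrite !mxE /horner_eval -C0E.
pose p := char_poly C; pose d : {poly K} := resultant p p^`().
have pE s : map_poly (horner_eval s) p = char_poly (c s).
  by rewrite /p map_char_poly CE.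
have n0 : (r.*2.+1)%:R != 0 :> {poly K}.
  by rewrite -polyC_natr polyC_eq0 pnatr_eq0.
have ld : lead_coef p^`() = (r.*2.+1)%:R.
  by apply: size_deriv_monic => //; [exact: char_poly_monic | exact: size_char_poly].
have dE s : d.[s] = resultant (char_poly (c s)) (char_poly (c s))^`().
  rewrite -[LHS]/(horner_eval s d) /d map_resultant -?deriv_map ?pE //.
    by rewrite (monicP (char_poly_monic C : p \is monic)) rmorph1 oner_neq0.
  by rewrite ld rmorph_nat pnatr_eq0.
have dsep s : (d.[s] != 0) = separable_poly (char_poly (c s)).
  rewrite dE resultant_eq0 separable_poly.unlock coprimep_def -leqNgt eqn_leq.
  rewrite [(0 < _)%N]lt0n size_poly_eq0 gcdp_eq0 negb_and.
  by rewrite monic_neq0 ?char_poly_monic // andbT.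
exists d.
  apply/eqP => d0; have := dsep 0; rewrite d0 hornerC eqxx c0.
  rewrite char_poly_trig; last by apply/is_trig_mxP => i j ij; rewrite torusE -val_eqE /= (ltn_eqF ij).
  rewrite -(big_enum _ _ _ (fun i => 'X - (torus_ev t i)%:P)) /=.
  rewrite -(big_map (torus_ev t) xpredT (fun a => 'X - a%:P)) separable_prod_XsubC.
  by rewrite map_inj_uniq // enum_uniq.
move=> s; rewrite dsep.
have [L LE] := closed_field_poly_normal (char_poly (c s)).
rewrite (monicP (char_poly_monic _)) scale1r in LE.
rewrite LE separable_prod_XsubC => uL.
have [t' t'r t'L] := regular_torus_of_roots (cS s) uL LE.
have [|P PS Pc] := SO_diagonalize (cS s) t'r _.
  by move=> a; rewrite LE root_prod_XsubC.
by exists t', P; split=> //; case: t'r.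
Qed.

Lemma regular_torus_exists : exists t : 'I_r -> K, regular_torus t.
Proof.
exists (fun k => 2 ^+ k.+1); split=> [k|]; first by rewrite expf_neq0 // pnatr_eq0.
have gt1 (k : nat) : 1 < 2 ^+ k.+1 :> K by rewrite exprn_egt1 // ltr1n.
have lt1 (k : nat) : (2 ^+ k.+1)^-1 < 1 :> K by rewrite invf_lt1 ?gt1 // exprn_gt0 ?ltr0n.
have I (k l : 'I_r) : 2 ^+ k.+1 = 2 ^+ l.+1 :> K -> k = l.
  move/eqP; rewrite -!natrX eqr_nat eqn_exp2l // eqSS => /eqP; exact: val_inj.
move=> a b; case: (idxP a) => [k|k|]; case: (idxP b) => [l|l|]; rewrite !torus_evE //.
- by move/I->.
- by move=> e; have := lt_trans (lt1 l) (gt1 k); rewrite e ltxx.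
- by move=> e; have := gt1 k; rewrite e ltxx.
- by move=> e; have := lt_trans (lt1 k) (gt1 l); rewrite e ltxx.
- by move/invr_inj/I->.
- by move=> e; have := lt1 k; rewrite e ltxx.
- by move=> e; have := gt1 l; rewrite -e ltxx.
- by move=> e; have := lt1 l; rewrite -e ltxx.
Qed.

(* Conjugates of torus elements are Zariski dense. *)
Lemma SO_conj_torus_dense (F : 'M[K]_n -> K) :
  (forall c, curve c -> (forall s, in_SO (c s)) -> polyfun (fun s => F (c s))) ->
  (forall t P, (forall k, t k != 0) -> in_SO P -> F (P *m torus t *m adj P) = 0) ->
  forall g, in_SO g -> F g = 0.
Proof.
move=> FP F0 g gS; have [t tr] := regular_torus_exists.
have [c1 [c1P c1S c10 c11]] := SO_curve gS.
have [c2 [c2P c2S c20 c21]] := SO_curve (torus_SO tr.1).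
(* A path in SO from a regular torus element, at s = 0, to g, at s = 1. *)
pose c s := c1 s *m c2 (1 - s).
have cP : curve c.
  apply: curve_mul => // i j; have [p pE] := c2P i j.
  exists (p \Po (1 - 'X)) => s; rewrite pE horner_comp.
  by rewrite hornerD hornerN hornerX hornerC.
have cS s : in_SO (c s) by apply: SOM.
have [|d d0 dP] := @curve_generic_regular c t cP cS tr.
  by rewrite /c subr0 c10 c21 mul1mx.
have [p pE] := FP c cP cS.
have p0 : p = 0.
  apply: (poly_eq0_of_generic_vanishing d0) => s /dP[t' [P [t'0 PS Pc]]].
  rewrite -pE; have -> : c s = P *m torus t' *m adj P.
    by rewrite -Pc -mulmxA SO_mul_adj // mulmx1.
  exact: F0.
have <- : c 1 = g by rewrite /c subrr c20 c11 mulmx1.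
by rewrite pE p0 hornerC.
Qed.

End GenericRegularity.

(** * Weights *)

Section TorusCharacters.
Variables (K : numFieldType) (r : nat).
Local Notation wt_t := 'rV[int]_r.
Implicit Types (nu mu : wt_t) (z w : 'I_r -> K).

Lemma exp2z_inj : injective (exprz (2 : K)).
Proof.
have e1 (p : nat) : 2 ^+ p = 1 :> K -> p = 0%N.
  move/eqP; rewrite -natrX -[1]/(1%:R) eqr_nat -(expn0 2) eqn_exp2l //.
  by move/eqP.
move=> m k e; have : 2 ^ (m - k) = 1 :> K.
  by rewrite expfzDr ?pnatr_eq0 // e -expfzDr ?pnatr_eq0 // subrr.
move=> {}e; apply/eqP; rewrite -subr_eq0; apply/eqP; case: (m - k) e => p.
  by move/e1->.
by rewrite NegzE => /(congr1 GRing.inv); rewrite invr1 invrK => /e1.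
Qed.

Definition nonzero z := forall k, z k != 0.

Definition zpow nu z : K := \prod_j z j ^ nu 0 j.

Lemma zpow_neq0 nu z : nonzero z -> zpow nu z != 0.
Proof. by move=> z0; apply/prodf_neq0 => j _; apply: expfz_neq0. Qed.

Lemma zpowD nu mu z : nonzero z -> zpow (nu + mu) z = zpow nu z * zpow mu z.
Proof. by move=> z0; rewrite /zpow -big_split; apply: eq_bigr => j _; rewrite mxE expfzDr. Qed.

Lemma zpowM nu z w : zpow nu (fun k => z k * w k) = zpow nu z * zpow nu w.
Proof. by rewrite /zpow -big_split; apply: eq_bigr => j _; rewrite expfzMl. Qed.

Lemma zpowV nu z : zpow nu (fun k => (z k)^-1) = (zpow nu z)^-1.
Proof. by rewrite /zpow -prodfV; apply: eq_bigr => j _; rewrite expfV. Qed.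

Lemma zpow0 z : zpow 0 z = 1.
Proof. by rewrite /zpow big1 // => j _; rewrite mxE expr0z. Qed.

Lemma zpow1 nu : zpow nu (fun=> 1) = 1.
Proof. by rewrite /zpow big1 // => j _; rewrite exp1rz. Qed.

Lemma zpow_delta nu (c : K) j : zpow nu (fun k => if k == j then c else 1) = c ^ nu 0 j.
Proof.
rewrite /zpow (bigD1 j) //= eqxx big1 ?mulr1 // => k kj.
by rewrite (negPf kj) exp1rz.
Qed.

Lemma zpow_sep nu mu : nu != mu -> exists2 z, nonzero z & zpow nu z != zpow mu z.
Proof.
move=> ne; have [j jne|e] := pickP (fun j => nu 0 j != mu 0 j); last first.
  by case/eqP: ne; apply/rowP => j; have /negbFE/eqP := e j.
exists (fun k => if k == j then 2 else 1) => [k|].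
  by case: ifP; rewrite ?oner_neq0 ?pnatr_eq0.
by rewrite !zpow_delta (inj_eq exp2z_inj).
Qed.

(** Dedekind's argument: subtracting [zpow mu w] times the relation from its translate by w
    eliminates mu, and w is chosen to separate mu from the weight under consideration. *)
Lemma zpow_indep (s : seq wt_t) (c : wt_t -> K) : uniq s ->
  (forall z, nonzero z -> \sum_(nu <- s) c nu * zpow nu z = 0) ->
  forall nu, nu \in s -> c nu = 0.
Proof.
elim: s c => // mu s IH c /= /andP[mus us] c0.
have cs nu : nu \in s -> c nu = 0.
  move=> nus; have numu : nu != mu by apply: contraNneq mus => <-.
  have [w w0 ws] := zpow_sep numu.
  have /eqP : c nu * (zpow nu w - zpow mu w) = 0.
    apply: (IH (fun nu => c nu * (zpow nu w - zpow mu w))) => // z z0.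
    have wz : nonzero (fun k => w k * z k) by move=> k; apply: mulf_neq0.
    have := c0 _ wz; have := c0 _ z0; rewrite !big_cons zpowM => e1 e2.
    transitivity (c mu * (zpow mu w * zpow mu z)
        + \sum_(j <- s) c j * zpow j (fun k => w k * z k)
      - zpow mu w * (c mu * zpow mu z + \sum_(j <- s) c j * zpow j z)); last first.
      by rewrite e1 e2 mulr0 subrr.
    rewrite mulrDr opprD addrACA [c mu * _]mulrCA subrr add0r mulr_sumr -sumrB.
    by apply: eq_bigr => nu' _; rewrite zpowM; ring.
  by rewrite mulf_eq0 subr_eq0 (negPf ws) orbF => /eqP.
move=> nu; rewrite inE => /predU1P[->|]; last exact: cs.
have := c0 (fun=> 1) (fun=> oner_neq0 _).
rewrite big_cons zpow1 mulr1 big_seq big1 ?addr0 // => nu' /cs->.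
by rewrite mul0r.
Qed.

Definition laurent (f : ('I_r -> K) -> K) := exists s : seq (K * wt_t),
  forall z, nonzero z -> f z = \sum_(p <- s) p.1 * zpow p.2 z.

Lemma laurent_eq f g : (forall z, nonzero z -> f z = g z) -> laurent f -> laurent g.
Proof. by move=> fg [s sE]; exists s => z z0; rewrite -fg // sE. Qed.

Lemma laurent_zpow c nu : laurent (fun z => c * zpow nu z).
Proof. by exists [:: (c, nu)] => z z0; rewrite big_seq1. Qed.

Lemma laurent_cst c : laurent (fun=> c).
Proof. by apply: laurent_eq (laurent_zpow c 0) => z z0; rewrite zpow0 mulr1. Qed.

Lemma laurent_add f g : laurent f -> laurent g -> laurent (fun z => f z + g z).
Proof. by move=> [s sE] [t tE]; exists (s ++ t) => z z0; rewrite big_cat sE // tE. Qed.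

Lemma laurent_mul f g : laurent f -> laurent g -> laurent (fun z => f z * g z).
Proof.
move=> [s sE] [t tE]; exists [seq (p.1 * q.1, p.2 + q.2) | p <- s, q <- t] => z z0.
rewrite big_allpairs_dep sE // tE // mulr_suml; apply: eq_bigr => p _.
by rewrite mulr_sumr; apply: eq_bigr => q _; rewrite /= zpowD //; ring.
Qed.

Lemma laurent_meval n (p : {mpoly K[n]}) (x : ('I_r -> K) -> 'I_n -> K) :
  (forall k, laurent (fun z => x z k)) -> laurent (fun z => p.@[x z]).
Proof.
move=> xP; elim/mpoly_ring_ind: p => [c|i|p q Pp Pq|p q Pp Pq].
- by apply: (laurent_eq _ (laurent_cst c)) => z _; rewrite mevalC.
- by apply: laurent_eq (xP i) => z _; rewrite mevalXU.
- by apply: laurent_eq (laurent_add Pp Pq) => z _; rewrite mevalD.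
- by apply: laurent_eq (laurent_mul Pp Pq) => z _; rewrite mevalM.
Qed.

Definition idx_wt (a : 'I_(r.*2.+1)) : wt_t :=
  \row_k ((a == x_idx k)%:Z - (a == y_idx k)%:Z).

Lemma idx_wt_x k : idx_wt (x_idx k) = basis_wt k.
Proof. by apply/rowP => j; rewrite !mxE !eq_idxE subr0 eq_sym; case: eqP. Qed.

Lemma idx_wt_y k : idx_wt (y_idx k) = - basis_wt k.
Proof. by apply/rowP => j; rewrite !mxE !eq_idxE sub0r eq_sym; case: eqP. Qed.

Lemma idx_wt_z : idx_wt (z_idx r) = 0.
Proof. by apply/rowP => j; rewrite !mxE !eq_idxE subr0. Qed.

Definition idx_wtE := (idx_wt_x, idx_wt_y, idx_wt_z).

Lemma idx_wt_dual a : idx_wt (dual a) = - idx_wt a.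
Proof. by case: (idxP a) => [k|k|]; rewrite !dualE !idx_wtE ?opprK ?oppr0. Qed.

Lemma zpow_basis k z : zpow (basis_wt k) z = z k.
Proof.
rewrite /zpow (bigD1 k) //= mxE !eqxx expr1z big1 ?mulr1 // => j jk.
by rewrite mxE (negPf jk) andbF expr0z.
Qed.

Lemma zpowN nu z : zpow (- nu) z = (zpow nu z)^-1.
Proof.
by rewrite -zpowV; apply: eq_bigr => j _; rewrite mxE -expfV invr_expz.
Qed.

Lemma torus_ev_zpow z a : torus_ev z a = zpow (idx_wt a) z.
Proof.
by case: (idxP a) => [k|k|]; rewrite torus_evE idx_wtE ?zpowN ?zpow_basis ?zpow0.
Qed.

Lemma laurent_torus a b : laurent (fun z => torus z a b).
Proof.
apply: (laurent_eq _ (laurent_zpow (a == b)%:R (idx_wt a))) => z z0.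
by rewrite torusE torus_ev_zpow mulr_natl.
Qed.

End TorusCharacters.

Section WeightDecomposition.
Variables (K : numClosedFieldType) (r : nat) (V : so_rep K r).
Local Notation n := (r.*2.+1).
Local Notation d := (so_dim V).
Local Notation wt_t := 'rV[int]_r.
Implicit Types (nu mu : wt_t) (z w : 'I_r -> K).

Lemma so_rep_polynomials : exists P : 'I_d -> 'I_d -> {mpoly K[n * n]},
  forall i j g, in_SO g -> V g i j = (P i j).@[fun k => mxvec g 0 k].
Proof.
have /fin_all_exists[P PE] := fun i => fin_all_exists (fun j => @so_map_regular K r V i j).
by exists P.
Qed.

(** The coefficients of the Laurent polynomial [V (torus z)], which turn out to be the projections
    onto the weight spaces. The list [wts] may contain nu with [p nu = 0]; such nu are not
    weights. *)
Definition weight_projections (wts : seq wt_t) (p : wt_t -> 'M[K]_d) :=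
  [/\ uniq wts, forall nu, nu \notin wts -> p nu = 0 &
      forall z, nonzero z -> V (torus z) = \sum_(nu <- wts) zpow nu z *: p nu].

Lemma weight_projections_exist : exists wts p, weight_projections wts p.
Proof.
have [P PE] := so_rep_polynomials.
have L i j : laurent (fun z => V (torus z) i j).
  apply: (@laurent_eq _ _ (fun z => (P i j).@[fun k => mxvec (torus z) 0 k])).
    by move=> z z0; rewrite PE //; apply: torus_SO.
  by apply: laurent_meval => k; case/mxvec_indexP: k => a b;
    apply: laurent_eq (laurent_torus K a b) => z _; rewrite mxvecE.
have /fin_all_exists[S SE] := fun i => fin_all_exists (L i).
pose wts := undup (flatten [seq [seq q.2 | q <- S ij.1 ij.2] | ij : 'I_d * 'I_d]).
exists wts, (fun nu => \matrix_(i, j) \sum_(q <- S i j | q.2 == nu) q.1).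
have mem i j q : q \in S i j -> q.2 \in wts.
  move=> qS; rewrite mem_undup; apply/flattenP; exists [seq q.2 | q <- S i j].
    by apply/mapP; exists (i, j); rewrite ?mem_enum.
  exact: map_f.
split=> [|nu nuw|z z0]; first exact: undup_uniq.
  apply/matrixP => i j; rewrite !mxE big_seq_cond big_pred0 // => q.
  by apply/negP => /andP[/mem qw /eqP qnu]; rewrite qnu (negPf nuw) in qw.
apply/matrixP => i j; rewrite SE // summxE.
transitivity (\sum_(nu <- wts) \sum_(q <- S i j | q.2 == nu) q.1 * zpow q.2 z).
  rewrite (exchange_big_dep xpredT) //= big_seq [RHS]big_seq; apply: eq_bigr => q qS.
  rewrite (eq_bigl (pred1 q.2)) => [|nu]; last by rewrite /= eq_sym.
  by rewrite -big_filter filter_pred1_uniq ?big_seq1 ?undup_uniq ?(mem i j).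
apply: eq_bigr => nu _; rewrite !mxE mulr_sumr; apply: eq_bigr => q /eqP->.
by rewrite mulrC.
Qed.

End WeightDecomposition.

Section Weights.
Variables (K : numClosedFieldType) (r : nat) (V : so_rep K r).
Local Notation n := (r.*2.+1).
Local Notation d := (so_dim V).
Local Notation wt_t := 'rV[int]_r.
Variables (wts : seq wt_t) (p : wt_t -> 'M[K]_d).
Hypothesis wp : weight_projections wts p.
Implicit Types (nu mu : wt_t) (z w : 'I_r -> K) (A : 'M[K]_d).

Let wts_uniq : uniq wts. Proof. by case: wp. Qed.
Let p_out nu : nu \notin wts -> p nu = 0. Proof. by case: wp => _ h _; apply: h. Qed.
Let V_torus z : nonzero z -> V (torus z) = \sum_(nu <- wts) zpow nu z *: p nu.
Proof. by case: wp => _ _; apply. Qed.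

Lemma sum_weights_single (T : zmodType) (F : wt_t -> T) nu :
  (forall mu, mu != nu -> F mu = 0) -> (nu \notin wts -> F nu = 0) ->
  \sum_(mu <- wts) F mu = F nu.
Proof.
move=> F0 Fnu; have [nuw|nuw] := boolP (nu \in wts).
  by rewrite (bigD1_seq nu) //= big1 ?addr0.
rewrite Fnu // big_seq big1 // => mu muw; apply: F0.
by apply: contraNneq nuw => <-.
Qed.

Lemma weight_indep (c : wt_t -> 'M[K]_d) :
  (forall z, nonzero z -> \sum_(nu <- wts) zpow nu z *: c nu = 0) ->
  forall nu, nu \in wts -> c nu = 0.
Proof.
move=> c0 nu nuw; apply/matrixP => i j; rewrite mxE.
apply: (zpow_indep (c := fun nu => c nu i j) wts_uniq) => // z z0.
have := congr1 (fun M : 'M_d => M i j) (c0 z z0); rewrite summxE mxE => {2}<-.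
by apply: eq_bigr => mu _; rewrite mxE mulrC.
Qed.

Lemma weight_indep2 (c c' : wt_t -> 'M[K]_d) :
  (forall z, nonzero z ->
     \sum_(nu <- wts) zpow nu z *: c nu = \sum_(nu <- wts) zpow nu z *: c' nu) ->
  forall nu, nu \in wts -> c nu = c' nu.
Proof.
move=> cc nu nuw; apply/eqP; rewrite -subr_eq0; apply/eqP.
apply: (weight_indep (c := fun nu => c nu - c' nu)) => // z z0.
by under eq_bigr do rewrite scalerBr; rewrite sumrB cc // subrr.
Qed.

Lemma rep_torusM z w : nonzero z -> nonzero w ->
  V (torus (fun k => z k * w k)) = V (torus z) *m V (torus w).
Proof. by move=> z0 w0; rewrite -torusM so_mapM //; apply: torus_SO. Qed.

(** Both sides are the coefficient of [zpow nu z] in the multiplicativity of V at the torus elements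
    z and w. *)
Lemma proj_torus nu w : nonzero w -> p nu *m V (torus w) = zpow nu w *: p nu.
Proof.
move=> w0; have [nuw|/p_out->] := boolP (nu \in wts); last by rewrite mul0mx scaler0.
apply: (weight_indep2 (c := fun nu => p nu *m V (torus w))
  (c' := fun nu => zpow nu w *: p nu)) => // z z0.
have zw : nonzero (fun k => z k * w k) by move=> k; apply: mulf_neq0.
have := rep_torusM z0 w0; rewrite (V_torus zw) (V_torus z0) mulmx_suml => e.
under eq_bigr do rewrite scalemxAl.
by rewrite -e; apply: eq_bigr => mu _; rewrite zpowM scalerA.
Qed.

Lemma proj_mul nu mu : p nu *m p mu = if nu == mu then p nu else 0.
Proof.
have [muw|/p_out e] := boolP (mu \in wts); last first.
  by rewrite e mulmx0; case: eqP => // ->; rewrite e.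
have := weight_indep2 (c := fun mu => p nu *m p mu)
  (c' := fun mu => if nu == mu then p nu else 0).
apply=> // z z0; have := proj_torus nu z0; rewrite (V_torus z0) mulmx_sumr.
under eq_bigr do rewrite -scalemxAr.
move=> ->; have [nuw|nuw] := boolP (nu \in wts).
  rewrite (bigD1_seq nu) //= eqxx big1 ?addr0 // => kappa.
  by rewrite eq_sym => /negPf->; rewrite scaler0.
rewrite p_out // scaler0 big1_seq // => kappa /= _.
by case: ifP; rewrite scaler0.
Qed.

Lemma proj_sum : \sum_(nu <- wts) p nu = 1%:M.
Proof.
rewrite -(so_map1 V) -torus1 V_torus; last by move=> k; apply: oner_neq0.
by apply: eq_bigr => nu _; rewrite zpow1 scale1r.
Qed.

Lemma torus_proj nu w : nonzero w -> V (torus w) *m p nu = zpow nu w *: p nu.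
Proof.
move=> w0; rewrite V_torus // mulmx_suml.
under eq_bigr do rewrite -scalemxAl proj_mul.
rewrite (sum_weights_single (nu := nu)) ?eqxx // => [mu /negPf->|/p_out->];
  by rewrite scaler0.
Qed.

Lemma proj_shift A alpha nu :
  (forall z, nonzero z -> V (torus z) *m A = zpow alpha z *: (A *m V (torus z))) ->
  p (nu + alpha) *m A = A *m p nu.
Proof.
move=> VA; have orth mu kappa : mu != kappa + alpha -> p mu *m A *m p kappa = 0.
  move=> ne; have [z z0 zne] := zpow_sep K ne.
  have e1 : p mu *m V (torus z) *m A *m p kappa = zpow mu z *: (p mu *m A *m p kappa).
    by rewrite proj_torus // -!scalemxAl.
  have e2 : p mu *m V (torus z) *m A *m p kappa =
      zpow (kappa + alpha) z *: (p mu *m A *m p kappa).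
    rewrite -(mulmxA (p mu)) VA // -scalemxAr -scalemxAl -!mulmxA torus_proj //.
    by rewrite -!scalemxAr scalerA mulrC -zpowD.
  move/eqP: e1; rewrite e2 -subr_eq0 -scalerBl scaler_eq0 subr_eq0.
  by rewrite eq_sym (negPf zne) => /eqP.
transitivity (p (nu + alpha) *m A *m p nu).
  rewrite -[LHS]mulmx1 -proj_sum mulmx_sumr.
  apply: sum_weights_single => [mu ne|/p_out->]; last by rewrite mulmx0.
  by apply: orth; rewrite (inj_eq (addIr _)) eq_sym.
rewrite -[RHS]mul1mx -proj_sum mulmx_suml -mulmxA; symmetry.
apply: (sum_weights_single (F := fun mu => p mu *m (A *m p nu))) => [mu ne|/p_out->].
  by rewrite mulmxA orth.
by rewrite mul0mx.
Qed.

Lemma weight_vector nu (v : 'cV[K]_d) :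
  (forall z, nonzero z -> V (torus z) *m v = zpow nu z *: v) -> p nu *m v = v.
Proof.
move=> Vv; rewrite -[RHS]mul1mx -proj_sum mulmx_suml; symmetry.
apply: (sum_weights_single (F := fun mu => p mu *m v)) => [mu ne|/p_out->]; last first.
  by rewrite mul0mx.
have [z z0 zne] := zpow_sep K ne.
have : p mu *m V (torus z) *m v = zpow nu z *: (p mu *m v).
  by rewrite -mulmxA Vv // scalemxAr.
rewrite proj_torus // -scalemxAl => /eqP; rewrite -subr_eq0 -scalerBl scaler_eq0.
by rewrite subr_eq0 (negPf zne) => /eqP.
Qed.

Lemma is_weightE nu : is_weight V nu <-> p nu != 0.
Proof.
split=> [[v v0 Vv]|/matrix0Pn[i [j pij]]].
  by apply: contraNneq v0 => p0; rewrite -(weight_vector Vv) p0 mul0mx.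
exists (col j (p nu)); first by apply/matrix0Pn; exists i, 0; rewrite mxE.
by move=> t t0; rewrite -/(zpow nu t) colE mulmxA torus_proj // scalemxAl.
Qed.

Lemma trace_torus z A : nonzero z ->
  \tr (V (torus z) *m A) = \sum_(nu <- wts) zpow nu z * \tr (p nu *m A).
Proof.
move=> z0; rewrite V_torus // mulmx_suml raddf_sum; apply: eq_bigr => nu _ /=.
by rewrite -scalemxAl mxtraceZ.
Qed.

End Weights.

(** * The Lie algebra and the Casimir operator *)

Section SoElements.
Variables (K : numFieldType) (r : nat).
Local Notation n := (r.*2.+1).
Implicit Types (u v w : 'cV[K]_n) (g X Y : 'M[K]_n).

(** The bivector of u and v as an operator skew for [bil]. For u isotropic and orthogonal to v it is
    the velocity at s = 0 of [eich u (s *: v)]. *)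
Definition so_elt u v : 'M[K]_n := dyad u v - dyad v u.
Definition skew X := adj X = - X.

Lemma so_eltC u v : so_elt v u = - so_elt u v.
Proof. by rewrite /so_elt opprB. Qed.

Lemma so_eltxx u : so_elt u u = 0.
Proof. exact: subrr. Qed.

Lemma so_eltDl u v w : so_elt (u + v) w = so_elt u w + so_elt v w.
Proof. by rewrite /so_elt !dyadLE opprD addrACA. Qed.

Lemma so_eltZl c u v : so_elt (c *: u) v = c *: so_elt u v.
Proof. by rewrite /so_elt !dyadLE scalerBr. Qed.

Lemma so_eltDr u v w : so_elt w (u + v) = so_elt w u + so_elt w v.
Proof. by rewrite !(so_eltC _ w) so_eltDl opprD. Qed.

Lemma so_eltZr c u v : so_elt u (c *: v) = c *: so_elt u v.
Proof. by rewrite !(so_eltC _ u) so_eltZl scalerN. Qed.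

Lemma so_elt_skew u v : skew (so_elt u v).
Proof. by rewrite /skew /so_elt adjD adjN !adj_dyad opprB. Qed.

Lemma so_elt_conj g u v : g *m so_elt u v *m adj g = so_elt (g *m u) (g *m v).
Proof. by rewrite /so_elt mulmxBr mulmxBl !mul_dyad !dyad_adj. Qed.

Lemma so_elt_mulv u v w : so_elt u v *m w = bil v w *: u - bil u w *: v.
Proof. by rewrite mulmxBl !dyad_mulv. Qed.

Lemma so_elt_bracket X u v : skew X ->
  X *m so_elt u v - so_elt u v *m X = so_elt (X *m u) v + so_elt u (X *m v).
Proof.
move=> sX; have aX : X = adj (- X) by rewrite adjN sX opprK.
rewrite {2}aX /so_elt mulmxBr mulmxBl !mul_dyad !dyad_adj !mulNmx !dyadLE.
by apply/matrixP => i j; rewrite !mxE; ring.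
Qed.

Lemma skew_bracket X Y : skew X -> skew Y -> skew (X *m Y - Y *m X).
Proof.
move=> sX sY; rewrite /skew adjD adjN !adjM sX sY !mulNmx !mulmxN !opprK.
by rewrite opprB.
Qed.

Lemma dyad_evec_sum X : X = \sum_(ab : 'I_n * 'I_n)
  (X *m form_inv K r) ab.1 ab.2 *: dyad (evec K ab.1) (evec K ab.2).
Proof.
rewrite -{1}[X]mulmx1 -form_invK mulmxA {1}[X *m _]matrix_sum_delta pair_bigA /=.
rewrite mulmx_suml; apply: eq_bigr => ab _; rewrite -scalemxAl; congr (_ *: _).
by rewrite /dyad /evec trmx_delta mul_delta_mx.
Qed.

Lemma skew_sum X : skew X -> X = 2^-1 *: \sum_(ab : 'I_n * 'I_n)
  (X *m form_inv K r) ab.1 ab.2 *: so_elt (evec K ab.1) (evec K ab.2).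
Proof.
move=> sX; have e : X = 2^-1 *: (X - adj X).
  by rewrite sX opprK; apply/matrixP => i j; rewrite !mxE; field.
rewrite {1}e; congr (_ *: _); under eq_bigr do rewrite scalerBr.
rewrite sumrB -dyad_evec_sum; congr (_ - _).
rewrite {1}[X]dyad_evec_sum; elim/big_rec2: _ => [|ab A B _ <-].
  by rewrite /adj trmx0 mulmx0 mul0mx.
by rewrite adjD adjZ adj_dyad.
Qed.

Lemma dyad_evec_entry (a b i j : 'I_n) :
  dyad (evec K a) (evec K b) i j = (i == a)%:R * (form_wt K b *+ (j == dual b)).
Proof.
rewrite /dyad -mulmxA mxE big_ord1 /evec trmx_delta -rowE [row _ _ _ _]mxE.
by rewrite [delta_mx _ _ _ _]mxE [form_mx _ _ _ _]mxE eqxx andbT.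
Qed.

Lemma torus_evec (t : 'I_r -> K) a : torus t *m evec K a = torus_ev t a *: evec K a.
Proof.
apply/matrixP => i j; rewrite ord1 /evec -colE [LHS]mxE torusE [RHS]mxE [delta_mx _ _ _ _]mxE eqxx andbT.
by case: eqP => [->|]; rewrite ?mulr1 ?mulr0.
Qed.

End SoElements.

(** * The differential of a representation at the identity *)

Section Differential.
Variables (K : numClosedFieldType) (r : nat) (V : so_rep K r).
Local Notation n := (r.*2.+1).
Local Notation d := (so_dim V).
Variable P : 'I_d -> 'I_d -> {mpoly K[n * n]}.
Hypothesis PE : forall i j g, in_SO g -> V g i j = (P i j).@[fun k => mxvec g 0 k].
Implicit Types (u v w : 'cV[K]_n) (g X Y : 'M[K]_n) (c : K -> 'M[K]_n).

(** Derivative at 1, in the direction X, of the polynomials [P] that represent V. Since these are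
    only determined on SO, [diff X] has an intrinsic meaning only for skew X. *)
Definition diff X : 'M[K]_d := \matrix_(i, j)
  \sum_k ((P i j)^`M(k)).@[fun k => mxvec (1%:M : 'M[K]_n) 0 k] * mxvec X 0 k.

Lemma diffD X Y : diff (X + Y) = diff X + diff Y.
Proof.
apply/matrixP => i j; rewrite !mxE -big_split; apply: eq_bigr => k _.
by rewrite linearD mxE mulrDr.
Qed.

Lemma diffZ a X : diff (a *: X) = a *: diff X.
Proof.
apply/matrixP => i j; rewrite !mxE mulr_sumr; apply: eq_bigr => k _.
by rewrite linearZ mxE; ring.
Qed.

Lemma diff0 : diff 0 = 0.
Proof. by rewrite -[X in diff X](scale0r 0) diffZ scale0r. Qed.

Lemma diffN X : diff (- X) = - diff X.
Proof. by rewrite -scaleN1r diffZ scaleN1r. Qed.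

Lemma diff_sum (I : finType) (F : I -> 'M[K]_n) :
  diff (\sum_i F i) = \sum_i diff (F i).
Proof. by elim/big_rec2: _ => [|i A B _ <-]; rewrite ?diff0 ?diffD. Qed.

Definition near0_SO c := exists2 q : {poly K}, q.[0] != 0 &
  forall s, q.[s] != 0 -> in_SO (c s).

Lemma near0_SO_all c : (forall s, in_SO (c s)) -> near0_SO c.
Proof. by move=> cS; exists 1; rewrite ?hornerC ?oner_neq0. Qed.

Lemma mder_mxvec m k (c : K -> 'M[K]_(m, k)) A B : mder c A B ->
  forall l, der (fun s => mxvec (c s) 0 l) (mxvec A 0 l) (mxvec B 0 l).
Proof.
move=> cD l; case/mxvec_indexP: l => i j; rewrite !mxvecE.
by apply: der_eq (cD i j) => s; rewrite mxvecE.
Qed.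

Lemma mder_rep c X : near0_SO c -> mder c 1%:M X ->
  mder (fun s => V (c s)) 1%:M (diff X).
Proof.
move=> [q q0 cS] cD i j; rewrite [X in der _ _ X]mxE -(so_map1 V) PE; last exact: SO1.
apply: der_near q0 _ (der_meval (P i j) (mder_mxvec cD)) => s /cS cs.
by rewrite PE.
Qed.

Lemma mder_diff c A B : mder c A B -> mder (fun s => diff (c s)) (diff A) (diff B).
Proof.
move=> cD i j; rewrite !mxE.
apply: (@der_eq _ (fun s => \sum_k ((P i j)^`M(k)).@[fun k => mxvec (1%:M : 'M[K]_n) 0 k]
  * mxvec (c s) 0 k)) => [s|]; first by rewrite mxE.
apply: der_sum => k; have := der_mul (der_cst (P i j)^`M(k).@[fun k => mxvec (1%:M : 'M[K]_n) 0 k])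
  (mder_mxvec cD k).
by rewrite mul0r add0r; apply.
Qed.

Definition tangent X := exists2 c, near0_SO c & mder c 1%:M X.

Definition equivariant X := forall g, in_SO g ->
  V g *m diff X = diff (g *m X *m adj g) *m V g.

Lemma rep_adjK g : in_SO g -> V (adj g) *m V g = 1%:M.
Proof. by move=> gS; rewrite -so_mapM ?SO_adjK ?so_map1 //; apply: SO_adj. Qed.

(** Derivative at s = 0 of V (g c(s) g^-1) = V g V (c(s)) V (g^-1), with [adj g] for g^-1. *)
Lemma tangent_equivariant X : tangent X -> equivariant X.
Proof.
move=> [c [q q0 cS] cD] g gS.
have D1 : mder (fun s => g *m c s *m adj g) 1%:M (g *m X *m adj g).
  have := mder_mul (mder_mul (mder_cst g) cD) (mder_cst (adj g)).
  by rewrite !mul0mx !mulmx1 mulmx0 !addr0 add0r SO_mul_adj.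
have D2 : mder (fun s => V (g *m c s *m adj g)) 1%:M (diff (g *m X *m adj g)).
  apply: mder_rep D1; exists q => // s /cS cs.
  by apply: SOM; [apply: SOM | apply: SO_adj].
have D3 := mder_mul (mder_mul (mder_cst (V g)) (mder_rep (ex_intro2 _ _ q q0 cS) cD))
  (mder_cst (V (adj g))).
have [|_ e] := mder_uniq D2 (mder_near q0 _ D3) => [s /cS cs|].
  have gcS := SOM gS cs; have gaS := SO_adj gS; by rewrite (so_mapM V gcS gaS) (so_mapM V gS cs).
by rewrite e !mul0mx !mulmx0 !addr0 add0r -(mulmxA (V g *m diff X)) rep_adjK // mulmx1.
Qed.

Lemma equivariantD X Y : equivariant X -> equivariant Y -> equivariant (X + Y).
Proof. by move=> eX eY g gS; rewrite mulmxDr mulmxDl !diffD mulmxDr mulmxDl eX // eY. Qed.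

Lemma equivariantZ a X : equivariant X -> equivariant (a *: X).
Proof. by move=> eX g gS; rewrite -scalemxAr -scalemxAl !diffZ -scalemxAr -scalemxAl eX. Qed.

Lemma tangent0 : tangent 0.
Proof.
exists (fun=> 1%:M); last exact: mder_cst.
by apply: near0_SO_all => s; apply: SO1.
Qed.

Lemma tangent_eich u v : bil u u = 0 -> bil u v = 0 -> tangent (so_elt u v).
Proof.
move=> uu uv; exists (fun s => eich u (s *: v)).
  by apply: near0_SO_all => s; apply: eich_SO; rewrite // bilZr uv mulr0.
move=> i j; exists ((- quad_form v * dyad u u i j)%:P), 1; split=> [|s _].
  by rewrite hornerC oner_neq0.
rewrite /eich /so_elt !dyadLE !quad_formE !bilE !mxE !hornerC.
by field.
Qed.

Definition torus_line (k : 'I_r) (s : K) (j : 'I_r) : K := if j == k then 1 + s else 1.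

Lemma torus_line_SO k : near0_SO (fun s => torus (torus_line k s)).
Proof.
exists (1 + 'X) => [|s]; rewrite hornerD hornerX hornerC ?addr0 ?oner_neq0 // => s0.
by apply: torus_SO => j; rewrite /torus_line; case: ifP; rewrite ?oner_neq0.
Qed.

Lemma torus_line_der k : mder (fun s => torus (torus_line k s)) 1%:M
  (so_elt (evec K (x_idx k)) (evec K (y_idx k))).
Proof.
have D a : der (fun s => torus_ev (torus_line k s) a) 1
    ((a == x_idx k)%:R - (a == y_idx k)%:R).
  case: (idxP a) => [j|j|]; rewrite !eq_idxE ?subr0 ?sub0r.
  - apply: (@der_eq _ (fun s => torus_line k s j)) => [s|]; first by rewrite torus_ev_x.
    rewrite /torus_line; case: eqP => _; last exact: der_cst.
    by apply: der_eq (der_linear 1 1) => s; rewrite mul1r.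
  - apply: (@der_eq _ (fun s => (torus_line k s j)^-1)) => [s|]; first by rewrite torus_ev_y.
    rewrite /torus_line; case: eqP => _; first exact: der_inv1D.
    by rewrite oppr0; apply: der_eq (der_cst 1) => s; rewrite invr1.
  by apply: der_eq (der_cst 1) => s; rewrite torus_ev_z.
move=> a b; rewrite [X in der _ X _]mxE.
have -> : so_elt (evec K (x_idx k)) (evec K (y_idx k)) a b =
   ((a == x_idx k)%:R - (a == y_idx k)%:R) * (a == b)%:R.
  rewrite /so_elt [LHS]mxE [in X in _ + X]mxE !dyad_evec_entry !dualE /form_wt !eq_idxE.
  have [->|ab] := eqVneq a b.
    by case: (b == x_idx k); case: (b == y_idx k); rewrite ?mulr1n ?mulr0n; ring.
  have h l : (a == l)%:R * (b == l)%:R = 0 :> K.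
    by rewrite -natrM mulnb; case: (eqVneq a l) => //= <-; rewrite eq_sym (negPf ab).
  have h' l : (a == l)%:R * (1 *+ (b == l)) = 0 :> K by exact: h.
  by rewrite !h' mulr0 subrr.
have := der_mul (D a) (der_cst (a == b)%:R); rewrite mul1r mulr0 addr0.
by apply: der_eq => s; rewrite torusE mulr_natr.
Qed.

(** Skew operators are combinations of the [so_elt] of basis vectors. If one vector is isotropic and
    orthogonal to the other, this is, up to sign, the velocity of an Eichler group; the remaining
    pairs x_k, y_k come from lines in the torus. *)
Lemma skew_tangent_ind (Q : 'M[K]_n -> Prop) :
  (forall X Y, Q X -> Q Y -> Q (X + Y)) -> (forall a X, Q X -> Q (a *: X)) ->
  (forall X, tangent X -> Q X) -> forall X, skew X -> Q X.
Proof.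
move=> QD QZ Qt.
have iso a b : a != z_idx r -> b != dual a -> Q (so_elt (evec K a) (evec K b)).
  move=> az ba; apply: (Qt); apply: tangent_eich; rewrite bil_evec.
    by move: az; case: (idxP a) => [k|k|]; rewrite ?dualE ?eq_idxE.
  by rewrite (negPf ba).
have Qx k : Q (so_elt (evec K (x_idx k)) (evec K (y_idx k))).
  apply: (Qt); exists (fun s => torus (torus_line k s)); first exact: torus_line_SO.
  exact: torus_line_der.
have QC u v : Q (so_elt u v) -> Q (so_elt v u).
  by move=> Quv; rewrite so_eltC -scaleN1r; apply: QZ.
have Qb a b : Q (so_elt (evec K a) (evec K b)).
  have [ba|ba] := eqVneq b (dual a).
    rewrite ba; case: (idxP a) => [k|k|]; rewrite dualE //; first exact: QC.
    by rewrite so_eltxx; apply/Qt/tangent0.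
  have [az|az] := eqVneq a (z_idx r); last exact: iso.
  apply/QC/iso; first by apply: contraNneq ba => ->; rewrite az dual_z.
  by apply: contraNneq ba => ->; rewrite dualK.
move=> X /skew_sum->; apply: (QZ).
by apply: big_ind => [||ab _]; [exact/Qt/tangent0 | exact: QD | exact/QZ/Qb].
Qed.

Lemma skew_equivariant X : skew X -> equivariant X.
Proof.
by move: X; apply: skew_tangent_ind; [exact: equivariantD | exact: equivariantZ |
  exact: tangent_equivariant].
Qed.

Lemma mder_adj c A B : mder c A B -> mder (fun s => adj (c s)) (adj A) (adj B).
Proof.
move=> cD; have := mder_mul (mder_mul (mder_cst (form_inv K r)) (mder_tr cD))
  (mder_cst (form_mx K r)).
by rewrite mul0mx mulmx0 addr0 add0r.
Qed.

Lemma tangent_skew X : tangent X -> skew X.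
Proof.
move=> [c [q q0 cS] cD].
have := mder_near q0 _ (mder_mul (mder_adj cD) cD) => /(_ (fun=> 1%:M)) D1.
have [|_] := mder_uniq (D1 _) (mder_cst 1%:M) => [s /cS/SO_adjK//|].
by rewrite adj1 mul1mx mulmx1 => /eqP; rewrite addr_eq0 => /eqP.
Qed.

(** Derivative at s = 0 of the equivariance V (c(s)) diff Y = diff (c(s) Y adj (c(s))) V (c(s))
    along a curve of velocity X, where adj (c(s)) has velocity -X. Linearity reduces skew X to this
    case. *)
Lemma diff_bracket X Y : skew X -> skew Y ->
  diff X *m diff Y - diff Y *m diff X = diff (X *m Y - Y *m X).
Proof.
move=> sX sY; move: X sX; apply: skew_tangent_ind.
- move=> X X' e e'.
  have -> : (X + X') *m Y - Y *m (X + X') = (X *m Y - Y *m X) + (X' *m Y - Y *m X').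
    by rewrite mulmxDl mulmxDr opprD addrACA.
  by rewrite diffD [in RHS]diffD -e -e' mulmxDl mulmxDr opprD addrACA.
- by move=> a X e; rewrite !diffZ -!scalemxAl -!scalemxAr -!scalerBr e diffZ.
move=> X tX; have sX := tangent_skew tX; have [c [q q0 cS] cD] := tX.
have VD := mder_rep (ex_intro2 _ _ q q0 cS) cD.
have D1 := mder_mul VD (mder_cst (diff Y)).
have D2 := mder_mul (mder_diff (mder_mul (mder_mul cD (mder_cst Y)) (mder_adj cD))) VD.
have [|_] := mder_uniq (mder_near q0 _ D1) D2 => [s /cS cs|].
  exact: skew_equivariant.
rewrite adj1 !(mulmx0, mul1mx, mulmx1, addr0) sX mulmxN => ->.
by rewrite addrK.
Qed.

End Differential.

Section PositiveRoots.
Variable r : nat.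

(* [inl i] stands for e_i, [inr (i, j, true)] for e_i + e_j and
   [inr (i, j, false)] for e_i - e_j, the last two being roots for i < j. *)
Definition proot : finType := ('I_r + 'I_r * 'I_r * bool)%type.

Definition proot_valid (t : proot) : bool :=
  match t with inl _ => true | inr (i, j, _) => (i < j)%N end.

Definition proot_wt (t : proot) : 'rV[int]_r :=
  match t with
  | inl i => basis_wt i
  | inr (i, j, true) => basis_wt i + basis_wt j
  | inr (i, j, false) => basis_wt i - basis_wt j
  end.

Lemma big_proot (T : Type) (idx : T) (op : Monoid.com_law idx) (F : proot -> T) :
  \big[op/idx]_(t | proot_valid t) F t =
  op (\big[op/idx]_i F (inl i))
     (\big[op/idx]_(ij : 'I_r * 'I_r | (ij.1 < ij.2)%N)
        op (F (inr (ij.1, ij.2, true))) (F (inr (ij.1, ij.2, false)))).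
Proof.
rewrite big_sumType /=; congr (op _ _).
rewrite [RHS](eq_bigr (fun ij => \big[op/idx]_(b : bool) F (inr (ij.1, ij.2, b)))).
  rewrite pair_big_dep /=; apply: eq_big => [[[i j] b]|[[i j] b] _] //=.
  by rewrite andbT.
by move=> ij _; rewrite big_bool.
Qed.

Lemma big_triangular (T : Type) (idx : T) (op : Monoid.com_law idx) (F : 'I_r -> 'I_r -> T) :
  \big[op/idx]_i \big[op/idx]_j F i j = op (\big[op/idx]_i F i i)
    (\big[op/idx]_(ij : 'I_r * 'I_r | (ij.1 < ij.2)%N) op (F ij.1 ij.2) (F ij.2 ij.1)).
Proof.
rewrite pair_bigA /= (bigID (fun ij : 'I_r * 'I_r => ij.1 == ij.2)) /=; congr (op _ _).
  rewrite -(pair_big_dep xpredT (fun i j => i == j) F) /=.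
  by apply: eq_bigr => i _; rewrite (big_pred1 i) // => j; rewrite /= eq_sym.
rewrite big_split /= (bigID (fun ij : 'I_r * 'I_r => (ij.1 < ij.2)%N)) /=; congr (op _ _).
  by apply: eq_bigl => -[i j] /=; rewrite -val_eqE /= neq_ltn; case: ltngtP.
pose sw (ij : 'I_r * 'I_r) := (ij.2, ij.1); have swI : injective sw by case=> i j [] ? ? [-> ->].
rewrite [RHS](reindex_inj swI) /=.
by apply: eq_bigl => -[i j] /=; rewrite -val_eqE /= neq_ltn; case: ltngtP.
Qed.

(** Groups the pairs of indices by weight: x_k and y_k give weight 0, pairs with z give the roots
    e_k and -e_k, and the others give the roots with two nonzero coordinates. *)
Lemma sum_idx_sym (K : numFieldType) d (T : 'I_(r.*2.+1) -> 'I_(r.*2.+1) -> 'M[K]_d) :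
  (forall a b, T a b = T b a) -> (forall a, T a a = 0) ->
  2^-1 *: \sum_a \sum_b T a b = \sum_k T (x_idx k) (y_idx k) +
    (\sum_k (T (x_idx k) (z_idx r) + T (y_idx k) (z_idx r)) +
    \sum_(ij : 'I_r * 'I_r | (ij.1 < ij.2)%N)
      ((T (x_idx ij.1) (x_idx ij.2) + T (y_idx ij.1) (y_idx ij.2)) +
       (T (x_idx ij.1) (y_idx ij.2) + T (x_idx ij.2) (y_idx ij.1)))).
Proof.
move=> TC Txx.
have tri (f : 'I_r -> 'I_(r.*2.+1)) : \sum_k \sum_l T (f k) (f l) =
    \sum_(ij : 'I_r * 'I_r | (ij.1 < ij.2)%N) T (f ij.1) (f ij.2) +
    \sum_(ij : 'I_r * 'I_r | (ij.1 < ij.2)%N) T (f ij.1) (f ij.2).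
  rewrite big_triangular /= big1 ?add0r => [|k _]; last exact: Txx.
  by rewrite big_split; congr (_ + _); apply: eq_bigr => ij _; apply: TC.
have halves (A B C S D E : 'M[K]_d) :
    2^-1 *: ((A + A + (C + S) + D) + (C + S + (B + B) + E) + (D + E)) =
    C + ((D + E) + ((A + B) + S)).
  by apply/matrixP => i j; rewrite !mxE; field.
rewrite big_idx /=; under eq_bigr do rewrite big_idx /=.
under [X in _ *: (_ + X + _)]eq_bigr do rewrite big_idx /=.
rewrite big_idx /= !big_split /= Txx addr0 !tri.
have -> : \sum_k \sum_l T (y_idx k) (x_idx l) = \sum_k \sum_l T (x_idx k) (y_idx l).
  by rewrite exchange_big; apply: eq_bigr => k _; apply: eq_bigr => l _; apply: TC.
have -> : \sum_k T (z_idx r) (x_idx k) = \sum_k T (x_idx k) (z_idx r).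
  by apply: eq_bigr => k _; apply: TC.
have -> : \sum_k T (z_idx r) (y_idx k) = \sum_k T (y_idx k) (z_idx r).
  by apply: eq_bigr => k _; apply: TC.
rewrite [\sum_k \sum_l T (x_idx k) (y_idx l)]big_triangular /= halves.
by rewrite big_split.
Qed.

End PositiveRoots.

(** * Cartan elements, root vectors and the Casimir operator *)

Section Casimir.
Variables (K : numClosedFieldType) (r : nat) (V : so_rep K r).
Local Notation n := (r.*2.+1).
Local Notation d := (so_dim V).
Local Notation wt_t := 'rV[int]_r.
Variable P : 'I_d -> 'I_d -> {mpoly K[n * n]}.
Hypothesis PE : forall i j g, in_SO g -> V g i j = (P i j).@[fun k => mxvec g 0 k].
Variables (wts : seq wt_t) (p : wt_t -> 'M[K]_d).
Hypothesis wp : weight_projections wts p.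

Implicit Types (u v w : 'cV[K]_n) (g X Y : 'M[K]_n) (A B : 'M[K]_n).

Definition omega a b : 'M[K]_d := diff P (so_elt (evec K a) (evec K b)).

Lemma omegaC a b : omega b a = - omega a b.
Proof. by rewrite /omega so_eltC diffN. Qed.

Lemma omegaxx a : omega a a = 0.
Proof. by rewrite /omega so_eltxx diff0. Qed.

Lemma omega_torus a b z : nonzero z ->
  V (torus z) *m omega a b = zpow (idx_wt a + idx_wt b) z *: (omega a b *m V (torus z)).
Proof.
move=> z0; rewrite (skew_equivariant PE (so_elt_skew _ _)); last exact: torus_SO.
rewrite so_elt_conj !torus_evec so_eltZl so_eltZr !diffZ scalerA.
by rewrite -scalemxAl zpowD // -!torus_ev_zpow mulrC.
Qed.

Lemma proj_omega a b nu : p (nu + (idx_wt a + idx_wt b)) *m omega a b = omega a b *m p nu.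
Proof. by apply: (proj_shift wp) => z; apply: omega_torus. Qed.

Lemma der_exprz (m : int) : der (fun s : K => (1 + s) ^ m) 1 m%:~R.
Proof.
case: m => m; last rewrite NegzE.
  elim: m => [|m IH]; first by apply: der_eq (der_cst 1) => s; rewrite expr0z.
  have := der_mul (der_linear 1 1) IH; rewrite !mul1r => D.
  have -> : (m.+1%:Z)%:~R = 1 + (m%:Z)%:~R :> K by rewrite -addn1 PoszD intrD addrC.
  by apply: der_eq D => s; rewrite mul1r -exprSz.
elim: m => [|m IH].
  by apply: der_eq (der_inv1D K) => s; rewrite -invr_expz expr1z.
have := der_mul (der_inv1D K) IH; rewrite !mul1r mulr1 => D.
have -> : (- m.+2%:Z)%:~R = -1 + (- m.+1%:Z)%:~R :> K.
  by rewrite -addn1 PoszD opprD intrD addrC.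
by apply: der_eq D => s; rewrite -!invr_expz [(_ ^ m.+2)]exprSz invfM.
Qed.

Definition cartan k := omega (x_idx k) (y_idx k).

(** Derivative at s = 0 of the weight decomposition along [torus_line k], where the character nu
    takes the value (1 + s)^(nu_k). *)
Lemma cartanE k : cartan k = \sum_(nu <- wts) (nu 0 k)%:~R *: p nu.
Proof.
have D1 := mder_rep PE (torus_line_SO K k) (torus_line_der K k).
have D2 : mder (fun s => \sum_(nu <- wts) (1 + s) ^ nu 0 k *: p nu)
    (\sum_(nu <- wts) 1 *: p nu) (\sum_(nu <- wts) (nu 0 k)%:~R *: p nu).
  move=> i j; rewrite !summxE.
  apply: (@der_eq _ (fun s => \sum_(nu <- wts) (1 + s) ^ nu 0 k * p nu i j)) => [s|].
    by rewrite summxE; apply: eq_bigr => nu _; rewrite mxE.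
  apply: der_sum => nu; rewrite !mxE.
  by have := der_mul (der_exprz (nu 0 k)) (der_cst (p nu i j)); rewrite mulr0 addr0.
have q0 : (1 + 'X).[0] != 0 :> K by rewrite hornerD hornerX hornerC addr0 oner_neq0.
apply: (mder_uniq (mder_near q0 _ D1) D2).2 => s; rewrite hornerD hornerX hornerC => s0.
have [_ _ ->] := wp; last by move=> j; rewrite /torus_line; case: ifP; rewrite ?oner_neq0.
by apply: eq_bigr => nu _; rewrite zpow_delta.
Qed.

Lemma cartan_proj k nu : cartan k *m p nu = (nu 0 k)%:~R *: p nu.
Proof.
rewrite cartanE mulmx_suml; have [_ pout _] := wp.
rewrite (sum_weights_single wp (nu := nu)) => [|mu ne|/pout->].
- by rewrite -scalemxAl (proj_mul wp) eqxx.
- by rewrite -scalemxAl (proj_mul wp) (negPf ne) scaler0.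
by rewrite mulmx0.
Qed.

Definition root_e (t : proot r) : 'M[K]_d :=
  match t with
  | inl i => omega (x_idx i) (z_idx r)
  | inr (i, j, true) => omega (x_idx i) (x_idx j)
  | inr (i, j, false) => omega (x_idx i) (y_idx j)
  end.

(** Opposite root vectors, normalized so that [e, f] is the Cartan element with the coordinates of
    the root. The factor 1/2 compensates for z having norm 2 under [bil]. *)
Definition root_f (t : proot r) : 'M[K]_d :=
  match t with
  | inl i => 2^-1 *: omega (z_idx r) (y_idx i)
  | inr (i, j, true) => omega (y_idx j) (y_idx i)
  | inr (i, j, false) => omega (x_idx j) (y_idx i)
  end.

Lemma root_e_torus t z : nonzero z ->
  V (torus z) *m root_e t = zpow (proot_wt t) z *: (root_e t *m V (torus z)).
Proof.
by move=> z0; case: t => [i|[[i j] []]] /=; rewrite omega_torus // !idx_wtE ?addr0.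
Qed.

Lemma sum_basis_cartan i : \sum_k (basis_wt i 0 k)%:~R *: cartan k = cartan i.
Proof.
rewrite (bigD1 i) //= big1 ?addr0 => [|k ki]; first by rewrite mxE !eqxx scale1r.
by rewrite mxE (negPf ki) andbF scale0r.
Qed.

Lemma sum_wt_cartanD (mu nu : wt_t) : \sum_k ((mu + nu) 0 k)%:~R *: cartan k =
  \sum_k (mu 0 k)%:~R *: cartan k + \sum_k (nu 0 k)%:~R *: cartan k.
Proof. by rewrite -big_split; apply: eq_bigr => k _; rewrite mxE intrD scalerDl. Qed.

Lemma sum_wt_cartanN (nu : wt_t) : \sum_k ((- nu) 0 k)%:~R *: cartan k =
  - \sum_k (nu 0 k)%:~R *: cartan k.
Proof. by rewrite -sumrN; apply: eq_bigr => k _; rewrite mxE rmorphN scaleNr. Qed.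

Lemma root_bracket t : proot_valid t ->
  root_e t *m root_f t - root_f t *m root_e t = \sum_k (proot_wt t 0 k)%:~R *: cartan k.
Proof.
have br a b a' b' : omega a b *m omega a' b' - omega a' b' *m omega a b =
    form_wt K b *+ (a' == dual b) *: omega a b' - form_wt K a *+ (a' == dual a) *: omega b b'
    + (form_wt K b *+ (b' == dual b) *: omega a' a - form_wt K a *+ (b' == dual a) *: omega a' b).
  rewrite (diff_bracket PE (so_elt_skew _ _) (so_elt_skew _ _)).
  rewrite (so_elt_bracket _ _ (so_elt_skew _ _)) !so_elt_mulv !bil_evec.
  by rewrite -!scaleN1r !(so_eltDl, so_eltDr, so_eltZl, so_eltZr) !diffD !diffZ.
case: t => [i|[[i j] []]] /= ij.
- rewrite -scalemxAr -scalemxAl -scalerBr br sum_basis_cartan !dualE /form_wt !eq_idxE /=.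
  rewrite !mulr0n mulr1n !scale0r subr0 omegaxx scaler0 subrr addr0 scalerA.
  by rewrite mulVf ?pnatr_eq0 // scale1r.
- rewrite br sum_wt_cartanD !sum_basis_cartan !dualE /form_wt !eq_idxE.
  have ji : (j == i) = false by rewrite -val_eqE /= gtn_eqF.
  rewrite [i == j]eq_sym ji !scale0r subr0 add0r !scale1r.
  by rewrite (omegaC (x_idx j)) opprK.
- rewrite br sum_wt_cartanD sum_wt_cartanN !sum_basis_cartan !dualE /form_wt !eq_idxE.
  by rewrite !scale0r subr0 add0r !scale1r.
Qed.

(** The linear map whose values at elementary matrices are the [omega a b]. It intertwines A -> g A
    g^T with conjugation by V g, which reduces the invariance of the Casimir operator to matrix
    algebra. *)
Definition polar A : 'M[K]_d := diff P (A *m form_mx K r - adj (A *m form_mx K r)).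

Lemma polarD A B : polar (A + B) = polar A + polar B.
Proof. by rewrite /polar mulmxDl adjD opprD addrACA diffD. Qed.

Lemma polarZ c A : polar (c *: A) = c *: polar A.
Proof. by rewrite /polar -scalemxAl adjZ -scalerBr diffZ. Qed.

Lemma polar_delta a b : polar (delta_mx a b) = omega a b.
Proof.
have e : delta_mx a b *m form_mx K r = dyad (evec K a) (evec K b).
  by rewrite /dyad /evec trmx_delta mul_delta_mx.
by rewrite /polar e adj_dyad.
Qed.

Lemma polar_sum A : polar A = \sum_(ab : 'I_n * 'I_n) A ab.1 ab.2 *: omega ab.1 ab.2.
Proof.
rewrite {1}[A]matrix_sum_delta pair_bigA /=.
elim/big_rec2: _ => [|ab B C _ <-].
  by rewrite -[X in polar X](scale0r 0) polarZ scale0r.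
by rewrite polarD polarZ polar_delta.
Qed.

Lemma polar_equivariant g A : in_SO g -> V g *m polar A = polar (g *m A *m g^T) *m V g.
Proof.
move=> gS; have sk : skew (A *m form_mx K r - adj (A *m form_mx K r)).
  by rewrite /skew adjD adjN adjK opprB addrC.
rewrite /polar (skew_equivariant PE sk gS); congr (diff P _ *m _); rewrite mulmxBr mulmxBl.
have e : g *m (A *m form_mx K r) *m adj g = g *m A *m g^T *m form_mx K r.
  by rewrite /adj !mulmxA -(mulmxA (g *m A)) form_mxK mulmx1.
by rewrite -e (adjM (g *m _)) (adjM g) adjK (mulmxA g (adj _)).
Qed.

(** The sum over a basis of bivectors of each element times its dual, where [form_inv] on both sides
    expresses the duality for the form. Each bivector occurs twice, whence the factor 1/2. *)
Definition casimir : 'M[K]_d := 2^-1 *: \sum_(ab : 'I_n * 'I_n)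
  polar (delta_mx ab.1 ab.2) *m polar (form_inv K r *m delta_mx ab.2 ab.1 *m form_inv K r).

Lemma mul_delta_entry (g h : 'M[K]_n) a b c e : (g *m delta_mx a b *m h) c e = g c a * h b e.
Proof.
by rewrite -(mul_delta_mx (0 : 'I_1)) mulmxA -colE -mulmxA -rowE mxE big_ord1 !mxE.
Qed.

(** The bases [delta_mx a b] and [delta_mx b a] are dual for the trace pairing, for which A -> g A h
    has the adjoint A -> h A g. *)
Lemma polar_adjoint (g h k k' : 'M[K]_n) :
  \sum_(ab : 'I_n * 'I_n) polar (g *m delta_mx ab.1 ab.2 *m h) *m
     polar (k *m delta_mx ab.2 ab.1 *m k') =
  \sum_(ab : 'I_n * 'I_n) polar (delta_mx ab.1 ab.2) *m
     polar (k *m (h *m delta_mx ab.2 ab.1 *m g) *m k').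
Proof.
have E A : polar (k *m A *m k') =
    \sum_(ab : 'I_n * 'I_n) A ab.2 ab.1 *: polar (k *m delta_mx ab.2 ab.1 *m k').
  rewrite {1}[A]matrix_sum_delta exchange_big pair_bigA /=.
  elim/big_rec2: _ => [|ab B C _ <-].
    by rewrite mulmx0 mul0mx -[X in polar X](scale0r 0) polarZ scale0r.
  by rewrite mulmxDr mulmxDl polarD -scalemxAr -scalemxAl polarZ.
have E1 (ab : 'I_n * 'I_n) : polar (g *m delta_mx ab.1 ab.2 *m h) =
    \sum_(ce : 'I_n * 'I_n) (g ce.1 ab.1 * h ab.2 ce.2) *: omega ce.1 ce.2.
  by rewrite polar_sum; apply: eq_bigr => ce _; rewrite mul_delta_entry.
have E2 (ce : 'I_n * 'I_n) : polar (k *m (h *m delta_mx ce.2 ce.1 *m g) *m k') =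
    \sum_(ab : 'I_n * 'I_n) (g ce.1 ab.1 * h ab.2 ce.2) *:
      polar (k *m delta_mx ab.2 ab.1 *m k').
  by rewrite E; apply: eq_bigr => ab _; rewrite mul_delta_entry mulrC.
transitivity (\sum_(ab : 'I_n * 'I_n) \sum_(ce : 'I_n * 'I_n)
   (g ce.1 ab.1 * h ab.2 ce.2) *:
     (omega ce.1 ce.2 *m polar (k *m delta_mx ab.2 ab.1 *m k'))).
  apply: eq_bigr => ab _; rewrite E1 mulmx_suml; apply: eq_bigr => ce _.
  by rewrite -scalemxAl.
rewrite exchange_big; apply: eq_bigr => ce _; rewrite E2 polar_delta mulmx_sumr.
by apply: eq_bigr => ab _; rewrite -scalemxAr.
Qed.

(** V g passes both factors by equivariance, acting on each; [polar_adjoint] moves the action on the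
    first factor to the second, where the invariance [gF] of the form cancels it. *)
Lemma casimir_central g : in_SO g -> V g *m casimir = casimir *m V g.
Proof.
move=> gS; rewrite /casimir -scalemxAr -scalemxAl; congr (_ *: _).
have gF : g *m form_inv K r *m g^T = form_inv K r.
  have := SO_mul_adj gS; rewrite /adj; move: (form_mx K r) (form_inv K r) (form_mxK K r).
  move=> F Fi FFi e; rewrite -[LHS]mulmx1 -FFi -[RHS]mul1mx -e.
  by rewrite !mulmxA.
have assoc (A B C D E : 'M[K]_n) :
  A *m (B *m C *m D) *m E = A *m B *m C *m (D *m E) by rewrite !mulmxA.
have assoc' (A B C D : 'M[K]_n) :
  A *m B *m (C *m D *m A) *m (B *m C) = A *m B *m C *m D *m (A *m B *m C).
  by rewrite !mulmxA.
transitivity ((\sum_(ab : 'I_n * 'I_n) polar (g *m delta_mx ab.1 ab.2 *m g^T) *m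
   polar ((g *m form_inv K r) *m delta_mx ab.2 ab.1 *m (form_inv K r *m g^T))) *m V g).
  rewrite mulmx_sumr mulmx_suml; apply: eq_bigr => ab _.
  have e1 := polar_equivariant (delta_mx ab.1 ab.2) gS.
  have e2 := polar_equivariant (form_inv K r *m delta_mx ab.2 ab.1 *m form_inv K r) gS.
  rewrite [LHS]mulmxA e1 -[LHS]mulmxA e2 [LHS]mulmxA.
  by rewrite (assoc g (form_inv K r)).
rewrite polar_adjoint; apply: (congr1 (mulmx^~ (V g))); apply: eq_bigr => ab _.
by rewrite (assoc' g (form_inv K r)) gF.
Qed.

Lemma casimirE : casimir = \sum_k cartan k *m cartan k +
  \sum_(t | proot_valid t) (root_e t *m root_f t + root_f t *m root_e t).
Proof.
pose T a b := (form_wt K a * form_wt K b)^-1 *: (omega a b *m omega (dual b) (dual a)).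
have -> : casimir = 2^-1 *: \sum_a \sum_b T a b.
  rewrite pair_bigA; congr (_ *: _); apply: eq_bigr => -[a b] _ /=.
  rewrite polar_delta /T scalemxAr; congr (_ *m _); rewrite -polar_delta -polarZ.
  congr polar; apply/matrixP => c e; rewrite mul_delta_entry !mxE invfM.
  have -> : (b == dual c) = (c == dual b) by rewrite -(inj_eq (can_inj (@dualK r))) dualK eq_sym.
  case: eqP => [->|_]; case: eqP => _; rewrite ?(mulr0, mul0r, mulr1) //.
  by rewrite form_wt_dual mulrC.
have TC a b : T a b = T b a.
  rewrite /T (omegaC b a) (omegaC (dual a) (dual b)) mulNmx mulmxN opprK.
  by rewrite [_ * form_wt K b]mulrC.
have Txx a : T a a = 0 by rewrite /T omegaxx mul0mx scaler0.
have TE a b : T a b = (form_wt K a * form_wt K b)^-1 *: (omega a b *m omega (dual b) (dual a)).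
  exact: erefl.
clearbody T; have xz k : x_idx k != z_idx r by rewrite eq_idxE.
have yz k : y_idx k != z_idx r by rewrite eq_idxE.
have T1 (a b : 'I_n) : a != z_idx r -> b != z_idx r -> T a b = omega a b *m omega (dual b) (dual a).
  by move=> /negPf az /negPf bz; rewrite TE /form_wt az bz mulr1 invr1 scale1r.
have Txx2 k l : T (x_idx k) (x_idx l) = omega (x_idx k) (x_idx l) *m omega (y_idx l) (y_idx k).
  by rewrite (T1 _ _ (xz _) (xz _)) !dualE.
have Tyy k l : T (y_idx k) (y_idx l) = omega (y_idx l) (y_idx k) *m omega (x_idx k) (x_idx l).
  by rewrite TC (T1 _ _ (yz _) (yz _)) !dualE.
have Txy k l : T (x_idx k) (y_idx l) = omega (x_idx k) (y_idx l) *m omega (x_idx l) (y_idx k).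
  by rewrite (T1 _ _ (xz _) (yz _)) !dualE.
have Txz k : T (x_idx k) (z_idx r) = 2^-1 *: (omega (x_idx k) (z_idx r) *m omega (z_idx r) (y_idx k)).
  by rewrite TE /form_wt !eq_idxE !dualE mul1r.
have Tyz k : T (y_idx k) (z_idx r) = 2^-1 *: (omega (z_idx r) (y_idx k) *m omega (x_idx k) (z_idx r)).
  by rewrite TC TE /form_wt !eq_idxE !dualE mulr1.
rewrite (sum_idx_sym TC Txx) big_proot.
congr (_ + _); first by apply: eq_bigr => k _; rewrite Txy.
congr (_ + _); first by apply: eq_bigr => k _; rewrite Txz Tyz scalemxAr scalemxAl.
by apply: eq_bigr => ij _; rewrite Txx2 Tyy !Txy.
Qed.

Lemma casimir_scalar : irreducible_rep V -> exists c, casimir = c%:M.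
Proof.
move=> [d0 Virr].
have [c] : exists c, root (char_poly casimir^T) c.
  by apply/(@closed_rootP K); rewrite size_char_poly eqSS -lt0n.
rewrite -eigenvalue_root_char => /eigenvalueP[v vC v0]; exists c.
have [g gS||] := Virr (eigenspace casimir^T c).
- apply/eigenspaceP.
  have /eigenspaceP e := submx_refl (eigenspace casimir^T c).
  rewrite -mulmxA -trmx_mul -casimir_central // trmx_mul mulmxA e scalemxAl.
  by rewrite -scalemxAl.
- move=> e; have : (v <= eigenspace casimir^T c)%MS by apply/eigenspaceP.
  by rewrite e submx0 (negPf v0).
move=> full; have /eigenspaceP : (1%:M <= eigenspace casimir^T c)%MS by apply: submx_full.
by rewrite mul1mx scalemx1 => /(congr1 trmx); rewrite trmxK tr_scalar_mx.
Qed.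

End Casimir.

(** * Multiplicity one *)

Section SubspaceMatrix.
Variables (K : fieldType) (d : nat) (S : 'rV[K]_d -> Prop).
Hypothesis S0 : S 0.
Hypothesis S_lin : forall c x y, S x -> S y -> S (c *: x + y).

(** Take a matrix of maximal rank among those with row space in S: adjoining a vector of S cannot
    raise the rank, so the vector is already in the row space. *)
Lemma subspace_matrix : exists U : 'M[K]_d, forall w, S w <-> (w <= U)%MS.
Proof.
pose Q k := exists2 U : 'M[K]_d, (forall w, (w <= U)%MS -> S w) & \rank U = k.
have Qle k : boolp.asbool (Q k) -> (k <= d)%N.
  by move=> /boolp.asboolP[U _ <-]; apply: rank_leq_col.
have Q0 : exists k, boolp.asbool (Q k).
  exists 0%N; apply/boolp.asboolP; exists 0; last exact: mxrank0.
  by move=> w; rewrite submx0 => /eqP->.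
have [k /boolp.asboolP[U US rU] kmax] := ex_maxnP Q0 Qle.
exists U => w; split=> [Sw|]; last exact: US.
have : (\rank (U + w)%MS <= k)%N.
  apply: kmax; apply/boolp.asboolP; exists (U + w)%MS => // w' /sub_addsmxP[[a b] ->].
  rewrite /= [b]mx11_scalar mul_scalar_mx addrC; apply: S_lin => //.
  by apply: US; apply: submxMl.
rewrite -rU => le; have : \rank U == \rank (U + w)%MS.
  by rewrite eqn_leq le mxrankS ?addsmxSl.
by rewrite (mxrank_leqif_sup (addsmxSl U w)).2 addsmx_sub => /andP[].
Qed.

End SubspaceMatrix.

Section Height.
Variable r : nat.
Local Notation n := (r.*2.+1).
Local Notation wt_t := 'rV[int]_r.
Implicit Types mu nu : wt_t.

(* Twice the pairing with rho. *)
Definition height (nu : wt_t) : int := \sum_k nu 0 k * (r.*2 - k.*2.+1)%:Z.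

Lemma heightD mu nu : height (mu + nu) = height mu + height nu.
Proof. by rewrite /height -big_split; apply: eq_bigr => k _; rewrite mxE mulrDl. Qed.

Lemma heightN nu : height (- nu) = - height nu.
Proof. by rewrite /height -sumrN; apply: eq_bigr => k _; rewrite mxE mulNr. Qed.

Lemma height0 : height 0 = 0.
Proof. by rewrite /height big1 // => k _; rewrite mxE mul0r. Qed.

Lemma height_basis k : height (basis_wt k) = (r.*2 - k.*2.+1)%:Z.
Proof.
rewrite /height (bigD1 k) //= mxE !eqxx mul1r big1 ?addr0 // => j jk.
by rewrite mxE (negPf jk) andbF mul0r.
Qed.

Lemma rho2_gt0 (k : 'I_r) : (0 < r.*2 - k.*2.+1)%N.
Proof. by rewrite subn_gt0 ltn_Sdouble. Qed.

Lemma rho2_anti (k l : 'I_r) : (k < l)%N -> (r.*2 - l.*2.+1 < r.*2 - k.*2.+1)%N.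
Proof. by move=> kl; rewrite ltn_sub2l ?ltn_Sdouble // ltnS ltn_double. Qed.

(** The coordinates of 2 rho are positive and distinct. In consequence idx_wt a + idx_wt b has
    height 0 only for b = dual a, so [omega a b] raises heights, lowers them or is a multiple of a
    Cartan element. *)
Lemma height_idx_inj : injective (fun a : 'I_n => height (idx_wt a)).
Proof.
have I (k l : 'I_r) : (r.*2 - k.*2.+1)%N = (r.*2 - l.*2.+1)%N -> k = l.
  move=> e; apply/val_inj; case: (ltngtP k l) => // /rho2_anti; by rewrite e ltnn.
move=> a b /=; case: (idxP a) => [k|k|]; case: (idxP b) => [l|l|];
  rewrite !idx_wtE ?heightN ?height_basis ?height0 //.
- by case=> /I->.
- by move=> e; have := rho2_gt0 k; rewrite -ltz_nat e oppr_gt0 ltz_nat.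
- by case=> e; have := rho2_gt0 k; rewrite e.
- by move=> e; have := rho2_gt0 l; rewrite -ltz_nat -e oppr_gt0 ltz_nat.
- by move=> /oppr_inj[/I->].
- by move/eqP; rewrite oppr_eq0 => /eqP[e]; have := rho2_gt0 k; rewrite e.
- by case=> e; have := rho2_gt0 l; rewrite -e.
- by move/esym/eqP; rewrite oppr_eq0 => /eqP[e]; have := rho2_gt0 l; rewrite e.
Qed.

Lemma height_root_gt0 a : pos_root a -> 0 < height a.
Proof.
move=> [[i [j [ij [->|->]]]]|[i ->]]; rewrite ?heightD ?heightN !height_basis.
- by rewrite ltz_nat addn_gt0 rho2_gt0.
- by rewrite subr_gt0 ltz_nat rho2_anti.
by rewrite ltz_nat rho2_gt0.
Qed.

Lemma weight_le_height mu nu : weight_le mu nu -> height mu <= height nu /\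
  (height mu = height nu -> mu = nu).
Proof.
move=> [s sP e].
have eh : height nu - height mu = \sum_(a <- s) height a.
  rewrite -heightN -heightD e.
  elim: (s) => [|a s' IH]; last by rewrite !big_cons heightD IH.
  by rewrite !big_nil height0.
have ge : 0 <= \sum_(a <- s) height a.
  by rewrite big_seq; apply: sumr_ge0 => a /sP/height_root_gt0/ltW.
split; first by rewrite -subr_ge0 eh.
move=> he; move: eh; rewrite he subrr.
case: (s) sP e => [_|a s' sP _ /esym].
  by rewrite big_nil => /eqP; rewrite subr_eq0 => /eqP.
have ha : 0 < height a by apply/height_root_gt0/sP/mem_head.
rewrite big_cons => /eqP; rewrite gt_eqF // ltr_wpDr //.
by rewrite big_seq; apply: sumr_ge0 => b bs; apply/ltW/height_root_gt0/sP; rewrite inE bs orbT.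
Qed.

End Height.

Section MultiplicityOne.
Variables (K : numClosedFieldType) (r : nat) (V : so_rep K r).
Hypothesis r0 : (0 < r)%N.
Local Notation n := (r.*2.+1).
Local Notation d := (so_dim V).
Local Notation wt_t := 'rV[int]_r.
Variable P : 'I_d -> 'I_d -> {mpoly K[n * n]}.
Hypothesis PE : forall i j g, in_SO g -> V g i j = (P i j).@[fun k => mxvec g 0 k].
Variables (wts : seq wt_t) (p : wt_t -> 'M[K]_d).
Hypothesis wp : weight_projections wts p.
Local Notation omega := (omega P).
Implicit Types (u v w : 'cV[K]_n) (g X Y : 'M[K]_n) (x y : 'cV[K]_d).

Definition subspace (S : 'cV[K]_d -> Prop) :=
  S 0 /\ forall c x y, S x -> S y -> S (c *: x + y).

Lemma subspace_col S : subspace S -> exists U : 'M[K]_d, forall x, S x <-> (x^T <= U)%MS.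
Proof.
move=> [S0 SL]; have [||U UP] := @subspace_matrix K d (fun w : 'rV_d => S w^T).
- by rewrite trmx0.
- by move=> c x y Sx Sy; rewrite linearP; apply: SL.
by exists U => x; rewrite -UP trmxK.
Qed.

Lemma subspaceZ S c x : subspace S -> S x -> S (c *: x).
Proof. by move=> [S0 SL] Sx; rewrite -[_ *: _]addr0; apply: SL. Qed.

Lemma subspaceD S x y : subspace S -> S x -> S y -> S (x + y).
Proof. by move=> [S0 SL] Sx Sy; rewrite -[x]scale1r; apply: SL. Qed.

Lemma subspace_sum S (I : Type) (s : seq I) (F : I -> 'cV[K]_d) :
  subspace S -> (forall i, S (F i)) -> S (\sum_(i <- s) F i).
Proof. by move=> sS SF; apply: big_ind => // [|x y]; [case: sS | exact: subspaceD]. Qed.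

Lemma diff_skew_sum X : skew X -> diff P X = 2^-1 *: \sum_(ab : 'I_n * 'I_n)
  (X *m form_inv K r) ab.1 ab.2 *: omega ab.1 ab.2.
Proof.
move=> /skew_sum e; rewrite {1}e diffZ diff_sum; congr (_ *: _).
by apply: eq_bigr => ab _; rewrite diffZ.
Qed.

Lemma omega_stable_skew S X x : subspace S -> skew X ->
  (forall a b, S (omega a b *m x)) -> S (diff P X *m x).
Proof.
move=> sS sX Sx; rewrite (diff_skew_sum sX) -scalemxAl mulmx_suml; apply: subspaceZ => //.
by apply: subspace_sum => // ab; rewrite -scalemxAl; apply: subspaceZ.
Qed.

(* Along a one-parameter unipotent group the matrix entries are polynomials f_x
   with f_x' = f_(E x), so their coefficients vanish if S is stable under E. *)
Lemma eich_stable S (u v : 'cV[K]_n) : subspace S -> bil u u = 0 -> bil u v = 0 ->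
  (forall x, S x -> S (diff P (so_elt u v) *m x)) ->
  forall x, S x -> S (V (eich u v) *m x).
Proof.
move=> sS uu uv SE; have [U UP] := subspace_col sS.
pose f x j s := ((V (eich u (s *: v)) *m x)^T *m cokermx U) 0 j.
have eS s : in_SO (eich u (s *: v)) by apply: eich_SO; rewrite // bilZr uv mulr0.
have Vpoly i j : polyfun (fun s => V (eich u (s *: v)) i j).
  apply: (@polyfun_eq _ (fun s => (P i j).@[fun k => mxvec (eich u (s *: v)) 0 k])).
    by move=> s; rewrite PE.
  apply: polyfun_meval => k; case/mxvec_indexP: k => a b.
  by apply: polyfun_eq (curve_eich u v a b) => s; rewrite mxvecE.
have fder x j s0 : der (fun s => f x j (s0 + s)) (f x j s0) (f (diff P (so_elt u v) *m x) j s0).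
  have ED : mder (fun s => eich u (s *: v)) 1%:M (so_elt u v).
    move=> a b; exists ((- quad_form v * dyad u u a b)%:P), 1; split=> [|s _].
      by rewrite hornerC oner_neq0.
    rewrite /eich /so_elt !dyadLE !quad_formE !bilE !mxE !hornerC.
    by field.
  have VD := mder_mul (mder_mul (mder_cst (V (eich u (s0 *: v)))) (mder_rep PE (near0_SO_all eS) ED))
    (mder_cst x).
  have FD := mder_mul (mder_tr VD) (mder_cst (cokermx U)).
  have := FD 0 j; rewrite !mul0mx mulmx0 !mulmx1 !addr0 add0r mulmx0 addr0 -mulmxA.
  apply: der_eq => s; rewrite /f scalerDl -eichD ?bilZr ?uv ?mulr0 //.
  by rewrite so_mapM.
have fcoef0 k : forall x, S x -> forall j (q : {poly K}), (forall s, f x j s = q.[s]) -> q`_k = 0.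
  elim: k => [|k IH] x Sx j q qE.
    rewrite -horner_coef0 -qE /f scale0r eich0 so_map1 mul1mx.
    by move/UP: Sx; rewrite submxE => /eqP->; rewrite mxE.
  have := IH _ (SE _ Sx) j q^`().
  rewrite coef_deriv => /(_ _)/eqP; rewrite mulrn_eq0 => h; apply/eqP; apply: h => s.
  have D := fder x j s; have D' := der_horner q s.
  have [|_ ->//] := der_uniq D (der_eq _ D').
  by move=> s'; rewrite qE.
move=> x Sx; apply/UP; rewrite submxE; apply/eqP/matrixP => i j; rewrite ord1 [RHS]mxE.
have : polyfun (f x j).
  apply: polyfun_mulmx => [a b|a b]; last exact: polyfun_cst.
  apply: (@polyfun_eq _ (fun s => (V (eich u (s *: v)) *m x) b a)) => [s|]; first by rewrite [in RHS]mxE.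
  by apply: polyfun_mulmx => // a' b'; apply: polyfun_cst.
move=> [q qE]; have := qE 1; rewrite /f scale1r => ->.
have -> : q = 0 by apply/polyP => k; rewrite coef0 (fcoef0 k x Sx j q qE).
by rewrite hornerC.
Qed.

Lemma SO_stable S : subspace S ->
  (forall a b x, S x -> S (omega a b *m x)) ->
  forall g, in_SO g -> forall x, S x -> S (V g *m x).
Proof.
move=> sS SO g gS; suff [] : in_SO g /\ forall x, S x -> S (V g *m x) by [].
move: g gS; apply: SO_eich_ind => // [|u v g uu uv [gS IH]].
  by split=> [|x]; rewrite ?so_map1 ?mul1mx //; apply: SO1.
have eS := eich_SO uu uv; split=> [|x Sx]; first exact: SOM.
rewrite (so_mapM V eS gS) -mulmxA; apply: eich_stable => // [y Sy|]; last exact: IH.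
by apply: omega_stable_skew => //; [exact: so_elt_skew | move=> a b; apply: SO].
Qed.

Lemma irreducible_subspace S x : irreducible_rep V -> subspace S ->
  (forall g, in_SO g -> forall y, S y -> S (V g *m y)) -> x != 0 -> S x -> forall y, S y.
Proof.
move=> [_ Virr] sS SV x0 Sx y; have [U UP] := subspace_col sS; apply/UP.
have [g gS|U0|] := Virr U; last exact: submx_full.
  apply/row_subP => i; rewrite row_mul -[row i U]trmxK -trmx_mul; apply/UP.
  by apply: SV => //; apply/UP; rewrite trmxK; apply: row_sub.
by move/UP: Sx; rewrite U0 submx0 trmx_eq0 (negPf x0).
Qed.

Variable lam : wt_t.
Hypothesis V_irr : irreducible_rep V.
Hypothesis V_hw : highest_weight V lam.

Lemma proj_high nu : height lam <= height nu -> nu != lam -> p nu = 0.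
Proof.
move=> hn ne; apply/eqP; apply: contraNT ne => /(is_weightE wp) nw.
have [hl e] := weight_le_height (V_hw.2 nu nw); apply/eqP/e/eqP.
by rewrite eq_le hl hn.
Qed.

(** The span of what lowering operators make of v. Raising and Cartan operators are left out so that
    [lowered_decomp] can bound heights by induction; stability under them is [lowered_stable]. *)
Inductive lowered (v : 'cV[K]_d) : 'cV[K]_d -> Prop :=
  | lowered_self : lowered v v
  | lowered0 : lowered v 0
  | lowered_lin c x y : lowered v x -> lowered v y -> lowered v (c *: x + y)
  | lowered_omega a b x : height (idx_wt a + idx_wt b) < 0 ->
      lowered v x -> lowered v (omega a b *m x).

Lemma lowered_subspace (v : 'cV[K]_d) : subspace (lowered v).
Proof. by split; [exact: lowered0 | exact: lowered_lin]. Qed.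

(** Raising operators annihilate v, by maximality of its weight, and Cartan elements scale it; both
    are moved past lowering operators by brackets. *)
Lemma lowered_stable (v : 'cV[K]_d) : p lam *m v = v ->
  forall x, lowered v x -> forall a b, lowered v (omega a b *m x).
Proof.
move=> pv; have sv := lowered_subspace v.
move=> x; elim=> {x} [a b|a b|c x y _ IHx _ IHy a b|a b x hab lx IH a' b'].
- have [h|h|h] := ltgtP (height (idx_wt a + idx_wt b)) 0.
  + exact/lowered_omega/lowered_self.
  + suff -> : omega a b *m v = 0 by apply: lowered0.
    rewrite -pv mulmxA -(proj_omega PE wp) proj_high ?mul0mx //.
      by rewrite heightD lerDl ltW.
    by rewrite -subr_eq0 addrAC subrr add0r; apply: contraTneq h => ->; rewrite height0 ltxx.
  have -> : b = dual a.
    apply: height_idx_inj; rewrite /= idx_wt_dual heightN.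
    by apply/eqP; rewrite -addr_eq0 addrC -heightD h.
  suff [c ->] : exists c, omega a (dual a) *m v = c *: v.
    by apply: subspaceZ => //; apply: lowered_self.
  case: (idxP a) => [k|k|]; rewrite dualE.
  + exists (lam 0 k)%:~R; rewrite -{1}pv mulmxA (cartan_proj PE wp) -scalemxAl pv //.
  + exists (- (lam 0 k)%:~R); rewrite omegaC mulNmx -{1}pv mulmxA (cartan_proj PE wp).
    by rewrite -scalemxAl pv scaleNr.
  by exists 0; rewrite omegaxx mul0mx scale0r.
- by rewrite mulmx0; apply: lowered0.
- by rewrite mulmxDr -scalemxAr; apply: lowered_lin.
(* The bracket is a combination of operators [omega], and the induction hypothesis for x covers all
   of them. *)
have br : omega a' b' *m omega a b =
    diff P (so_elt (evec K a') (evec K b') *m so_elt (evec K a) (evec K b) -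
      so_elt (evec K a) (evec K b) *m so_elt (evec K a') (evec K b')) +
    omega a b *m omega a' b'.
  by rewrite -(diff_bracket PE (so_elt_skew _ _) (so_elt_skew _ _)) subrK.
rewrite mulmxA br mulmxDl; apply: subspaceD => //.
  apply: omega_stable_skew => //.
  by apply: skew_bracket; apply: so_elt_skew.
by rewrite -mulmxA; apply: lowered_omega.
Qed.

(** Lowering operators strictly decrease heights, so apart from a multiple of v only components of
    height below that of lam arise. *)
Lemma lowered_decomp (v x : 'cV[K]_d) : p lam *m v = v -> lowered v x ->
  exists c y, x = c *: v + y /\ forall nu, height lam <= height nu -> p nu *m y = 0.
Proof.
move=> pv; elim=> {x} [||c x y _ [c1 [y1 [-> h1]]] _ [c2 [y2 [-> h2]]]|a b x hab _ [c [y [-> h]]]].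
- by exists 1, 0; rewrite scale1r addr0; split=> // nu _; rewrite mulmx0.
- by exists 0, 0; rewrite scale0r addr0; split=> // nu _; rewrite mulmx0.
- exists (c * c1 + c2), (c *: y1 + y2); split=> [|nu hn].
    by rewrite scalerDr scalerA addrACA -scalerDl.
  by rewrite mulmxDr -scalemxAr h1 // h2 // scaler0 addr0.
exists 0, (omega a b *m (c *: v + y)); split=> [|nu hn]; first by rewrite scale0r add0r.
have -> : nu = nu - (idx_wt a + idx_wt b) + (idx_wt a + idx_wt b) by rewrite subrK.
have hn' : height lam < height (nu - (idx_wt a + idx_wt b)).
  by rewrite heightD heightN; apply: le_lt_trans hn _; rewrite ltrDl oppr_gt0.
rewrite mulmxA (proj_omega PE wp) -mulmxA mulmxDr h ?(ltW hn') // addr0.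
rewrite proj_high ?(ltW hn') ?mul0mx ?mulmx0 //.
by apply: contraTneq hn' => ->; rewrite ltxx.
Qed.

(** By irreducibility every vector is [lowered v], so the image of [p lam] is the line of v. As
    [p lam] fixes v, its trace is 1. *)
Lemma highest_weight_mult1 : \tr (p lam) = 1.
Proof.
have [[v v0 Vv] _] := V_hw; have pv : p lam *m v = v := weight_vector wp Vv.
have all x : lowered v x.
  apply: (irreducible_subspace V_irr (lowered_subspace v) _ v0 (lowered_self v)).
  apply: SO_stable; first exact: lowered_subspace.
  by move=> a b y ly; apply: lowered_stable.
have col x : exists c, p lam *m x = c *: v.
  have [c [y [-> h]]] := lowered_decomp pv (all x).
  by exists c; rewrite mulmxDr -scalemxAr pv h // addr0.
have /fin_all_exists[c cE] := fun j : 'I_d => col (delta_mx j 0).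
have pE : p lam = v *m \row_j c j.
  apply/matrixP => i j; have := congr1 (fun M : 'cV_d => M i 0) (cE j).
  by rewrite -colE !mxE big_ord1 !mxE mulrC.
have c1 : (\row_j c j *m v) 0 0 = 1.
  have e : (\row_j c j *m v) 0 0 *: v = v.
    by rewrite -[RHS]pv pE -mulmxA [X in _ = v *m X]mx11_scalar mul_mx_scalar.
  apply/eqP; rewrite -subr_eq0; move/eqP: e; rewrite -[X in _ == X]scale1r.
  by rewrite -subr_eq0 -scalerBl scaler_eq0 (negPf v0) orbF.
by rewrite pE mxtrace_mulC trace_mx11.
Qed.

End MultiplicityOne.

(** * The Weyl group *)

Section WeylGroup.
Variables (K : numClosedFieldType) (r : nat).
Local Notation n := (r.*2.+1).
Local Notation wt_t := 'rV[int]_r.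
Implicit Types (s : weyl r) (t z : 'I_r -> K) (mu nu : wt_t).

Definition weyl_pt s t k : K := if s.2 k then (t (s.1 k))^-1 else t (s.1 k).
Definition weyl_pt_inv s t k : K :=
  let j := (s.1^-1)%g k in if s.2 j then (t j)^-1 else t j.

Lemma weyl_pt_nonzero s t : nonzero t -> nonzero (weyl_pt s t).
Proof. by move=> t0 k; rewrite /weyl_pt; case: ifP; rewrite ?invr_eq0. Qed.

Lemma weyl_pt_inv_nonzero s t : nonzero t -> nonzero (weyl_pt_inv s t).
Proof. by move=> t0 k; rewrite /weyl_pt_inv; case: ifP; rewrite ?invr_eq0. Qed.

Lemma weyl_ptK s t : weyl_pt s (weyl_pt_inv s t) =1 t.
Proof.
by move=> k; rewrite /weyl_pt /weyl_pt_inv permK; case: (s.2 k); rewrite ?invrK.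
Qed.

Lemma zpow_weyl s t nu : zpow (weyl_act s nu) (weyl_pt s t) = zpow nu t.
Proof.
rewrite [RHS]/zpow (reindex_perm s.1); apply: eq_bigr => k _ /=.
rewrite mxE /weyl_pt; case: (s.2 k) => /=; last by rewrite expr0 mul1r.
by rewrite expr1 mulN1r -invr_expz -expfV invrK.
Qed.

Lemma eq_zpow nu t z : t =1 z -> zpow nu t = zpow nu z.
Proof. by move=> tz; apply: eq_bigr => k _; rewrite tz. Qed.

Lemma eq_torus t z : t =1 z -> torus t = torus z.
Proof.
move=> tz; apply/matrixP => a b; rewrite !torusE.
by case: (idxP a) => [k|k|]; rewrite !torus_evE ?tz.
Qed.

Definition weyl_idx s (a : 'I_n) : 'I_n :=
  if insub a./2 is Some k then
    if odd a (+) s.2 k then y_idx (s.1 k) else x_idx (s.1 k)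
  else a.

Lemma weyl_idx_x s k : weyl_idx s (x_idx k) = if s.2 k then y_idx (s.1 k) else x_idx (s.1 k).
Proof. by rewrite /weyl_idx x_idxE doubleK valK odd_double. Qed.

Lemma weyl_idx_y s k : weyl_idx s (y_idx k) = if s.2 k then x_idx (s.1 k) else y_idx (s.1 k).
Proof.
by rewrite /weyl_idx y_idxE /= uphalf_double valK odd_double; case: (s.2 k).
Qed.

Lemma weyl_idx_z s : weyl_idx s (z_idx r) = z_idx r.
Proof. by rewrite /weyl_idx /= doubleK insubF // ltnn. Qed.

Definition weyl_idxE := (weyl_idx_x, weyl_idx_y, weyl_idx_z).

Lemma torus_ev_weyl s t a : torus_ev (weyl_pt s t) a = torus_ev t (weyl_idx s a).
Proof.
case: (idxP a) => [k|k|]; rewrite !weyl_idxE ?torus_evE /weyl_pt //;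
  by case: (s.2 k); rewrite !torus_evE ?invrK.
Qed.

(** Signed permutations act by permutation matrices, a change of sign exchanging x_k and y_k. The
    determinant may be -1; [weyl_SO] corrects this by a scalar, which conjugation does not see. *)
Definition weyl_mx s : 'M[K]_n := \matrix_(i, a) (i == weyl_idx s a)%:R.

Lemma weyl_mx_isom s : isom (weyl_mx s).
Proof.
have e a : weyl_mx s *m evec K a = evec K (weyl_idx s a).
  by apply/matrixP => i j; rewrite /evec -colE !mxE ord1 eqxx andbT.
apply: isom_gramP => a b; rewrite !e bil_evec.
have I := inj_eq (@perm_inj _ s.1).
case: (idxP a) => [k|k|]; case: (idxP b) => [l|l|]; rewrite !weyl_idxE ?dualE;
  try case ek: (s.2 k); try case el: (s.2 l); rewrite ?dualE /form_wt ?eq_idxE ?I //;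
  by case: (eqVneq l k) => // lk; move: el; rewrite lk ek.
Qed.

Lemma weyl_mx_torus s t : torus t *m weyl_mx s = weyl_mx s *m torus (weyl_pt s t).
Proof.
apply/matrixP => i a; rewrite !torus_diag mul_diag_mx mul_mx_diag [LHS]mxE [RHS]mxE.
rewrite [weyl_mx s i a]mxE [(\row__ _) 0 i]mxE [(\row__ _) 0 a]mxE torus_ev_weyl.
by case: eqP => [->|]; rewrite ?mulr0 ?mul0r ?mulr1 ?mul1r.
Qed.

Definition weyl_SO s : 'M[K]_n := \det (weyl_mx s) *: weyl_mx s.

Lemma weyl_SO_in s : in_SO (weyl_SO s).
Proof. exact/isom_SO/weyl_mx_isom. Qed.

Lemma weyl_SO_torus s t : torus t *m weyl_SO s = weyl_SO s *m torus (weyl_pt s t).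
Proof. by rewrite /weyl_SO -scalemxAr weyl_mx_torus -scalemxAl. Qed.

Variable V : so_rep K r.

Lemma rep_weyl s t : nonzero t ->
  V (torus t) *m V (weyl_SO s) = V (weyl_SO s) *m V (torus (weyl_pt s t)).
Proof.
move=> t0; have NS := weyl_SO_in s.
have tS := torus_SO t0; have wS := torus_SO (weyl_pt_nonzero s t0).
by rewrite -(so_mapM V tS NS) weyl_SO_torus (so_mapM V NS wS).
Qed.

Lemma rep_mul_adj g : in_SO g -> V g *m V (adj g) = 1%:M.
Proof. by move=> gS; rewrite -so_mapM ?SO_mul_adj ?so_map1 //; apply: SO_adj. Qed.

Lemma trace_weyl s t : nonzero t -> \tr (V (torus (weyl_pt s t))) = \tr (V (torus t)).
Proof.
move=> t0; have NS := weyl_SO_in s.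
have := congr1 (fun M => \tr (M *m V (adj (weyl_SO s)))) (rep_weyl s t0).
rewrite /= -[in LHS]mulmxA rep_mul_adj // mulmx1 => ->.
by rewrite mxtrace_mulC mulmxA rep_adjK // mul1mx.
Qed.

Lemma is_weight_weyl s nu : is_weight V nu -> is_weight V (weyl_act s nu).
Proof.
move=> [v v0 Vv]; have NS := weyl_SO_in s; have aS := SO_adj NS.
exists (V (adj (weyl_SO s)) *m v).
  apply: contraNneq v0 => /(congr1 (mulmx (V (weyl_SO s)))).
  by rewrite mulmxA rep_mul_adj // mul1mx mulmx0 => ->.
move=> w w0; rewrite -/(zpow (weyl_act s nu) w).
have u0 := weyl_pt_inv_nonzero s w0; set u := weyl_pt_inv s w in u0.
rewrite -(eq_zpow _ (weyl_ptK s w)) zpow_weyl -(eq_torus (weyl_ptK s w)) -/u.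
have e : V (torus (weyl_pt s u)) *m V (adj (weyl_SO s)) = V (adj (weyl_SO s)) *m V (torus u).
  have := congr1 (fun M => V (adj (weyl_SO s)) *m M *m V (adj (weyl_SO s))) (rep_weyl s u0).
  rewrite /= -!mulmxA rep_mul_adj // mulmx1 => ->.
  by rewrite mulmxA rep_adjK // mul1mx.
by rewrite mulmxA e -mulmxA Vv // -scalemxAr.
Qed.

End WeylGroup.

(** * Dominant weights and the norm of mu + rho *)

Section DominantWeights.
Variable r : nat.
Local Notation wt_t := 'rV[int]_r.
Implicit Types (mu nu : wt_t) (s : weyl r).

Definition dominant mu := (forall i, 0 <= mu 0 i) /\
  forall i j : 'I_r, (i <= j)%N -> mu 0 j <= mu 0 i.

Definition dot mu nu : int := \sum_k mu 0 k * nu 0 k.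

Lemma dot_weyl s mu : dot (weyl_act s mu) (weyl_act s mu) = dot mu mu.
Proof.
rewrite [RHS]/dot (reindex_perm s.1); apply: eq_bigr => k _ /=; rewrite mxE.
by case: (s.2 k); rewrite ?expr1 ?expr0; ring.
Qed.

(** A conjugate of maximal height is dominant: otherwise changing the sign of a negative coordinate,
    or exchanging two coordinates in increasing order, would raise the height. *)
Lemma dominant_conj mu : exists s : weyl r, dominant (weyl_act s mu).
Proof.
pose s0 : weyl r := (1%g, [ffun=> false]).
case: (@Order.TotalTheory.arg_maxP _ _ _ s0 xpredT (fun s => height (weyl_act s mu))) => // s _ smax.
pose c (k : 'I_r) : int := (r.*2 - k.*2.+1)%:Z.
have c0 k : 0 < c k by rewrite ltz_nat rho2_gt0.
exists s; split=> [i|i j].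
  pose s' : weyl r := (s.1, [ffun k => s.2 k (+) (k == i)]).
  have := smax s' isT; rewrite /= -subr_ge0 -heightN -heightD.
  rewrite /height (bigD1 i) //= big1 ?addr0 => [|k ki]; last first.
    by rewrite !mxE !ffunE (negPf ki) addbF subrr mul0r.
  rewrite pmulr_lge0 ?c0 // !mxE /= ffunE eqxx signr_addb expr1 mulrN1 mulNr opprK.
  by rewrite -mulr2n pmulrn_lge0.
rewrite leq_eqVlt => /predU1P[/val_inj->//|ij].
have ji : j != i by rewrite neq_ltn ij orbT.
pose s' : weyl r := ((tperm i j * s.1)%g, [ffun k => s.2 (tperm i j k)]).
have s'E k : weyl_act s' mu 0 k = weyl_act s mu 0 (tperm i j k).
  by rewrite !mxE /= ffunE permM.
have D k : (weyl_act s mu - weyl_act s' mu) 0 k =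
    weyl_act s mu 0 k - weyl_act s mu 0 (tperm i j k).
  by rewrite mxE -s'E; congr (_ + _); rewrite mxE.
have := smax s' isT; rewrite /= -subr_ge0 -heightN -heightD /height.
rewrite (bigD1 i) //= (bigD1 j) //= big1 ?addr0 => [|k /andP[ki kj]]; last first.
  by rewrite D tpermD 1?eq_sym // subrr mul0r.
rewrite !D tpermL tpermR; set yi := weyl_act s mu 0 i; set yj := weyl_act s mu 0 j.
rewrite -/(c i) -/(c j) -[yj - yi]opprB mulNr -mulrBr pmulr_lge0 ?subr_ge0 //.
by rewrite subr_gt0 ltz_nat rho2_anti.
Qed.

Lemma dot_root_ge0 a nu : pos_root a -> dominant nu -> 0 <= dot a nu.
Proof.
have dotb i : dot (basis_wt i) nu = nu 0 i.
  rewrite /dot (bigD1 i) //= mxE !eqxx mul1r big1 ?addr0 // => k ki.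
  by rewrite mxE (negPf ki) andbF mul0r.
have dotD x y : dot (x + y) nu = dot x nu + dot y nu.
  by rewrite /dot -big_split; apply: eq_bigr => k _; rewrite mxE mulrDl.
have dotN x : dot (- x) nu = - dot x nu.
  by rewrite /dot -sumrN; apply: eq_bigr => k _; rewrite mxE mulNr.
move=> [[i [j [ij [->|->]]]]|[i ->]] [n0 na]; rewrite ?dotD ?dotN !dotb //.
  by rewrite addr_ge0.
by rewrite subr_ge0 na // ltnW.
Qed.

(** |lam|^2 - |mu|^2 = (lam - mu, lam + mu), where lam - mu is a sum of positive roots and lam + mu
    is dominant. *)
Lemma dot_dominant_le mu lam : dominant mu -> dominant lam -> weight_le mu lam ->
  dot mu mu <= dot lam lam.
Proof.
move=> [m0 ma] [l0 la] [s sP e].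
have dd : dominant (lam + mu).
  by split=> [i|i j ij]; rewrite !mxE ?addr_ge0 // lerD ?ma ?la.
rewrite -subr_ge0; have -> : dot lam lam - dot mu mu = dot (lam - mu) (lam + mu).
  by rewrite /dot -sumrB; apply: eq_bigr => k _; rewrite !mxE; ring.
have -> : dot (lam - mu) (lam + mu) = \sum_(a <- s) dot a (lam + mu).
  rewrite e; elim: (s) => [|a s' IH]; rewrite ?big_nil ?big_cons.
    by rewrite /dot big1 // => k _; rewrite mxE mul0r.
  by rewrite -IH /dot -big_split; apply: eq_bigr => k _; rewrite mxE mulrDl.
by rewrite big_seq; apply: sumr_ge0 => a /sP/dot_root_ge0; apply.
Qed.

(* |2 mu + 2 rho|^2 *)
Definition rho_norm mu : int := \sum_(k < r) (mu 0 k *+ 2 + (r.*2 - k.*2.+1)%:Z) ^+ 2.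

Lemma rho_normE mu :
  rho_norm mu = dot mu mu *+ 4 + height mu *+ 4 + \sum_(k < r) (r.*2 - k.*2.+1)%:Z ^+ 2.
Proof.
rewrite /rho_norm /dot /height -!sumrMnl -!big_split; apply: eq_bigr => k _ /=.
by ring.
Qed.

End DominantWeights.

(** Up to a constant |mu + rho|^2 is |mu|^2 plus the height of mu, and lam maximizes both terms, the
    first by passing to the dominant conjugate of mu. Equality forces equal heights, hence mu = lam
    as mu is below lam. *)
Lemma rho_norm_inj (K : numClosedFieldType) (r : nat) (V : so_rep K r) lam mu :
  dominant lam -> highest_weight V lam -> is_weight V mu ->
  rho_norm mu = rho_norm lam -> mu = lam.
Proof.
move=> ld [_ hw] mw; rewrite !rho_normE => /addIr e.
have [s sd] := dominant_conj mu; have sw := is_weight_weyl s mw.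
have := dot_dominant_le sd ld (hw _ sw); rewrite dot_weyl => d_le.
have [h_le h_eq] := weight_le_height (hw _ mw); apply: h_eq.
apply/eqP; rewrite eq_le h_le -(ler_pMn2r (n := 4)) // -(lerD2l (dot mu mu *+ 4)) e.
by rewrite lerD2r lerMn2r d_le.
Qed.

(** * Alternants and the Laplacian *)

Section WeylDenominator.
Variable K : numFieldType.

(* chebq m (x + 1/x) = x^m + x^(m-1) + ... + x^(-m) *)
Fixpoint chebq_pair m : {poly K} * {poly K} :=
  if m is m'.+1 then let: (a, b) := chebq_pair m' in (b, 'X * b - a)
  else (1, 'X + 1).
Definition chebq m := (chebq_pair m).1.

Lemma chebqSS m : chebq m.+2 = 'X * chebq m.+1 - chebq m.
Proof. by rewrite /chebq /=; case: (chebq_pair m). Qed.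

Lemma chebq_ind (Q : nat -> Prop) :
  Q 0%N -> Q 1%N -> (forall m, Q m -> Q m.+1 -> Q m.+2) -> forall m, Q m.
Proof.
move=> Q0 Q1 QS m; suff [] : Q m /\ Q m.+1 by [].
by elim: m => // m [Qm Qm1]; split=> //; apply: QS.
Qed.

Lemma chebq_monic m : size (chebq m) = m.+1 /\ chebq m \is monic.
Proof.
elim/chebq_ind: m => [||m [sm _] [sm1 mm1]].
- by rewrite size_poly1 monic1.
- by rewrite -[chebq 1]/('X + 1%:P) size_XaddC monicXaddC.
have s0 : size ('X * chebq m.+1) = m.+3 by rewrite mulrC size_mulX ?sm1 // -size_poly_eq0 sm1.
rewrite chebqSS size_polyDl ?size_polyN ?sm ?s0 //; split=> //.
rewrite monicE lead_coefDl ?size_polyN ?sm ?s0 // mulrC lead_coefMX.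
by rewrite -monicE.
Qed.

Lemma chebqE m (x : K) : x != 0 ->
  (1 - x) * x ^+ m * (chebq m).[x + x^-1] = 1 - x ^+ m.*2.+1.
Proof.
move=> x0; elim/chebq_ind: m => [||m IH IH1].
- by rewrite hornerC; ring.
- by rewrite -[chebq 1]/('X + 1%:P) hornerD hornerX hornerC; field.
rewrite chebqSS hornerD hornerN hornerM hornerX.
have -> : (1 - x) * x ^+ m.+2 * ((x + x^-1) * (chebq m.+1).[x + x^-1] - (chebq m).[x + x^-1])
  = (x ^+ 2 + 1) * ((1 - x) * x ^+ m.+1 * (chebq m.+1).[x + x^-1])
    - x ^+ 2 * ((1 - x) * x ^+ m * (chebq m).[x + x^-1]).
  by rewrite !exprS; field.
by rewrite IH IH1 !doubleS !exprS; ring.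
Qed.

Lemma det_rev r (A : 'M[K]_r) : \det (\matrix_(i, j) A (rev_ord i) (rev_ord j)) = \det A.
Proof.
pose s := perm (@rev_ord_inj r).
have -> : \matrix_(i, j) A (rev_ord i) (rev_ord j) = row_perm s (col_perm s A).
  by apply/matrixP => i j; rewrite !mxE !permE.
rewrite row_permE col_permE !det_mulmx !det_perm odd_permV mulrC -mulrA -expr2.
by rewrite sqrr_sign mulr1.
Qed.

(** The q m are a unitriangular change of basis of the powers, which leaves a Vandermonde
    determinant with its columns in decreasing order. *)
Lemma det_monic_family r (q : nat -> {poly K}) (y : 'I_r -> K) :
  (forall m, size (q m) = m.+1 /\ q m \is monic) ->
  \det (\matrix_(i < r, j < r) (q (r - j.+1)%N).[y i]) =
  \prod_(ij : 'I_r * 'I_r | (ij.1 < ij.2)%N) (y ij.1 - y ij.2).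
Proof.
move=> qm; pose W : 'M[K]_r := \matrix_(i, l) y i ^+ (r - l.+1).
pose T : 'M[K]_r := \matrix_(l, j) (q (r - j.+1)%N)`_(r - l.+1).
have -> : \matrix_(i < r, j < r) (q (r - j.+1)%N).[y i] = W *m T.
  apply/matrixP => i j; rewrite !mxE (@horner_coef_wide _ r); last first.
    by rewrite (qm _).1 -subSn // subSS leq_subr.
  rewrite (reindex_inj rev_ord_inj); apply: eq_bigr => l _ /=.
  by rewrite !mxE mulrC.
rewrite det_mulmx [\det T]det_trig; last first.
  apply/is_trig_mxP => l j lj; rewrite mxE nth_default // (qm _).1.
  by have := ltn_ord j; lia.
rewrite [X in _ * X]big1 ?mulr1 => [|j _]; last first.
  by rewrite mxE; have [sq /monicP] := qm (r - j.+1)%N; rewrite lead_coefE sq.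
have := det_Vandermonde (\row_j y (rev_ord j)); rewrite -det_tr -det_rev.
set A := \matrix_(i, j) _; have -> : A = W.
  apply/matrixP => i j; rewrite !mxE rev_ordK; congr (_ ^+ _).
move=> ->; rewrite pair_big_dep /=.
pose sw (ij : 'I_r * 'I_r) := (rev_ord ij.2, rev_ord ij.1).
have swI : injective sw.
  move=> [i j] [i' j'] e; have := congr1 fst e; have := congr1 snd e.
  by move=> /rev_ord_inj/= -> /rev_ord_inj/= ->.
rewrite [RHS](reindex_inj swI) /=; apply: eq_big => [[i j]|[i j] _] /=.
  by have := ltn_ord i; have := ltn_ord j; lia.
by rewrite !mxE.
Qed.

(** Entry (i, j) is (1 - x_i) x_i^(r-1) times [chebq (r - j.+1)] at y_i = x_i + 1/x_i. In the
    remaining Vandermonde determinant y_i - y_j = (1 - x_i x_j)(x_j - x_i) / (x_i x_j), and the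
    powers of the x_i cancel the denominators. *)
Lemma weyl_denominator r (x : 'I_r -> K) : (forall i, x i != 0) ->
  \det (\matrix_(i < r, j < r) (x i ^+ j - x i ^+ (r.*2 - j.+1))) =
  (\prod_i (1 - x i)) * \prod_(ij : 'I_r * 'I_r | (ij.1 < ij.2)%N)
     ((1 - x ij.1 * x ij.2) * (x ij.2 - x ij.1)).
Proof.
move=> x0; pose D : 'rV[K]_r := \row_i ((1 - x i) * x i ^+ r.-1).
pose y i := x i + (x i)^-1.
have -> : \matrix_(i < r, j < r) (x i ^+ j - x i ^+ (r.*2 - j.+1)) =
    diag_mx D *m \matrix_(i, j) (chebq (r - j.+1)).[y i].
  apply/matrixP => i j; rewrite mul_diag_mx !mxE.
  have jr := ltn_ord j.
  have e1 : r.-1 = (j + (r - j.+1))%N by lia.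
  have e2 : (r.*2 - j.+1 = j + (r - j.+1).*2.+1)%N by lia.
  rewrite e1 e2 !exprD -[LHS]mulr1.
  have := chebqE (r - j.+1) (x0 i); rewrite -/(y i) => e.
  transitivity (x i ^+ j * ((1 - x i) * x i ^+ (r - j.+1) * (chebq (r - j.+1)).[y i])).
    by rewrite e; ring.
  by ring.
rewrite det_mulmx det_diag det_monic_family; last exact: chebq_monic.
rewrite (eq_bigr (fun i => (1 - x i) * x i ^+ r.-1)) => [|i _]; last by rewrite mxE.
rewrite big_split /= -mulrA; congr (_ * _).
have e : \prod_i x i ^+ r.-1 = \prod_(ij : 'I_r * 'I_r | (ij.1 < ij.2)%N) (x ij.1 * x ij.2).
  have : \prod_i \prod_(j < r) x i = (\prod_i x i) * \prod_i x i ^+ r.-1.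
    rewrite -big_split /=; apply: eq_bigr => i _; rewrite prodr_const card_ord.
    by rewrite -exprS prednK // (leq_ltn_trans _ (ltn_ord i)).
  rewrite big_triangular => /mulfI -> //.
  by apply/prodf_neq0.
rewrite e -big_split /=; apply: eq_bigr => -[i j] _ /=; rewrite /y.
by field; rewrite !x0.
Qed.

End WeylDenominator.

(** * Euler operators with shifted exponents *)

Section EulerOperators.
Variables (K : numFieldType) (r : nat).
Implicit Types (f g : {mpoly K[r]}) (c : K) (k : 'I_r) (m : 'X_{1..r}).

(** The operator X_k d/dX_k conjugated by X_k^(-c): f stands for X_k^(-c) f, where c may be
    half-integral. The shifts of factors add, as in [eulerM]. *)
Definition euler c k f : {mpoly K[r]} := 'X_k * f^`M(k) - c *: f.

Lemma eulerD c k f g : euler c k (f + g) = euler c k f + euler c k g.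
Proof. by rewrite /euler mderivD -!mul_mpolyC; ring. Qed.

Lemma eulerZ c k a f : euler c k (a *: f) = a *: euler c k f.
Proof. by rewrite /euler mderivZ -!mul_mpolyC; ring. Qed.

Lemma euler0 c k : euler c k 0 = 0.
Proof. by rewrite -[X in euler _ _ X](scale0r 0) eulerZ scale0r. Qed.

Lemma euler_sum c k (I : Type) (s : seq I) (F : I -> {mpoly K[r]}) :
  euler c k (\sum_(i <- s) F i) = \sum_(i <- s) euler c k (F i).
Proof. by elim/big_rec2: _ => [|i A B _ <-]; rewrite ?euler0 ?eulerD. Qed.

Lemma eulerM c c' k f g : euler (c + c') k (f * g) = euler c k f * g + f * euler c' k g.
Proof. by rewrite /euler mderivM -!mul_mpolyC mpolyCD; ring. Qed.

Lemma eulerX c k m : euler c k 'X_[m] = ((m k)%:R - c) *: 'X_[m].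
Proof.
rewrite /euler mderivX scalerBl -scalerAr; congr (_ - _).
have [->|mk] := eqVneq (m k) 0%N; first by rewrite !scale0r.
congr (_ *: _); rewrite -mpolyXD; congr mpolyX; apply/mnmP => j.
by rewrite mnmDE mnmBE mnm1E; case: eqP => [<-|_]; lia.
Qed.

Lemma euler_coef c k f m : (euler c k f)@_m = ((m k)%:R - c) * f@_m.
Proof.
elim/mpolyind: f => [|a m' f _ _ IH]; first by rewrite euler0 !mcoeff0 mulr0.
rewrite eulerD eulerZ eulerX [LHS]mcoeffD IH [in RHS]mcoeffD !mcoeffZ mcoeffX.
by case: eqP => [->|_] /=; ring.
Qed.

Lemma euler1 k : euler 0 k 1 = 0.
Proof. by rewrite -mpolyX0 eulerX mnm0E subr0 scale0r. Qed.

Definition laplace c f := \sum_k euler c k (euler c k f).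

Lemma laplace_coef c f m : (laplace c f)@_m = (\sum_k ((m k)%:R - c) ^+ 2) * f@_m.
Proof.
rewrite /laplace raddf_sum mulr_suml; apply: eq_bigr => k _ /=.
by rewrite !euler_coef mulrA expr2.
Qed.

Lemma laplaceM c c' f g : laplace (c + c') (f * g) = laplace c f * g +
  (\sum_k euler c k f * euler c' k g) *+ 2 + f * laplace c' g.
Proof.
rewrite /laplace mulr_suml mulr_sumr -sumrMnl -!big_split; apply: eq_bigr => k _ /=.
by rewrite eulerM eulerD !eulerM; ring.
Qed.

(* The first-order terms of the Laplacian of a product over roots, combined
   through f S = - g d_alpha M. *)
Lemma euler_root_prod (T : eqType) (l : seq T) (f g S : T -> {mpoly K[r]})
    (s a : T -> 'I_r -> K) (c : K) (M : {mpoly K[r]}) :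
  (forall t k, t \in l -> euler (s t k) k (f t) = - (a t k / 2) *: g t) ->
  (forall t, t \in l -> f t * S t = - (g t * \sum_k a t k *: euler c k M)) ->
  (\sum_k euler (\sum_(t <- l) s t k) k (\prod_(t <- l) f t) * euler c k M) *+ 2 =
  (\prod_(t <- l) f t) * \sum_(t <- l) S t.
Proof.
elim: l => [|t l IH] fg fS.
  rewrite !big_nil mulr0 big1 ?mul0rn // => k _.
  by rewrite !big_nil euler1 mul0r.
rewrite !big_cons; set Q := \prod_(_ <- _) _.
have {}IH := IH (fun t' k h => fg t' k (mem_behead (s := t :: l) h))
  (fun t' h => fS t' (mem_behead (s := t :: l) h)).
rewrite mulrDr -[f t * Q * \sum_(_ <- _) _]mulrA -IH -/Q.
have -> : f t * Q * S t = - (Q * (g t * \sum_k a t k *: euler c k M)).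
  by rewrite mulrAC fS ?mem_head // mulNr mulrC.
rewrite [g t * _]mulr_sumr [Q * _]mulr_sumr -sumrN -!sumrMnl [f t * (\sum_k _)]mulr_sumr -big_split.
apply: eq_bigr => k _; rewrite /= ?big_cons eulerM fg ?mem_head // -/Q.
have -> : - (a t k / 2) *: g t = - ((a t k / 2)%:MP * g t) by rewrite scaleNr mul_mpolyC.
have -> : a t k *: euler c k M = ((a t k / 2)%:MP *+ 2) * euler c k M.
  by rewrite -mpolyCMn mul_mpolyC; congr (_ *: _); field.
by ring.
Qed.

Lemma mpoly_eq_nonzero f g : (forall x : 'I_r -> K, nonzero x -> f.@[x] = g.@[x]) -> f = g.
Proof.
move=> fg; apply/eqP; rewrite -subr_eq0; apply/eqP; set h := f - g.
pose row m : 'rV[int]_r := \row_i (m i)%:Z.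
pose mon (nu : 'rV[int]_r) : 'X_{1..r} := [multinom absz (nu 0%R i) | i < r].
have rowK : cancel row mon by move=> m; apply/mnmP => i; rewrite mnmE mxE.
apply/mpolyP => m; rewrite mcoeff0.
have [mh|/memN_msupp_eq0//] := boolP (m \in msupp h).
rewrite -(rowK m); apply: (@zpow_indep _ _ [seq row m | m <- msupp h] (fun nu => h@_(mon nu))).
- by rewrite map_inj_uniq ?msupp_uniq //; apply: can_inj rowK.
- move=> z z0; rewrite big_map.
  have : h.@[z] = 0 by rewrite mevalB fg ?subrr.
  rewrite mevalE => {2}<-; apply: eq_bigr => m' _; rewrite rowK; congr (_ * _).
  by apply: eq_bigr => i _; rewrite mxE.
exact: map_f.
Qed.

End EulerOperators.

Section Alternants.
Variable r : nat.

(** Expanding the entries in the Leibniz formula, each as a choice between u and -v, gives the sum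
    over the signs. *)
Lemma det_sub_weyl (R : comNzRingType) (u v : 'I_r -> 'I_r -> R) :
  \det (\matrix_(i, j) (u i j - v i j)) = \sum_(s : weyl r) (-1) ^+ s.1 *
    \prod_i ((-1) ^+ s.2 i * (if s.2 i then v i (s.1 i) else u i (s.1 i))).
Proof.
rewrite -(pair_bigA _ (fun (p : 'S_r) (e : {ffun 'I_r -> bool}) => (-1) ^+ p *
  \prod_i ((-1) ^+ e i * (if e i then v i (p i) else u i (p i))))) /=.
apply: eq_bigr => p _; rewrite -mulr_sumr; congr (_ * _).
rewrite -(bigA_distr_bigA (fun (i : 'I_r) (b : bool) => (-1) ^+ b * (if b then v i (p i) else u i (p i)))).
apply: eq_bigr => i _; rewrite mxE big_bool /= expr1 expr0 mulN1r mul1r addrC.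
by [].
Qed.

Variable K : numFieldType.
Implicit Types a b : 'I_r -> nat.

(** If a_j + b_j = 2 c for all j, this is the alternating sum over the Weyl orbit of (b - a) / 2,
    times the monomial with all exponents c. *)
Definition alternant a b : {mpoly K[r]} := \det (\matrix_(i, j) ('X_i ^+ a j - 'X_i ^+ b j)).

Definition alt_mon a b (s : weyl r) : 'X_{1..r} :=
  [multinom (if s.2 i then b (s.1 i) else a (s.1 i)) | i < r].

Lemma alternantE a b : alternant a b =
  \sum_(s : weyl r) ((-1) ^+ s.1 * \prod_i (-1) ^+ s.2 i) *: 'X_[alt_mon a b s].
Proof.
rewrite /alternant det_sub_weyl; apply: eq_bigr => s _.
rewrite big_split /= mulrA mpolyXE_id -mul_mpolyC; congr (_ * _).
  rewrite rmorphM rmorphXn rmorphN1 rmorph_prod; congr (_ * _).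
  by apply: eq_bigr => i _; rewrite rmorphXn rmorphN1.
by apply: eq_bigr => i _; rewrite mnmE; case: (s.2 i).
Qed.

Lemma alternant_coef_neq0 a b m : (alternant a b)@_m != 0 -> exists s, m = alt_mon a b s.
Proof.
move=> am; have [s /eqP->|no] := pickP (fun s => m == alt_mon a b s); first by exists s.
case/eqP: am; rewrite alternantE raddf_sum big1 // => s _ /=.
by rewrite mcoeffZ mcoeffX eq_sym no mulr0.
Qed.

Lemma alternant_eval a b (x : 'I_r -> K) :
  (alternant a b).@[x] = \det (\matrix_(i, j) (x i ^+ a j - x i ^+ b j)).
Proof.
rewrite -det_map_mx; congr (\det _); apply/matrixP => i j; rewrite !mxE.
by rewrite rmorphB !rmorphXn /= !mevalXU.
Qed.

(** The monomial with exponents a comes from the identity alone: values of b are too large, and a is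
    injective. *)
Lemma alternant_neq0 a b :
  injective a -> (forall i j, a i < b j)%N -> alternant a b != 0.
Proof.
move=> aI ab; pose s0 : weyl r := (1%g, [ffun=> false]).
apply/eqP => /(congr1 (mcoeff (alt_mon a b s0))) /eqP.
rewrite mcoeff0 alternantE raddf_sum (bigD1 s0) //= [X in _ + X]big1 ?addr0 => [|s ss0].
  rewrite mcoeffZ mcoeffX eqxx mulr1 odd_perm1 expr0 mul1r big1 ?oner_eq0 // => i _.
  by rewrite ffunE.
rewrite mcoeffZ mcoeffX; case: eqP => [e|]; last by rewrite mulr0.
case/eqP: ss0; have es i : (if s.2 i then b (s.1 i) else a (s.1 i)) = a i.
  have := congr1 (fun m : 'X_{1..r} => m i) e; rewrite /alt_mon !mnmE /= ffunE.
  by rewrite perm1.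
have s2 i : s.2 i = false.
  by apply/negP => si; have := es i; rewrite si => h; have := ab i (s.1 i); rewrite h ltnn.
case: s e es s2 => p f /= _ es s2; congr (_, _); last by apply/ffunP => i; rewrite ffunE s2.
by apply/permP => i; rewrite perm1; apply: aI; rewrite -[RHS]es s2.
Qed.

End Alternants.

Section RootPolynomials.
Variables (K : numFieldType) (r : nat).
Implicit Types (t : proot r) (x : 'I_r -> K).

(* With X_i standing for e^(-e_i), [root_minus t] and [root_plus t] are the
   products of e^(alpha/2) -+ e^(-alpha/2) with the monomial of exponents
   [root_shift t]. *)
Definition root_minus t : {mpoly K[r]} :=
  match t with
  | inl i => 1 - 'X_i
  | inr (i, j, true) => 1 - 'X_i * 'X_j
  | inr (i, j, false) => 'X_j - 'X_i
  end.

Definition root_plus t : {mpoly K[r]} :=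
  match t with
  | inl i => 1 + 'X_i
  | inr (i, j, true) => 1 + 'X_i * 'X_j
  | inr (i, j, false) => 'X_i + 'X_j
  end.

Definition root_shift t k : K :=
  match t with
  | inl i => 2^-1 * (i == k)%:R
  | inr (i, j, _) => 2^-1 * ((i == k)%:R + (j == k)%:R)
  end.

Lemma basis_wt_intr (i k : 'I_r) : (basis_wt i 0 k)%:~R = (i == k)%:R :> K.
Proof. by rewrite mxE eqxx eq_sym; case: eqP. Qed.

Lemma basis_wtN_intr (i k : 'I_r) : ((- basis_wt i) 0 k)%:~R = - (i == k)%:R :> K.
Proof. by rewrite mxE rmorphN /= basis_wt_intr. Qed.

(** The derivative of e^(alpha/2) - e^(-alpha/2) is alpha_k / 2 times e^(alpha/2) + e^(-alpha/2);
    the sign is due to X_i standing for e^(-e_i). *)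
Lemma root_poly_euler t k : proot_valid t ->
  euler (root_shift t k) k (root_minus t) = - ((proot_wt t 0 k)%:~R / 2) *: root_plus t.
Proof.
have eB c f g : euler c k (f - g) = euler c k f - euler c k g :> {mpoly K[r]}.
  by rewrite eulerD -scaleN1r eulerZ scaleN1r.
have e1 c : euler c k 1 = - c *: 1 :> {mpoly K[r]}.
  by rewrite -mpolyX0 eulerX mnm0E sub0r.
have eX c i : euler c k 'X_i = ((i == k)%:R - c) *: 'X_i :> {mpoly K[r]}.
  by rewrite eulerX mnm1E.
have eXX c i j : euler c k ('X_i * 'X_j) = ((i == k)%:R + (j == k)%:R - c) *: ('X_i * 'X_j)
    :> {mpoly K[r]}.
  by rewrite -mpolyXD eulerX mnmDE !mnm1E natrD.
case: t => [i|[[i j] []]] /= ij; rewrite eB ?e1 ?eX ?eXX.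
- rewrite basis_wt_intr; case: (i == k) => /=; apply/mpolyP => m;
    rewrite !(mcoeffD, mcoeffN, mcoeffZ); by field.
- rewrite mxE intrD !basis_wt_intr.
  have : ~~ ((i == k) && (j == k)).
    by apply: contraTN ij => /andP[/eqP-> /eqP->]; rewrite ltnn.
  case: (i == k); case: (j == k) => //= _; apply/mpolyP => m;
    rewrite !(mcoeffD, mcoeffN, mcoeffZ); by field.
rewrite mxE intrD basis_wtN_intr basis_wt_intr.
have : ~~ ((i == k) && (j == k)).
  by apply: contraTN ij => /andP[/eqP-> /eqP->]; rewrite ltnn.
case: (i == k); case: (j == k) => //= _; apply/mpolyP => m;
  rewrite !(mcoeffD, mcoeffN, mcoeffZ); by field.
Qed.

(** The root e_k contributes 1/2, as does each of the 2r - 2 positive roots with another nonzero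
    coordinate besides k. The total is the midpoint of the exponents j and 2r - 1 - j of the
    denominator. *)
Lemma sum_root_shift k : \sum_(t | proot_valid t) root_shift t k = r%:R - 2^-1.
Proof.
rewrite big_proot /= (bigD1 k) //= eqxx big1 ?addr0 => [|i /negPf->]; last by rewrite mulr0.
have -> : \sum_(ij : 'I_r * 'I_r | (ij.1 < ij.2)%N)
   (2^-1 * ((ij.1 == k)%:R + (ij.2 == k)%:R) + 2^-1 * ((ij.1 == k)%:R + (ij.2 == k)%:R)) =
   \sum_(ij : 'I_r * 'I_r | (ij.1 < ij.2)%N) ((ij.1 == k)%:R + (ij.2 == k)%:R) :> K.
  by apply: eq_bigr => ij _; field.
have := big_triangular +%R (fun i j : 'I_r => (i == k)%:R : K).
have e : \sum_(i < r) (i == k)%:R = 1 :> K.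
  by rewrite (bigD1 k) //= eqxx big1 ?addr0 // => i /negPf->.
rewrite e /=; under eq_bigr do rewrite sumr_const card_ord.
rewrite sumrMnl e => ->; by field.
Qed.

Lemma root_minus_prod : \prod_(t | proot_valid t) root_minus t =
  alternant K (fun j : 'I_r => j) (fun j => r.*2 - j.+1)%N.
Proof.
apply: mpoly_eq_nonzero => x x0; rewrite alternant_eval weyl_denominator //.
rewrite rmorph_prod big_proot /=; congr (_ * _).
  by apply: eq_bigr => i _; rewrite rmorphB rmorph1 /= mevalXU.
by apply: eq_bigr => ij _; rewrite !rmorphB rmorph1 rmorphM /= !mevalXU.
Qed.

(** With B = e^(-alpha) A both sides are e^(alpha/2) (1 - e^(-2 alpha)) A, up to the monomial of
    [root_shift]. *)
Lemma root_poly_relation t (A B : {mpoly K[r]}) :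
  (forall x, nonzero x -> B.@[x] = zpow (proot_wt t) x * A.@[x]) ->
  root_minus t * (A + B) = root_plus t * (A - B).
Proof.
move=> AB; apply: mpoly_eq_nonzero => x x0.
rewrite !rmorphM rmorphD rmorphB /= AB //; move: A.@[x] => {AB A B}A.
case: t => [i|[[i j] []]] /=;
  rewrite ?(zpowD, zpowN) // !zpow_basis !(rmorphD, rmorphN, rmorphM, rmorph1) /= !mevalXU.
- by ring.
- by ring.
by field; rewrite x0.
Qed.

(** The exponents of each monomial are c +- (b_j - a_j) / 2 in some order, so their squared
    distances to c have the same sum. *)
Lemma laplace_alternant a b (c : K) : (forall j, (a j)%:R + (b j)%:R = c *+ 2) ->
  laplace c (alternant K a b) =
  (\sum_(j < r) ((b j)%:R - (a j)%:R) ^+ 2 / 4) *: alternant K a b.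
Proof.
move=> abc; apply/mpolyP => m; rewrite laplace_coef mcoeffZ.
have [->|/alternant_coef_neq0[s ->]] := eqVneq (alternant K a b)@_m 0; first by rewrite !mulr0.
congr (_ * _); rewrite [RHS](reindex_perm s.1); apply: eq_bigr => k _ /=.
have e : c = ((a (s.1 k))%:R + (b (s.1 k))%:R) / 2 by rewrite abc; field.
by rewrite mnmE e; case: (s.2 k); field.
Qed.

End RootPolynomials.

(** * The character formula *)

Section RadialPart.
Variables (K : numClosedFieldType) (r : nat) (V : so_rep K r).
Local Notation n := (r.*2.+1).
Local Notation d := (so_dim V).
Local Notation wt_t := 'rV[int]_r.
Variable P : 'I_d -> 'I_d -> {mpoly K[n * n]}.
Hypothesis PE : forall i j g, in_SO g -> V g i j = (P i j).@[fun k => mxvec g 0 k].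
Variables (wts : seq wt_t) (p : wt_t -> 'M[K]_d).
Hypothesis wp : weight_projections wts p.
Variable N : nat.
Hypothesis wts_le : forall nu, nu \in wts -> forall i, `|nu 0 i| <= N%:Z.
Implicit Types (Z : 'M[K]_d) (nu mu : wt_t) (x : 'I_r -> K).

Lemma wts_absz nu i : nu \in wts ->
  (absz (N%:Z - nu 0 i)%R)%:Z = N%:Z - nu 0 i /\ (absz (N%:Z + nu 0 i)%R)%:Z = N%:Z + nu 0 i.
Proof.
move=> /wts_le/(_ i); rewrite ler_norml => /andP[le1 le2].
by split; apply: gez0_abs; rewrite ?subr_ge0 // addrC -[N%:Z]opprK subr_ge0.
Qed.

Definition wt_mon nu : 'X_{1..r} := [multinom absz (N%:Z - nu 0%R i)%R | i < r].

(** The function t -> tr (V t Z) on the torus, as a polynomial in X_i = 1/t_i after multiplication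
    by the N-th powers of the X_i. For Z = 1 it is the character. *)
Definition gen Z : {mpoly K[r]} := \sum_(nu <- wts) \tr (p nu *m Z) *: 'X_[wt_mon nu].

Lemma genD Z Z' : gen (Z + Z') = gen Z + gen Z'.
Proof.
by rewrite /gen -big_split; apply: eq_bigr => nu _; rewrite mulmxDr mxtraceD scalerDl.
Qed.

Lemma genZ c Z : gen (c *: Z) = c *: gen Z.
Proof.
rewrite /gen scaler_sumr; apply: eq_bigr => nu _.
by rewrite -scalemxAr mxtraceZ scalerA.
Qed.

Lemma gen_sum (I : Type) (s : seq I) (Q : pred I) (F : I -> 'M[K]_d) :
  gen (\sum_(i <- s | Q i) F i) = \sum_(i <- s | Q i) gen (F i).
Proof.
elim/big_rec2: _ => [|i A B _ <-]; last by rewrite genD.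
by rewrite -[X in gen X](scale0r 0) genZ scale0r.
Qed.

Lemma gen_eval Z x : nonzero x ->
  (gen Z).@[x] = (\prod_i x i ^+ N) * \tr (V (torus (fun k => (x k)^-1)) *m Z).
Proof.
move=> x0; have xV : nonzero (fun k => (x k)^-1) by move=> k; rewrite invr_eq0.
rewrite (trace_torus wp) // rmorph_sum mulr_sumr /= big_seq [RHS]big_seq.
apply: eq_bigr => nu nuw; rewrite mevalZ mevalX mulrA mulrC; congr (_ * _).
rewrite /zpow -big_split; apply: eq_bigr => i _; rewrite mnmE /=.
by rewrite exprnP (wts_absz i nuw).1 expfzDr // -invr_expz expfV.
Qed.

Lemma proj_cartan k nu : p nu *m cartan P k = (nu 0 k)%:~R *: p nu.
Proof.
rewrite (cartanE PE wp) mulmx_sumr; have [_ pout _] := wp.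
rewrite (sum_weights_single wp (nu := nu)) => [|mu ne|/pout->].
- by rewrite -scalemxAr (proj_mul wp) eqxx.
- by rewrite -scalemxAr (proj_mul wp) eq_sym (negPf ne) scaler0.
by rewrite mul0mx.
Qed.

Lemma euler_gen k Z : euler N%:R k (gen Z) = - gen (cartan P k *m Z).
Proof.
rewrite /gen euler_sum -sumrN big_seq [RHS]big_seq; apply: eq_bigr => nu nuw.
rewrite eulerZ eulerX scalerA mulmxA proj_cartan -scalemxAl mxtraceZ -scaleNr.
congr (_ *: _); rewrite mnmE -[_%:R - _]/((_%:Z)%:~R - (N%:Z)%:~R) (wts_absz k nuw).1.
by rewrite rmorphB /=; ring.
Qed.

Lemma gen_shift (E F : 'M[K]_d) alpha x : nonzero x ->
  (forall z, nonzero z -> V (torus z) *m E = zpow alpha z *: (E *m V (torus z))) ->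
  (gen (F *m E)).@[x] = zpow alpha x * (gen (E *m F)).@[x].
Proof.
move=> x0 VE; have xV : nonzero (fun k => (x k)^-1) by move=> k; rewrite invr_eq0.
rewrite (gen_eval _ x0) (gen_eval (E *m F) x0) (mulmxA (V _) E F) (VE _ xV) -scalemxAl mxtraceZ.
rewrite -(mulmxA E) [\tr (E *m _)]mxtrace_mulC -(mulmxA (V _) F) zpowV.
by rewrite [RHS]mulrCA (mulVKf (zpow_neq0 _ x0)).
Qed.

(** The difference of the two traces is a derivative of the character, because [e, f] is a Cartan
    element; [root_poly_relation] passes from it to the sum, the contribution of the root to the
    Casimir operator. *)
Lemma root_relation t : proot_valid t ->
  root_minus K t * (gen (root_e P t *m root_f P t) + gen (root_f P t *m root_e P t)) =
  - (root_plus K t * \sum_k (proot_wt t 0 k)%:~R *: euler N%:R k (gen 1%:M)).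
Proof.
move=> tv.
have -> : \sum_k (proot_wt t 0 k)%:~R *: euler N%:R k (gen 1%:M) =
    - (gen (root_e P t *m root_f P t) - gen (root_f P t *m root_e P t)).
  have <- : gen (root_e P t *m root_f P t - root_f P t *m root_e P t) =
      gen (root_e P t *m root_f P t) - gen (root_f P t *m root_e P t).
    by rewrite genD -scaleN1r genZ scaleN1r.
  rewrite (root_bracket PE tv) gen_sum -sumrN; apply: eq_bigr => k _.
  by rewrite euler_gen mulmx1 genZ scalerN.
rewrite mulrN opprK; apply: root_poly_relation => x x0.
by apply: gen_shift => // z z0; apply: (root_e_torus PE).
Qed.

End RadialPart.

Section CharacterFormula.
Variables (K : numClosedFieldType) (r : nat) (V : so_rep K r).
Local Notation n := (r.*2.+1).
Local Notation d := (so_dim V).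
Local Notation wt_t := 'rV[int]_r.
Hypothesis r_gt0 : (0 < r)%N.
Variable P : 'I_d -> 'I_d -> {mpoly K[n * n]}.
Hypothesis PE : forall i j g, in_SO g -> V g i j = (P i j).@[fun k => mxvec g 0 k].
Variables (wts : seq wt_t) (p : wt_t -> 'M[K]_d).
Hypothesis wp : weight_projections wts p.
Variable N : nat.
Hypothesis wts_le : forall nu, nu \in wts -> forall i, `|nu 0 i| <= N%:Z.
Hypothesis V_irr : irreducible_rep V.
Variable lam : wt_t.
Hypotheses (lam_dom : dominant lam) (V_hw : highest_weight V lam).
Implicit Types (nu mu : wt_t) (x : 'I_r -> K).

Local Notation M := (gen wts p N 1%:M).
Local Notation D := (\prod_(t : proot r | proot_valid t) root_minus K t).
Local Notation C := (r%:R - 2^-1 + N%:R : K).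

Lemma laplace_gen : laplace N%:R M = gen wts p N (\sum_k cartan P k *m cartan P k).
Proof.
rewrite gen_sum; apply: eq_bigr => k _.
rewrite (euler_gen PE wp wts_le) mulmx1 -scaleN1r eulerZ (euler_gen PE wp wts_le).
by rewrite scaleN1r opprK.
Qed.

(** Exponents are centred at r - 1/2 in the denominator and at N in the character, whence the shift
    [C]. In the Leibniz formula the mixed term gives the root part of [casimirE] and the Laplacian
    of the character its Cartan part. *)
Lemma laplace_denominator_gen : exists c, laplace C (D * M) = c *: (D * M).
Proof.
have [c cE] := casimir_scalar PE V_irr.
have [c1 e1] : exists c1, laplace (r%:R - 2^-1 : K) D = c1 *: D.
  rewrite root_minus_prod laplace_alternant => [|j]; first by eexists.
  have jr := ltn_ord j; rewrite -natrD.
  have -> : (j + (r.*2 - j.+1) = r + r - 1)%N by lia.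
  by rewrite natrB ?natrD; [field | lia].
exists (c1 + c); rewrite laplaceM e1 laplace_gen -[D]big_filter.
set l := [seq t <- _ | _].
have lP t : t \in l -> proot_valid t by rewrite mem_filter => /andP[].
pose S (t : proot r) := gen wts p N (root_e P t *m root_f P t) + gen wts p N (root_f P t *m root_e P t).
have e k : \sum_(t <- l) root_shift K t k = r%:R - 2^-1.
  by rewrite /l big_filter sum_root_shift.
have := @euler_root_prod K r _ l (@root_minus K r) (@root_plus K r) S (@root_shift K r)
  (fun t k => (proot_wt t 0 k)%:~R) N%:R M (fun t k h => root_poly_euler K k (lP t h))
  (fun t h => root_relation PE wp wts_le (lP t h)).
rewrite (eq_bigr (fun k => euler (r%:R - 2^-1) k (\prod_(t <- l) root_minus K t) * euler N%:R k M));
  last by move=> k _; rewrite e.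
move=> ->; rewrite -addrA -mulrDr addrC.
have -> : \sum_(t <- l) S t + gen wts p N (\sum_k cartan P k *m cartan P k) = c *: M.
  have -> : c *: M = gen wts p N (casimir P) by rewrite cE -[c%:M]scalemx1 genZ.
  rewrite casimirE genD addrC; congr (_ + _).
  rewrite /l big_filter gen_sum; apply: eq_bigr => t _.
  by rewrite genD.
by rewrite -scalerAr -scalerAl -scalerDl addrC.
Qed.

(** The alternant of mu + rho: the exponents are C -+ (mu_j + r - 1/2 - j), with j counted from 0.
    It may vanish if mu is not dominant; [absz] changes nothing for mu in [wts]. *)
Definition alt_wt mu := alternant K (fun j => absz (N%:Z - mu 0%R j)%R + j)%N
  (fun j => absz (N%:Z + mu 0%R j)%R + (r.*2 - j.+1))%N.

(** By Weyl invariance the character can be expanded in the weights s mu within the term of the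
    denominator for s, where the exponents combine to s (mu + rho). *)
Lemma alt_wt_sum : D * M = \sum_(mu <- wts) \tr (p mu) *: alt_wt mu.
Proof.
apply: mpoly_eq_nonzero => x x0.
have xV : nonzero (fun k => (x k)^-1) by move=> k; rewrite invr_eq0.
rewrite mevalM root_minus_prod (gen_eval wp wts_le _ x0) mulmx1 /= alternant_eval.
rewrite det_sub_weyl mulr_suml rmorph_sum /=.
under [RHS]eq_bigr do rewrite mevalZ /alt_wt alternant_eval det_sub_weyl mulr_sumr.
rewrite exchange_big; apply: eq_bigr => s _ /=.
set w := fun k => (x k)^-1 in xV *.
have -> : \tr (V (torus w)) = \sum_(mu <- wts) zpow (weyl_act s mu) w * \tr (p mu).
  rewrite -(eq_torus (weyl_ptK s w)) (trace_weyl V s (weyl_pt_inv_nonzero s xV)).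
  have := trace_torus wp 1%:M (weyl_pt_inv_nonzero s xV); rewrite mulmx1 => ->.
  apply: eq_bigr => mu _; rewrite mulmx1 -(zpow_weyl s) (eq_zpow _ (weyl_ptK s w)); congr (_ * _).
rewrite !mulr_sumr big_seq [RHS]big_seq; apply: eq_bigr => mu muw.
rewrite -[LHS]mulrA [RHS]mulrCA; congr (_ * _); rewrite [in LHS]mulrA mulrA [RHS]mulrC; congr (_ * _).
rewrite /zpow -!big_split; apply: eq_bigr => i _ /=.
rewrite [in LHS]mxE -!mulrA; congr (_ * _).
have [] := wts_absz wts_le (s.1 i) muw.
rewrite /w; case: (s.2 i) => e1 e2; rewrite ?expr1 ?expr0 ?mulN1r ?mul1r exprD !exprnP ?e1 ?e2 expfzDr //.
  by rewrite -expfV -invr_expz invrK; ring.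
by rewrite -expfV -invr_expz; ring.
Qed.

Lemma laplace_alt_wt mu : mu \in wts ->
  laplace C (alt_wt mu) = ((rho_norm mu)%:~R / 4) *: alt_wt mu.
Proof.
move=> muw; have e j := wts_absz wts_le j muw.
have castN (m : nat) : m%:R = (m%:Z)%:~R :> K by [].
rewrite laplace_alternant => [|j].
  congr (_ *: _); rewrite /rho_norm rmorph_sum mulr_suml; apply: eq_bigr => j _ /=.
  rewrite !castN -rmorphB -rmorphXn; congr ((_ ^+ _)%:~R / _).
  rewrite !PoszD (e j).1 (e j).2; have := ltn_ord j; lia.
have [] := e j; have jr := ltn_ord j; rewrite !castN -intrD !PoszD => -> ->.
have -> : N%:Z - mu 0 j + j%:Z + (N%:Z + mu 0 j + (r.*2 - j.+1)%:Z) = (N + N + r + r)%:Z - 1.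
  lia.
by rewrite rmorphB /= -!castN !natrD; field.
Qed.

Lemma alt_wt_neq0 : lam \in wts -> alt_wt lam != 0.
Proof.
move=> lw; have [l0 la] := lam_dom; have e j := wts_absz wts_le j lw.
apply: alternant_neq0 => [i j|i j].
  have : injective (fun j : 'I_r => absz (N%:Z - lam 0%R j)%R + j)%N; last by apply.
  move=> {}i {}j eij; apply/val_inj; case: (ltngtP i j) => // ij.
    have := la _ _ (ltnW ij); have := (e i).1; have := (e j).1; lia.
  have := la _ _ (ltnW ij); have := (e i).1; have := (e j).1; lia.
have := (e i).1; have := (e j).2; have := l0 i; have := l0 j.
have := ltn_ord i; have := ltn_ord j; lia.
Qed.

(** The Laplacian multiplies the monomial m by [q m], so an eigenvector lives where [q m] is its
    eigenvalue. Where this is the eigenvalue of lam, only [alt_wt lam] contributes, by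
    [rho_norm_inj]; elsewhere both sides vanish. *)
Lemma weyl_character_gen : D * M = alt_wt lam.
Proof.
have pl := highest_weight_mult1 r_gt0 PE wp V_irr V_hw.
have lw : lam \in wts.
  have [_ pout _] := wp; apply/negPn/negP => /pout p0.
  by move: pl; rewrite p0 mxtrace0 => /esym/eqP; rewrite oner_eq0.
have [c cE] := laplace_denominator_gen.
pose q (m : 'X_{1..r}) := \sum_k ((m k)%:R - C) ^+ 2.
have qE f c' m : laplace C f = c' *: f -> f@_m != 0 -> q m = c'.
  move=> /(congr1 (mcoeff m)); rewrite laplace_coef mcoeffZ -/(q m) => e f0.
  exact: (mulIf f0 e).
have same m : q m = (rho_norm lam)%:~R / 4 -> (D * M)@_m = (alt_wt lam)@_m.
  move=> qm; have [uw _ _] := wp.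
  have cf (a : wt_t -> K) (F : wt_t -> {mpoly K[r]}) :
      (\sum_(mu <- wts) a mu *: F mu)@_m = \sum_(mu <- wts) a mu * (F mu)@_m.
    by rewrite raddf_sum; apply: eq_bigr => mu _; apply: mcoeffZ.
  rewrite alt_wt_sum cf (bigD1_seq lam lw uw) /= pl mul1r.
  rewrite big1_seq ?addr0 // => mu /andP[/eqP ml muw].
  have [p0|p0] := eqVneq (p mu) 0; first by rewrite p0 mxtrace0 mul0r.
  have [->|a0] := eqVneq (alt_wt mu)@_m 0; first by rewrite mulr0.
  case: ml; apply: (rho_norm_inj lam_dom V_hw (proj2 (is_weightE wp mu) p0)).
  apply: (@intr_inj K); apply: (mulIf (x := 4^-1)); first by rewrite invr_eq0 pnatr_eq0.
  by rewrite -qm (qE _ _ _ (laplace_alt_wt muw) a0).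
(* The eigenvalue given by the Casimir operator is identified at a monomial of [alt_wt lam], where
   the product has the same nonzero coefficient. *)
have cl : c = (rho_norm lam)%:~R / 4.
  have [m am] : exists m, (alt_wt lam)@_m != 0.
    have := alt_wt_neq0 lw; rewrite -msupp_eq0; case e: (msupp _) => [//|m s] _.
    by exists m; rewrite -mcoeff_msupp e mem_head.
  have qm := qE _ _ _ (laplace_alt_wt lw) am.
  by rewrite -qm (qE _ _ _ cE) // same.
apply/mpolyP => m; have [/same//|qm] := eqVneq (q m) ((rho_norm lam)%:~R / 4).
have -> : (alt_wt lam)@_m = 0.
  by apply: contraNeq qm => /(qE _ _ _ (laplace_alt_wt lw))->.
by apply: contraNeq qm => /(qE _ _ _ cE)->; rewrite cl.
Qed.

End CharacterFormula.

(** * The formula on the torus in terms of square roots *)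

Section TorusFormula.
Variables (K : numClosedFieldType) (r : nat) (V : so_rep K r) (lam : 'rV[int]_r).
Hypotheses (r_gt0 : (0 < r)%N) (V_irr : irreducible_rep V).
Hypotheses (lam_dom : dominant lam) (V_hw : highest_weight V lam).

(* These are the doubles of the entries of rho and of lam + rho. *)
Definition rho2 (j : 'I_r) : nat := r.*2 - j.*2.+1.
Definition ell2 (j : 'I_r) : nat := (absz (lam 0%R j)).*2 + rho2 j.

Lemma det_scale_rows (d : 'I_r -> K) (A : 'I_r -> 'I_r -> K) :
  \det (\matrix_(i, j) (d i * A i j)) = (\prod_i d i) * \det (\matrix_(i, j) A i j).
Proof.
have -> : \matrix_(i, j) (d i * A i j) = diag_mx (\row_i d i) *m \matrix_(i, j) A i j.
  by apply/matrixP => i j; rewrite mul_diag_mx !mxE.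
by rewrite det_mulmx det_diag; congr (_ * _); apply: eq_bigr => i _; rewrite mxE.
Qed.

(** Evaluation at X_i = z_i^(-2), that is, at t_i = z_i^2, makes the exponents integral. The row
    factors z_i^(-(2r-1)) and the factors z_i^(-2N) are common to both sides. *)
Lemma weyl_character_torus z : nonzero z ->
  \det (\matrix_(i, j) (z i ^+ ell2 j - (z i)^-1 ^+ ell2 j)) =
  \tr (V (torus (fun k => z k ^+ 2))) *
  \det (\matrix_(i, j) (z i ^+ rho2 j - (z i)^-1 ^+ rho2 j)).
Proof.
move=> z0; have [P PE] := so_rep_polynomials V.
have [wts [p wp]] := weight_projections_exist V.
pose N := \max_(nu <- wts) \max_i absz (nu 0%R i).
have wts_le nu : nu \in wts -> forall i, `|nu 0 i| <= N%:Z.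
  move=> nuw i; rewrite -abszE lez_nat; set nui := absz _.
  apply: leq_trans (leq_bigmax (F := fun i => absz (nu 0%R i)) i) _.
  exact: (leq_bigmax_seq (F := fun nu : 'rV[int]_r => \max_i absz (nu 0%R i))).
have lw : lam \in wts.
  have [_ pout _] := wp; have [/(is_weightE wp) p0 _] := V_hw.
  by apply: contraNT p0 => /pout->.
have := congr1 (fun f => f.@[fun i => (z i ^+ 2)^-1])
  (weyl_character_gen r_gt0 PE wp wts_le V_irr lam_dom V_hw).
have x0 : nonzero (fun i => (z i ^+ 2)^-1) by move=> i; rewrite invr_eq0 expf_neq0.
rewrite /= mevalM root_minus_prod (gen_eval wp wts_le _ x0) mulmx1 !alternant_eval.
rewrite (eq_torus (z := fun k => z k ^+ 2)) => [|k]; last by rewrite invrK.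
have -> : \matrix_(i < r, j < r) ((z i ^+ 2)^-1 ^+ j - (z i ^+ 2)^-1 ^+ (r.*2 - j.+1)) =
    \matrix_(i, j) ((z i)^-1 ^+ r.*2.-1 * (z i ^+ rho2 j - (z i)^-1 ^+ rho2 j)).
  apply/matrixP => i j; rewrite !mxE -exprVn -!exprM mulrBr -exprD.
  have jr := ltn_ord j; have -> : r.*2.-1 = (2 * j + rho2 j)%N by rewrite /rho2; lia.
  have -> : (2 * (r.*2 - j.+1) = 2 * j + rho2 j + rho2 j)%N by rewrite /rho2; lia.
  by rewrite [in RHS]exprD -[in RHS]mulrA -exprMn mulVf // expr1n mulr1.
set E := \matrix_(i, j) (_ - _).
have -> : E = \matrix_(i, j) (((z i)^-1 ^+ r.*2.-1 * (z i ^+ 2)^-1 ^+ N)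
   * (z i ^+ ell2 j - (z i)^-1 ^+ ell2 j)).
  apply/matrixP => i j; rewrite !mxE -exprVn -!exprM -exprD mulrBr -exprD.
  have [l0 _] := lam_dom; have lj := gez0_abs (l0 j).
  have [] := wts_absz wts_le j lw; have jr := ltn_ord j => e1 e2.
  have -> : (r.*2.-1 + 2 * N = 2 * (absz (N%:Z - lam 0%R j)%R + j) + ell2 j)%N.
    by rewrite /ell2 /rho2; lia.
  have -> : (2 * (absz (N%:Z + lam 0%R j)%R + (r.*2 - j.+1)) =
      2 * (absz (N%:Z - lam 0%R j)%R + j) + ell2 j + ell2 j)%N.
    by rewrite /ell2 /rho2; lia.
  by rewrite [in RHS]exprD -[in RHS]mulrA -exprMn mulVf // expr1n mulr1.
rewrite !det_scale_rows big_split /= => e.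
set D := \prod_i _ in e; set D' := \prod_i _ in e.
have D0 : D * D' != 0.
  by rewrite mulf_neq0 //; apply/prodf_neq0 => i _; rewrite expf_neq0 ?invr_eq0 ?expf_neq0.
by apply: (mulfI D0); rewrite -e; ring.
Qed.

End TorusFormula.

(** * Wedge products of powers *)

Section WedgeDeterminant.
Variables (K : fieldType) (r : nat).
Local Notation n := (r.*2.+1).
Implicit Types (A : 'I_r -> 'M[K]_n) (pp : {ffun 'I_r -> 'I_n * 'I_n}).

Lemma wedgeE A pp : wedge A pp = \det (\matrix_(k, i) A i (pp k).1 (pp k).2).
Proof.
rewrite /wedge sum_ffunE; apply: eq_bigr => t _; rewrite !ffunE.
by congr (_ * _); apply: eq_bigr => k _; rewrite mxE.
Qed.

Lemma weyl_signE (s : weyl r) : weyl_sign s = (-1) ^+ s.1 * \prod_i (-1) ^+ s.2 i.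
Proof.
rewrite /weyl_sign -det_tr.
have -> : (lin1_mx (@weyl_act int r s))^T = diag_mx (\row_i (-1) ^+ s.2 i) *m perm_mx s.1.
  by apply/matrixP => i j; rewrite mul_diag_mx !mxE eqxx eq_sym; case: eqP.
rewrite det_mulmx det_diag det_perm mulrC; congr (_ * _).
by apply: eq_bigr => i _; rewrite mxE.
Qed.

Lemma weyl_sum_wedge (h : 'M[K]_n) (l : 'rV[rat]_r) :
  weyl_sum h l = wedge (fun i => half_pow h (l 0 i) - half_pow h (- l 0 i)).
Proof.
apply/ffunP => pp; rewrite wedgeE /weyl_sum sum_ffunE.
transitivity (\det (\matrix_(k, i) (half_pow h (l 0 i) (pp k).1 (pp k).2 -
  half_pow h (- l 0 i) (pp k).1 (pp k).2))); last first.
  by congr (\det _); apply/matrixP => k i; rewrite !mxE.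
rewrite det_sub_weyl; apply: eq_bigr => s _.
rewrite ffunMzE !ffunE weyl_signE -mulrzr rmorphM rmorph_sign rmorph_prod mulrC -mulrA -big_split.
congr (_ * _); apply: eq_bigr => i _ /=; rewrite rmorph_sign mxE.
by case: (s.2 i); rewrite ?mul1r ?mulN1r.
Qed.

End WedgeDeterminant.

Section Density.
Variables (K : numClosedFieldType) (r : nat).
Local Notation n := (r.*2.+1).
Implicit Types (g h Q : 'M[K]_n) (t : 'I_r -> K) (e : 'I_r -> nat).
Implicit Types pp : {ffun 'I_r -> 'I_n * 'I_n}.

(** This is h^m - h^(-m) for h in SO; with [adj h] for the inverse, the entries are polynomial in
    those of h. *)
Definition power_diff h m : 'M[K]_n := h ^+ m - adj h ^+ m.

Lemma conj_torusX Q t m : in_SO Q ->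
  (Q *m torus t *m adj Q) ^+ m = Q *m torus (fun k => t k ^+ m) *m adj Q.
Proof.
move=> QS; elim: m => [|m IH].
  by rewrite expr0 (eq_torus (z := fun=> 1)) // torus1 mulmx1 SO_mul_adj.
rewrite exprS IH -[_ * _]/(_ *m _); move: (adj Q) (SO_adjK QS) => Q' QQ'.
rewrite (mulmxA _ (Q *m _)) (mulmxA _ Q) -(mulmxA _ Q' Q) QQ' mulmx1 -(mulmxA Q) torusM.
by congr (_ *m _ *m _); apply: eq_torus => k; rewrite exprS.
Qed.

Lemma adj_conj_torus Q t :
  adj (Q *m torus t *m adj Q) = Q *m torus (fun k => (t k)^-1) *m adj Q.
Proof. by rewrite adjM adjK adjM adj_torus mulmxA. Qed.

Lemma conj_torus_entry Q t a b : (Q *m torus t *m adj Q) a b =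
  \sum_c torus_ev t c * (Q a c * adj Q c b).
Proof.
rewrite torus_diag mul_mx_diag [LHS]mxE; apply: eq_bigr => c _.
by rewrite [X in X * _]mxE [(\row__ _) 0 c]mxE; ring.
Qed.

(** The eigenvalue 1 contributes nothing and inverse eigenvalues contribute opposite values. Only r
    terms remain, which is why the r x r matrices below factor through r x r matrices. *)
Lemma power_diff_conj_torus Q t m a b : in_SO Q ->
  power_diff (Q *m torus t *m adj Q) m a b =
  \sum_k (Q a (x_idx k) * adj Q (x_idx k) b - Q a (y_idx k) * adj Q (y_idx k) b) *
    (t k ^+ m - (t k)^-1 ^+ m).
Proof.
move=> QS; rewrite /power_diff adj_conj_torus !conj_torusX //.
rewrite [LHS]mxE [X in _ + X]mxE !conj_torus_entry -sumrB big_idx /= !torus_evE subrr addr0.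
rewrite -big_split; apply: eq_bigr => k _ /=; rewrite !torus_evE !exprVn invrK.
by ring.
Qed.

Lemma power_diff_det_conj_torus e pp Q t : in_SO Q ->
  \det (\matrix_(k, i) power_diff (Q *m torus t *m adj Q) (e i) (pp k).1 (pp k).2) =
  \det (\matrix_(k, m) (Q (pp k).1 (x_idx m) * adj Q (x_idx m) (pp k).2 -
                        Q (pp k).1 (y_idx m) * adj Q (y_idx m) (pp k).2)) *
  \det (\matrix_(m, i) (t m ^+ e i - (t m)^-1 ^+ e i)).
Proof.
move=> QS; rewrite -det_mulmx; congr (\det _); apply/matrixP => k i.
rewrite [LHS]mxE [RHS]mxE power_diff_conj_torus //; apply: eq_bigr => m _.
by rewrite [X in _ = X * _]mxE [X in _ = _ * X]mxE.
Qed.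

Lemma curve_exp c m : curve c -> curve (fun s => (c s : 'M[K]_n) ^+ m).
Proof.
move=> cP; elim: m => [|m IH] i j; first exact: polyfun_cst.
by apply: polyfun_eq (curve_mul cP IH i j) => s; rewrite exprS.
Qed.

Lemma curve_power_diff c m : curve c -> curve (fun s => power_diff (c s) m).
Proof.
move=> cP i j; apply: polyfun_eq (polyfun_add (curve_exp m cP i j)
  (polyfun_opp (curve_exp m (curve_adj cP) i j))) => s.
by rewrite /power_diff [RHS]mxE [X in _ = _ + X]mxE.
Qed.

Lemma polyfun_trace (V : so_rep K r) c : curve c -> (forall s, in_SO (c s)) ->
  polyfun (fun s => \tr (V (c s))).
Proof.
move=> cP cS; have [P PE] := so_rep_polynomials V.
apply: polyfun_sum => i _.
apply: (polyfun_eq (f := fun s => (P i i).@[fun k => mxvec (c s) 0 k])) => [s|].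
  by rewrite PE.
apply: polyfun_meval => k; case/mxvec_indexP: k => a b.
by apply: polyfun_eq (cP a b) => s; rewrite mxvecE.
Qed.

Lemma weyl_character_power (V : so_rep K r) (lam : 'rV[int]_r) h pp :
  (0 < r)%N -> irreducible_rep V -> dominant lam -> highest_weight V lam -> in_SO h ->
  \det (\matrix_(k, i) power_diff h (ell2 lam i) (pp k).1 (pp k).2) =
  \tr (V (h *m h)) * \det (\matrix_(k, i) power_diff h (rho2 i) (pp k).1 (pp k).2).
Proof.
move=> r_gt0 V_irr lam_dom V_hw hS; apply/eqP; rewrite -subr_eq0; apply/eqP.
pose D (e : 'I_r -> nat) g := \det (\matrix_(k, i) power_diff g (e i) (pp k).1 (pp k).2).
rewrite -/(D (ell2 lam) h) -/(D (@rho2 r) h); move: h hS.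
have DP e c : curve c -> polyfun (fun s => D e (c s)).
  move=> cP; apply: polyfun_det => k i.
  by apply: polyfun_eq (curve_power_diff (e i) cP (pp k).1 (pp k).2) => s; rewrite [RHS]mxE.
apply: (SO_conj_torus_dense r_gt0 (F := fun g => D (ell2 lam) g - \tr (V (g *m g)) * D (@rho2 r) g)).
  move=> c cP cS; apply: polyfun_add; first exact: DP.
  apply: polyfun_opp; apply: polyfun_mul; last exact: DP.
  by apply: polyfun_trace => [|s]; [exact: (curve_mul cP cP) | exact: (SOM (cS s) (cS s))].
move=> t Q t0 QS; have t20 : nonzero (fun k => t k ^+ 2) by move=> k; rewrite expf_neq0.
rewrite /D !power_diff_det_conj_torus // (weyl_character_torus r_gt0 V_irr lam_dom V_hw t0).
have -> : \tr (V ((Q *m torus t *m adj Q) *m (Q *m torus t *m adj Q))) =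
    \tr (V (torus (fun k => t k ^+ 2))).
  rewrite -[_ *m (_ *m _ *m _)]/(_ ^+ 2) conj_torusX //.
  have tS := torus_SO t20; have aS := SO_adj QS.
  rewrite (so_mapM V (SOM QS tS) aS) (so_mapM V QS tS) mxtrace_mulC mulmxA rep_adjK //.
  by rewrite mul1mx.
by ring.
Qed.

End Density.

Section HalfPowers.
Variables (K : numClosedFieldType) (r : nat) (h : 'M[K]_(r.*2.+1)).
Hypothesis h_SO : in_SO h.

Lemma half_pow_diff (m : nat) (q : rat) : 2 * q = m%:R ->
  half_pow h q - half_pow h (- q) = power_diff h m.
Proof.
move=> qm; rewrite /half_pow mulrN qm -[m%:R]/((m%:Z)%:~R) numqN numq_int /power_diff.
rewrite -invr_expz -exprVn; congr (_ - _ ^+ _).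
have hh : adj h * h = 1 by apply: SO_adjK.
have hU : h \is a GRing.unit by apply/unitrP; exists (adj h); split => //; apply: SO_mul_adj.
by apply: (mulIr hU); rewrite mulVr.
Qed.

End HalfPowers.

Local Open Scope complex_scope.

Theorem theorem3p1 (R : realType) (r : nat) (r_ge1 : (1 <= r)%N)
    (lam : 'rV[int]_r)
    (lam_ge0 : forall i : 'I_r, 0 <= lam 0 i)
    (lam_noninc : forall i j : 'I_r, (i <= j)%N -> lam 0 j <= lam 0 i)
    (V : so_rep R[i] r) (V_irr : irreducible_rep V)
    (V_hw : highest_weight V lam)
    (g h : 'M[R[i]]_(r.*2.+1))
    (g_SO : in_SO g) (h_SO : in_SO h) (h_sqrt : h ^+ 2 = g) :
  let ell : 'rV[rat]_r := map_mx intr lam + rho r in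
  weyl_sum h ell = character V g *: weyl_sum h (rho r)
  /\ wedge (fun i => half_pow h (ell 0 i) - half_pow h (- ell 0 i))
     = character V g *:
       wedge (fun i => half_pow h (rho r 0 i) - half_pow h (- rho r 0 i)).
Proof.
move=> ell; rewrite !weyl_sum_wedge.
suff W : wedge (fun i => half_pow h (ell 0 i) - half_pow h (- ell 0 i)) =
    character V g *: wedge (fun i => half_pow h (rho r 0 i) - half_pow h (- rho r 0 i)).
  by split.
have rhoE i : 2 * rho r 0 i = (rho2 i)%:R.
  have ir := ltn_ord i.
  rewrite mxE /rho2 natrB; last by lia.
  by rewrite -[i.*2.+1]addn1 -[i.+1]addn1 -!muln2 !natrD !natrM; field.
have ellE i : 2 * ell 0 i = (ell2 lam i)%:R.
  rewrite mxE mulrDr rhoE /ell2 natrD; congr (_ + _).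
  by rewrite mxE -[X in X%:~R](gez0_abs (lam_ge0 i)) -muln2 natrM mulrC.
apply/ffunP => pp; rewrite ffunE !wedgeE /character -h_sqrt.
transitivity (\det (\matrix_(k, i) power_diff h (ell2 lam i) (pp k).1 (pp k).2)).
  congr (\det _); apply/matrixP => k i; rewrite [LHS]mxE [RHS]mxE.
  by rewrite (half_pow_diff h_SO (ellE i)).
rewrite (weyl_character_power pp r_ge1 V_irr (conj lam_ge0 lam_noninc) V_hw h_SO).
congr (_ * _); congr (\det _); apply/matrixP => k i; rewrite [LHS]mxE [RHS]mxE.
by rewrite (half_pow_diff h_SO (rhoE i)).
Qed.
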